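(* For every $0$-framed long knot $\mathcal{K}$, the Laurent polynomials $\rho_{1,0}^{\mathcal{K}}$ and $P_1^{\mathcal{K}}$ (defined in the context) are equal.
   Context: **Universal invariant.** A long knot is a framed oriented tangle in $I^3$ with a single open component running upwards from bottom to top. It is represented by a rotational diagram: all crossings are upwards oriented, and maxima and minima occur only in pairs forming full clockwise or counterclockwise rotations of an upwards strand. Let $A$ be a (topological) ribbon Hopf algebra with universal $R$-matrix $R=\sum_i\alpha_i\otimes\beta_i$, inverse $R^{-1}=\sum_i\bar\alpha_i\otimes\bar\beta_i$, and balancing element $\kappa$. Place $\alpha_i$ on the overstrand and $\beta_i$ on the understrand of each positive crossing, $\bar\alpha_i$ on the overstrand and $\bar\beta_i$ on the understrand of each negative crossing, $\kappa$ on each full clockwise rotation and $\kappa^{-1}$ on each full counterclockwise rotation. The universal invariant $Z_A(\mathcal{K})\in A$ is the sum over all indices of the product of the beads, written from right to left in the order in which they are met along the orientation. **Colored Jones polynomial and $P_1^{\mathcal K}$.** Let $k$ be a field of characteristic zero, $[n]_q=\frac{q^n-q^{-n}}{q-q^{-1}}$, and let $U_q(\mathfrak{sl}_2)$ be the $k(q^{1/2})$-algebra generated by $E,F,K^{\pm1}$ with $KEK^{-1}=q^2E$, $KFK^{-1}=q^{-2}F$, $[E,F]=\frac{K-K^{-1}}{q-q^{-1}}$. Let $V_{n-1}$ be the $n$-dimensional module with basis $v_0,\dots,v_{n-1}$ and $Kv_p=q^{n-1-2p}v_p$, $Ev_p=[p]_qv_{p-1}$, $Fv_{p-1}=[n-p]_qv_p$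 (with $Ev_0=0$, $Fv_{n-1}=0$). On $V_{n-1}\otimes V_{n-1}$ the $R$-matrix acts by $R=\sum_{m\ge0}\frac{(q-q^{-1})^m}{[m]_q!}q^{\frac{m(m-1)}2}q^{\frac{H\otimes H}{2}}E^m\otimes F^m$, where $q^{\frac{H\otimes H}{2}}v_i\otimes v_j=q^{\frac12(n-1-2i)(n-1-2j)}v_i\otimes v_j$, and the balancing element is $\kappa=K$. Let $RT_{V_{n-1}}(\mathcal K)\in\mathrm{End}(V_{n-1})$ be the action of the universal invariant built from these data. The colored Jones polynomial $J^n_{\mathcal K}(q)$ is defined by $[n]_qJ^n_{\mathcal K}(q)=\mathrm{tr}^{V_{n-1}}\big(K\,RT_{V_{n-1}}(\mathcal K)\big)$. Let $\Delta_{\mathcal K}$ be the Alexander polynomial of $\mathcal K$, normalized by $\Delta_{\mathcal K}(t)=\Delta_{\mathcal K}(t^{-1})$, $\Delta_{\mathcal K}(1)=1$. By a theorem of Rozansky (the large-color expansion) there are symmetric Laurent polynomials $P_i^{\mathcal K}\in\mathbb Z[t,t^{-1}]$, $i\ge0$, with $P_0^{\mathcal K}=1$, such that for all $n\geq 1$ $$J^n_{\mathcal K}(q)=\sum_{i=0}^\infty\frac{P_i^{\mathcal K}(q^{2n})}{\Delta_{\mathcal K}^{2i+1}(q^{2n})}(q^2-1)^i\in\mathbb Q[[q^2-1]].$$ This defines $P_1^{\mathcal K}$. **The algebra $\mathbb D$ and $\rho_{1,0}^{\mathcal K}$.** Let $q_\epsilon=e^{\epsilon h}$ and $\{n\}_{q_\epsilon}=\frac{1-q_\epsilon^n}{1-q_\epsilon}$.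 The topological algebra $\mathbb D$ over $\mathbb Q(\epsilon)[[h]]$ is $h$-adically generated by $\mathbf y,\mathbf b,\mathbf a,\mathbf x$ with relations $\mathbf x\mathbf y=q_\epsilon\mathbf y\mathbf x+\frac{1-\mathbf A\mathbf B}{h}$, $[\mathbf a,\mathbf x]=\mathbf x$, $[\mathbf b,\mathbf x]=\epsilon\mathbf x$, $[\mathbf a,\mathbf y]=-\mathbf y$, $[\mathbf b,\mathbf y]=-\epsilon\mathbf y$, $[\mathbf a,\mathbf b]=0$, where $\mathbf A=e^{-\epsilon h\mathbf a}$, $\mathbf B=e^{-h\mathbf b}$. It is a topological ribbon Hopf algebra with $\Delta(\mathbf x)=1\otimes\mathbf x+\mathbf x\otimes\mathbf A$, $\Delta(\mathbf y)=1\otimes\mathbf y+\mathbf y\otimes\mathbf B$, $\mathbf a,\mathbf b$ primitive, universal $R$-matrix $\mathbf R=\sum_{m,n\ge0}\frac{h^{m+n}}{\{m\}_{q_\epsilon}!\,n!}\mathbf y^m\mathbf b^n\otimes\mathbf a^n\mathbf x^m$, and balancing element $(\mathbf A\mathbf B)^{1/2}$. Its universal invariant is denoted $\mathbf Z_{\mathbb D}(\mathcal K)$. Put $\mathbf t=\mathbf b-\epsilon\mathbf a$ and $\mathbf T=e^{-h\mathbf t}$, which are central, and let $\mathbf W=\mathbf y\mathbf A^{-1}\mathbf x+\frac{q_\epsilon\mathbf A^{-1}+\mathbf A\mathbf T-\frac12(1+\mathbf T)(q_\epsilon+1)}{h(q_\epsilon-1)}$, which is also central. By a theorem of Bar-Natan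 and Van der Veen there are Laurent polynomials $\rho^{\mathcal K}_{k,j}\in\mathbb Z[\mathbf T,\mathbf T^{-1}]$ such that, with $\Delta_{\mathcal K}=\Delta_{\mathcal K}(\mathbf T)$, $$\mathbf Z_{\mathbb D}(\mathcal K)=\frac1{\Delta_{\mathcal K}}\exp\Big(\sum_{k=1}^\infty\epsilon^kh^k\sum_{j=0}^{2k}\rho^{\mathcal K}_{k,j}\frac{h^j\mathbf W^j}{\Delta_{\mathcal K}^{2k-j}}\Big).$$ This defines $\rho_{1,0}^{\mathcal K}$. Equality is as Laurent polynomials in one variable. *)

(* Defs.v *)
From HB Require Import structures.
From mathcomp Require Import all_boot all_order all_algebra.
From mathcomp Require Import finmap boolp.
From mathcomp.multinomials Require Import monalg.
From mathcomp.real_closed Require Import mxtens.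

Set Implicit Arguments.
Unset Strict Implicit.
Unset Printing Implicit Defensive.

Import GRing.Theory.
Local Open Scope ring_scope.

(* Diagrams are read from bottom to top as a sequence of elementary layers.
   The layer (i, e) puts the elementary tangle e on the strands in positions
   i, i+1 (counted from the left, from 0) and vertical strands elsewhere.
   - [Cross pos] is a crossing of two upward strands. If pos, it is positive:
     the strand going from bottom left to top right is the overstrand.
   - [Cap u] is a maximum, [Cup u] a minimum; u says whether the left one of
     the two strands is upward. With u = true both are run through clockwise,
     with u = false counterclockwise. *)
Inductive elem := Cross of bool | Cap of bool | Cup of bool.
Definition layer := (nat * elem)%type.

Definition is_cross (l : layer) := if l.2 is Cross _ then true else false.

(* Orientations (true = up) of the strands above a layer, given those below. *)
Definition layer_boundary (s : seq bool) (l : layer) : option (seq bool) :=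
  let: (i, e) := l in
  match e with
  | Cross _ => if take 2 (drop i s) == [:: true; true] then Some s else None
  | Cap u => if take 2 (drop i s) == [:: u; ~~ u]
             then Some (take i s ++ drop i.+2 s) else None
  | Cup u => if (i <= size s)%N
             then Some (take i s ++ [:: u; ~~ u] ++ drop i s) else None
  end.

Definition top_boundary (D : seq layer) (s : seq bool) : option (seq bool) :=
  foldl (fun o l => obind (layer_boundary^~ l) o) (Some s) D.

(* What a strand meets: a crossing, as the over- or the understrand (crossings
   are named by the index of their layer), or an extremum, clockwise or not. *)
Inductive event := EOver of nat | EUnder of nat | ETurn of bool.

(* The events met from the point in position p at height lev (below layer
   lev), moving upwards if up and downwards otherwise, until the strand
   leaves the diagram or the fuel is spent. *)
Fixpoint walk (D : seq layer) (fuel lev p : nat) (up : bool) : seq event :=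
  if fuel isn't fuel'.+1 then [::] else
  if up then
    if (size D <= lev)%N then [::] else
    let: (i, e) := nth (0%N, Cross true) D lev in
    match e with
    | Cross pos =>
        if p == i then
          (if pos then EOver lev else EUnder lev) :: walk D fuel' lev.+1 i.+1 true
        else if p == i.+1 then
          (if pos then EUnder lev else EOver lev) :: walk D fuel' lev.+1 i true
        else walk D fuel' lev.+1 p true
    | Cap _ =>
        if p == i then ETurn true :: walk D fuel' lev i.+1 false
        else if p == i.+1 then ETurn false :: walk D fuel' lev i false
        else walk D fuel' lev.+1 (if (p < i)%N then p else (p - 2)%N) true
    | Cup _ => walk D fuel' lev.+1 (if (p < i)%N then p else p.+2) true
    end
  else if lev isn't lev'.+1 then [::] else
    let: (i, e) := nth (0%N, Cross true) D lev' in
    match e with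
    | Cross _ => walk D fuel' lev' p false
    | Cap _ => walk D fuel' lev' (if (p < i)%N then p else p.+2) false
    | Cup _ =>
        if p == i then ETurn false :: walk D fuel' lev i.+1 true
        else if p == i.+1 then ETurn true :: walk D fuel' lev i true
        else walk D fuel' lev' (if (p < i)%N then p else (p - 2)%N) false
    end.

(* The strand passes at most once through each of the at most
   (size D).+1 * (2 * size D + 1) points of the levels, so that the fuel is
   never exhausted. *)
Definition events (D : seq layer) : seq event :=
  walk D ((2 * size D).+2 ^ 2) 0 0 true.

Definition event_count (D : seq layer) : nat :=
  sumn [seq (if is_cross l then 2 else 1)%N | l <- D].

Inductive bead := Over of nat | Under of nat | Rot of bool.

(* A strand that runs upwards at the crossings meets maxima and minima
   alternately, a maximum first. The diagram is rotational when each maximum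
   and the minimum that follows it form a full rotation; Rot true is a
   clockwise one. *)
Fixpoint rotations (s : seq event) : option (seq bead) :=
  match s with
  | [::] => Some [::]
  | EOver l :: s' => omap (cons (Over l)) (rotations s')
  | EUnder l :: s' => omap (cons (Under l)) (rotations s')
  | ETurn u :: ETurn v :: s' =>
      if u == v then omap (cons (Rot u)) (rotations s') else None
  | [:: ETurn _ & _] => None
  end.

(* The condition on size (events D) says that the open strand meets everything
   there is in the diagram, i.e. that there is no closed component. *)
Record long_knot := LongKnot {
  diagram :> seq layer;
  diagram_wf : [&& top_boundary diagram [:: true] == Some [:: true],
                   size (events diagram) == event_count diagram
                 & isSome (rotations (events diagram))]
}.

Definition beads (K : long_knot) : seq bead :=
  odflt [::] (rotations (events K)).

(* The framing of a long knot is the blackboard framing of its diagram, which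
   as an integer is the writhe. *)
Definition framing (K : long_knot) : int :=
  \sum_(l <- diagram K)
     (if l.2 is Cross pos then (if pos then 1 else - 1) else 0).

Section UniversalInvariant.
Variables (A : pzRingType) (R Rinv : seq (A * A)) (kappa kappainv : A).

(* R and Rinv list the pairs (alpha_i, beta_i) and (alphabar_i, betabar_i). *)
Definition layer_beads (l : layer) : seq (A * A) :=
  match l.2 with
  | Cross true => R
  | Cross false => Rinv
  | _ => [:: (1, 1)]
  end.

Definition labelings (D : seq layer) : seq (seq (A * A)) :=
  foldr (fun l L => [seq x :: v | x <- layer_beads l, v <- L]) [:: [::]] D.

Definition bead_val (v : seq (A * A)) (b : bead) : A :=
  match b with
  | Over l => (nth (1, 1) v l).1
  | Under l => (nth (1, 1) v l).2
  | Rot cw => if cw then kappa else kappainv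
  end.

Definition universal_invariant (K : long_knot) : A :=
  \sum_(v <- labelings K) \prod_(b <- rev (beads K)) bead_val v b.

End UniversalInvariant.

(* Formal power series, over a possibly noncommutative ring *)
Record fps (R : Type) := Fps { fcoef :> nat -> R }.

HB.instance Definition _ (R : Type) := gen_eqMixin (fps R).
HB.instance Definition _ (R : Type) := gen_choiceMixin (fps R).

Lemma fpsP (R : Type) (f g : fps R) : (forall n, f n = g n) -> f = g.
Proof. by case: f g => [f] [g] /= E; congr Fps; apply: functional_extensionality_dep. Qed.

Section FpsRing.
Variable R : nzRingType.
Implicit Types f g : fps R.

Definition fps_zero : fps R := Fps (fun=> 0).
Definition fps_opp f : fps R := Fps (fun n => - f n).
Definition fps_add f g : fps R := Fps (fun n => f n + g n).

Fact fps_addA : associative fps_add.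
Proof. by move=> f g k; apply: fpsP => n /=; rewrite addrA. Qed.
Fact fps_addC : commutative fps_add.
Proof. by move=> f g; apply: fpsP => n /=; rewrite addrC. Qed.
Fact fps_add0 : left_id fps_zero fps_add.
Proof. by move=> f; apply: fpsP => n /=; rewrite add0r. Qed.
Fact fps_addN : left_inverse fps_zero fps_opp fps_add.
Proof. by move=> f; apply: fpsP => n /=; rewrite addNr. Qed.

HB.instance Definition _ :=
  GRing.isZmodule.Build (fps R) fps_addA fps_addC fps_add0 fps_addN.

Definition fps_cst (c : R) : fps R := Fps (fun n => if n is 0 then c else 0).
Definition fps_mul f g : fps R :=
  Fps (fun n => \sum_(i < n.+1) f i * g (n - i)%N).

Definition fps_trunc N f : {poly R} := \poly_(i < N) f i.

Fact fps_mul_trunc N f g n : (n < N)%N ->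
  fps_mul f g n = (fps_trunc N f * fps_trunc N g)`_n.
Proof.
move=> ltnN; rewrite coefM /=; apply: eq_bigr => i _.
have lein : (i <= n)%N by rewrite -ltnS.
by rewrite !coef_poly (leq_ltn_trans lein ltnN) (leq_ltn_trans (leq_subr _ _)).
Qed.

Fact fps_trunc_mul N f g n (p q : {poly R}) : (n < N)%N ->
  (forall i, (i < N)%N -> p`_i = f i) -> (forall i, (i < N)%N -> q`_i = g i) ->
  (p * q)`_n = (fps_trunc N f * fps_trunc N g)`_n.
Proof.
move=> ltnN pf qg; rewrite !coefM; apply: eq_bigr => i _.
have ltiN : (i < N)%N by apply: leq_trans ltnN; rewrite ltn_ord.
have ltjN : (n - i < N)%N by rewrite (leq_ltn_trans (leq_subr _ _)).
by rewrite !coef_poly ltiN ltjN pf ?qg.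
Qed.

Fact fps_mulA : associative fps_mul.
Proof.
move=> f g k; apply: fpsP => n; rewrite !(@fps_mul_trunc n.+1) //.
transitivity (fps_trunc n.+1 f * (fps_trunc n.+1 g * fps_trunc n.+1 k))`_n.
  symmetry; apply: fps_trunc_mul => // i ltin; first by rewrite coef_poly ltin.
  by rewrite (fps_mul_trunc _ _ ltin).
rewrite mulrA; apply: fps_trunc_mul => // i ltin; last by rewrite coef_poly ltin.
by rewrite (fps_mul_trunc _ _ ltin).
Qed.

Fact fps_mul1l : left_id (fps_cst 1) fps_mul.
Proof.
move=> f; apply: fpsP => n /=.
by rewrite big_ord_recl /= mul1r subn0 big1 ?addr0 // => i _; rewrite mul0r.
Qed.

Fact fps_mul1r : right_id (fps_cst 1) fps_mul.
Proof.
move=> f; apply: fpsP => n /=.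
rewrite big_ord_recr /= subnn mulr1 big1 ?add0r // => i _.
by case: (n - i)%N (subn_gt0 i n) => [|m _]; rewrite ?ltn_ord ?mulr0.
Qed.

Fact fps_mulDl : left_distributive fps_mul fps_add.
Proof.
move=> f g k; apply: fpsP => n /=; rewrite -big_split /=.
by apply: eq_bigr => i _; rewrite mulrDl.
Qed.

Fact fps_mulDr : right_distributive fps_mul fps_add.
Proof.
move=> f g k; apply: fpsP => n /=; rewrite -big_split /=.
by apply: eq_bigr => i _; rewrite mulrDr.
Qed.

Fact fps_1_neq0 : fps_cst 1 != 0.
Proof. by apply/eqP => /(congr1 (fun f : fps R => f 0%N)) /eqP; rewrite oner_eq0. Qed.

HB.instance Definition _ := GRing.Zmodule_isNzRing.Build (fps R)
  fps_mulA fps_mul1l fps_mul1r fps_mulDl fps_mulDr fps_1_neq0.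

Definition fps_X : fps R := Fps (fun n => (n == 1%N)%:R).

(* f / X^m, when X^m divides f *)
Definition fps_divX m f : fps R := Fps (fun n => f (n + m)%N).

(* The sum of the u k for k >= m, when X^k divides u k for all k. *)
Definition fps_sum m (u : nat -> fps R) : fps R :=
  Fps (fun N => \sum_(m <= k < N.+1) u k N).

(* The inverse of a series with constant coefficient 1. *)
Definition fps_inv1 f : fps R := fps_sum 0 (fun k => (1 - f) ^+ k).

End FpsRing.

Arguments fps_X {R}.

Definition fps_map (R S : Type) (phi : R -> S) (f : fps R) : fps S :=
  Fps (fun n => phi (f n)).

(* The inverse of a series with nonzero constant coefficient. *)
Definition fps_inv (K : fieldType) (f : fps K) : fps K :=
  fps_cst (f 0%N)^-1 * fps_inv1 (fps_cst (f 0%N)^-1 * f).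

(* The exponential of a series with zero constant coefficient. *)
Definition fps_exp (K : fieldType) (F : lalgType K) (f : fps F) : fps F :=
  Fps (fun N => \sum_(k < N.+1) ((k`!)%:R^-1 : K) *: (f ^+ k) N).

(* P i is the coefficient of t^i. *)
Definition laurent := {fsfun int -> int with 0}.

Definition laurent_eval (R : nzRingType) (u uinv : R) (P : laurent) : R :=
  \sum_(i <- finsupp P)
     (if i is Negz m then uinv ^+ m.+1 else u ^+ `|i|%N) *~ P i.

Definition laurent_one : laurent := [fsfun i in [fset (0 : int)]%fset => 1 | 0].

Definition laurent_symmetric (P : laurent) := forall i : int, P (- i) = P i.

Definition is_under (b : bead) := if b is Under _ then true else false.

(* The arc on which the j-th bead lies: arcs are numbered from 0 on, in the
   order in which they are met, a new one starting after each undercrossing. *)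
Definition arc_at (K : long_knot) (j : nat) : nat :=
  count is_under (take j (beads K)).

Definition over_arc (K : long_knot) (l : nat) : nat :=
  arc_at K (find (fun b => if b is Over l' then l' == l else false) (beads K)).

Definition under_crossings (K : long_knot) : seq nat :=
  pmap (fun b => if b is Under l then Some l else None) (beads K).

Definition crossing_sign (K : long_knot) (l : nat) : bool :=
  if (nth (0%N, Cross true) K l).2 is Cross false then false else true.

(* The row of the Alexander matrix given by the r-th undercrossing, at the end
   of arc r, is obtained by Fox calculus from its Wirtinger relation:
   x_over x_(r+1) = x_r x_over if the crossing is positive,
   x_(r+1) x_over = x_over x_r if it is negative. *)
Definition alexander_entry (K : long_knot) (r a : nat) : {poly int} :=
  let l := nth 0%N (under_crossings K) r in
  let pos := crossing_sign K l in
  let t_arc := if pos then r.+1 else r in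
  let other_arc := if pos then r else r.+1 in
    (1 - 'X) *+ (a == over_arc K l) + 'X *+ (a == t_arc) - 1 *+ (a == other_arc).

(* There is one more arc than crossings; the column of arc 0 is removed. *)
Definition alexander_minor (K : long_knot) : {poly int} :=
  let c := size (under_crossings K) in
  \det (\matrix_(r < c, a < c) alexander_entry K r a.+1).

Definition is_alexander (K : long_knot) (Delta : laurent) : Prop :=
  [/\ laurent_symmetric Delta,
      laurent_eval (1 : int) 1 Delta = 1
    & exists (b : bool) (m : int),
        let t : {fraction {poly int}} := tofrac 'X in
        laurent_eval t t^-1 Delta
          = (-1) ^+ b * t ^ m * tofrac (alexander_minor K)].

Section ColoredJones.
Variable k : fieldType.

(* k(q^(1/2)) *)
Definition kq := {fraction {poly k}}.
Definition q12 : kq := tofrac 'X.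
Definition q : kq := q12 ^+ 2.

Definition qnum (m : nat) : kq := (q ^+ m - q ^- m) / (q - q^-1).
Definition qfact (m : nat) : kq := \prod_(1 <= i < m.+1) qnum i.

Variable n : nat.

(* Matrices of the module V_(n-1) in the basis v_0, .., v_(n-1): column p is
   the image of v_p. *)
Definition wt (p : nat) : int := n%:Z - 1 - (2 * p)%:Z.
Definition actK : 'M[kq]_n := \matrix_(i, j) (q ^ wt j *+ (i == j)).
Definition actE : 'M[kq]_n := \matrix_(i, j) (qnum j *+ (j == i.+1 :> nat)).
Definition actF : 'M[kq]_n := \matrix_(i, j) (qnum (n - i) *+ (i == j.+1 :> nat)).

(* The R-matrix of V_(n-1) as a sum of pure tensors. As delta_mx i i is the
   projection to v_i, q^(H (x) H / 2) is the sum over i, j of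
   q^(wt i * wt j / 2) delta_mx i i (x) delta_mx j j. The sum over m stops at
   n - 1 because actE ^+ n = 0. *)
Definition Uq_R_term (m : nat) (i j : 'I_n) : 'M[kq]_n * 'M[kq]_n :=
  (((q - q^-1) ^+ m / qfact m * q ^+ 'C(m, 2) * q12 ^ (wt i * wt j))
     *: (delta_mx i i * actE ^+ m),
   delta_mx j j * actF ^+ m).

Definition Uq_R : seq ('M[kq]_n * 'M[kq]_n) :=
  [seq Uq_R_term m ij.1 ij.2 | m <- iota 0 n, ij <- enum {: 'I_n * 'I_n}].

Definition Uq_Rmx : 'M[kq]_(n * n) := \sum_(x <- Uq_R) x.1 *t x.2.

(* The inverse matrix, decomposed along the basis of elementary tensors. *)
Definition Uq_Rinv : seq ('M[kq]_n * 'M[kq]_n) :=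
  [seq (invmx Uq_Rmx (mxtens_index ij) (mxtens_index ij')
          *: delta_mx ij.1 ij'.1, delta_mx ij.2 ij'.2)
     | ij <- enum {: 'I_n * 'I_n}, ij' <- enum {: 'I_n * 'I_n}].

Definition RT (K : long_knot) : 'M[kq]_n :=
  universal_invariant Uq_R Uq_Rinv actK (invmx actK) K.

Definition colored_jones (K : long_knot) : kq := \tr (actK *m RT K) / qnum n.

End ColoredJones.

(* Below, the variable of fps is z = q^2 - 1. *)

(* q^(1/2) = (1 + z)^(1/4), by the binomial series *)
Definition q12_series (k : fieldType) : fps k :=
  Fps (fun n => (\prod_(i < n) (4%:R^-1 - i%:R)) / (n`!)%:R).

Definition poly_series (k : fieldType) (p : {poly k}) : fps k :=
  (map_poly (@fps_cst k) p).[q12_series k].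

(* f in k(q^(1/2)) is regular at q^(1/2) = 1, with expansion g in k[[z]]. *)
Definition has_expansion (k : fieldType) (f : kq k) (g : fps k) : Prop :=
  exists a b : {poly k}, [/\ b != 0, f = tofrac a / tofrac b
                           & poly_series b * g = poly_series a].

(* P (q^(2 n)) in Q[[z]] *)
Definition eval_q2n (n : nat) (P : laurent) : fps rat :=
  let u := (1 + fps_X) ^+ n in laurent_eval u (fps_inv1 u) P.

Definition rozansky_series (Delta : laurent) (P : nat -> laurent) (n : nat)
    : fps rat :=
  fps_sum 0 (fun i =>
    eval_q2n n (P i) * fps_inv1 (eval_q2n n Delta) ^+ (2 * i + 1) * fps_X ^+ i).

(* The property that defines the Laurent polynomials P_i of K. *)
Definition rozansky_expansion (k : fieldType) (K : long_knot) (Delta : laurent)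
    (P : nat -> laurent) : Prop :=
  [/\ P 0%N = laurent_one, forall i, laurent_symmetric (P i)
    & forall n : nat, (1 <= n)%N ->
        has_expansion (colored_jones k n K)
          (fps_map (fun c : rat => ratr c : k) (rozansky_series Delta P n))].

(* Q(eps) *)
Definition Qe : fieldType := {fraction {poly rat}}.
Definition eps : Qe := tofrac 'X.

(* The free Q(eps)-algebra on four letters. The completed free algebra is
   [fps freeD], in the variable h, and D is its quotient by the closed ideal
   generated by the relations. Elements of D are represented by elements of
   [fps freeD] and equality in D is the congruence [D_eq] below. *)
Definition freeD : lalgType Qe := {malg Qe[{fmonom 'I_4}]}.
Definition genD (i : 'I_4) : fps freeD :=
  fps_cst (<< fmu i >> : {malg Qe[{fmonom 'I_4}]}).
Definition y_ : fps freeD := genD (inord 0).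
Definition b_ : fps freeD := genD (inord 1).
Definition a_ : fps freeD := genD (inord 2).
Definition x_ : fps freeD := genD (inord 3).

Definition scal (c : fps Qe) : fps freeD := fps_map (fun e => e%:A) c.
Definition h_ : fps freeD := fps_X.
Definition eps_ : fps freeD := scal (fps_cst eps).

(* q_eps = e^(eps h) *)
Definition q_eps : fps Qe := Fps (fun n => eps ^+ n / (n`!)%:R).

(* {n} = (1 - q_eps^n) / (1 - q_eps) = 1 + q_eps + .. + q_eps^(n-1) *)
Definition qe_num (n : nat) : fps Qe := \sum_(i < n) q_eps ^+ i.
Definition qe_fact (n : nat) : fps Qe := \prod_(1 <= i < n.+1) qe_num i.

Definition A_ : fps freeD := fps_exp (- (eps_ * h_ * a_)).
Definition Ainv : fps freeD := fps_exp (eps_ * h_ * a_).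
Definition B_ : fps freeD := fps_exp (- (h_ * b_)).
Definition t_ : fps freeD := b_ - eps_ * a_.
Definition T_ : fps freeD := fps_exp (- (h_ * t_)).
Definition Tinv : fps freeD := fps_exp (h_ * t_).

Definition half : fps freeD := scal (fps_cst 2%:R^-1).

(* (A B)^(1/2) and its inverse; A and B commute in D *)
Definition kappaD : fps freeD := fps_exp (- (half * h_ * (eps_ * a_ + b_))).
Definition kappaDinv : fps freeD := fps_exp (half * h_ * (eps_ * a_ + b_)).

Definition relations : seq (fps freeD) :=
  [:: x_ * y_ - (scal q_eps * y_ * x_ + fps_divX 1 (1 - A_ * B_));
      a_ * x_ - x_ * a_ - x_;
      b_ * x_ - x_ * b_ - eps_ * x_;
      a_ * y_ - y_ * a_ + y_;
      b_ * y_ - y_ * b_ + eps_ * y_;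
      a_ * b_ - b_ * a_].

(* The difference is in the h-adic closure of the two-sided ideal generated by
   the relations. *)
Definition D_eq (u v : fps freeD) : Prop :=
  forall N : nat, exists s : seq (fps freeD * nat * fps freeD),
    forall n, (n < N)%N ->
      (u - v) n = (\sum_(c <- s) c.1.1 * nth 0 relations c.1.2 * c.2) n.

Definition D_R_term (m n : nat) : fps freeD * fps freeD :=
  (scal (fps_X ^+ (m + n) * fps_inv (qe_fact m * (n`!)%:R)) * y_ ^+ m * b_ ^+ n,
   a_ ^+ n * x_ ^+ m).

(* The universal R-matrix modulo h^(N+1) *)
Definition D_R (N : nat) : seq (fps freeD * fps freeD) :=
  [seq D_R_term m n | m <- iota 0 N.+1, n <- iota 0 N.+1].

(* Its inverse modulo h^(N+1), as the geometric series, which applies since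
   R = 1 (x) 1 mod h: the sum for k <= N of (1 (x) 1 - R)^k. Elements of the
   tensor square are written as lists of pure tensors. *)
Definition tens_mul (A : pzRingType) (u v : seq (A * A)) : seq (A * A) :=
  [seq (x.1 * y.1, x.2 * y.2) | x <- u, y <- v].

Definition D_Rinv (N : nat) : seq (fps freeD * fps freeD) :=
  let u := (1, 1) :: [seq (- x.1, x.2) | x <- D_R N] in
  flatten [seq iter k (tens_mul u) [:: (1, 1)] | k <- iota 0 N.+1].

(* The terms left out of D_R N and D_Rinv N do not contribute to the
   coefficient of h^N. *)
Definition Z_D (K : long_knot) : fps freeD :=
  Fps (fun N =>
    universal_invariant (D_R N) (D_Rinv N) kappaD kappaDinv K N).

(* The denominator h (q_eps - 1) is h^2 times the series (q_eps - 1) / h, with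
   constant coefficient eps; the numerator is divisible by h^2. *)
Definition W_ : fps freeD :=
  y_ * Ainv * x_
  + scal (fps_inv (fps_divX 1 (q_eps - 1)))
    * fps_divX 2 (scal q_eps * Ainv + A_ * T_
                  - half * (1 + T_) * (scal q_eps + 1)).

Definition eval_T (P : laurent) : fps freeD := laurent_eval T_ Tinv P.

(* The property that defines the Laurent polynomials rho_(k,j) of K. *)
Definition BV_expansion (K : long_knot) (Delta : laurent)
    (rho : nat -> nat -> laurent) : Prop :=
  let Dinv := fps_inv1 (eval_T Delta) in
  D_eq (Z_D K)
    (Dinv * fps_exp (fps_sum 1 (fun k =>
       eps_ ^+ k * h_ ^+ k *
       \sum_(0 <= j < (2 * k).+1)
          eval_T (rho k j) * (h_ ^+ j * W_ ^+ j) * Dinv ^+ (2 * k - j)))).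

(* Main.v *)
From HB Require Import structures.
Require Import Defs.
From mathcomp Require Import all_boot all_order all_algebra.
From mathcomp Require Import finmap boolp zify ring.
From mathcomp.multinomials Require Import monalg.
From mathcomp.real_closed Require Import mxtens.

Set Implicit Arguments.
Unset Strict Implicit.
Unset Printing Implicit Defensive.

Import GRing.Theory.
Local Open Scope ring_scope.

(** * Formal power series *)

(** Write q_eps = e^(eps h) and s = q_eps^(1/2). For each n >= 1 the n-dimensional module of
    U_q(sl_2), taken at q^2 = q_eps, is also a module over D: y acts as E, x as ((q - q^-1) / h) K
    F, the balancing element (A B)^(1/2) as K, and the central elements T and h W act as the scalars
    q_eps^n and -((1 + q_eps^n) / 2) (s - 1) / (s + 1) ([rep_relations], [rep_T], [rep_hW]). By its
    expansion, Z_D(K) then acts as an explicit scalar ([rep_BV_expansion]).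

    On this module the R-matrix of D is a gauge transform c (1 (x) g^-1) R (g (x) 1) of the R-matrix
    R of U_q(sl_2), where c is a scalar, g is diagonal and g (x) g commutes with R ([R_mx_gauge]). A
    numbering of the regions of the diagram makes the factors g telescope along the strand, and the
    scalars multiply to c to the power of the writhe, which is 0 ([knot_mx_gauge]). So the scalar by
    which Z_D(K) acts is J^n at q^2 = q_eps ([colored_jones_rel]), and for all n >= 1 the series of
    the P_i at q_eps^n, with z = q_eps - 1, equals the exponential expression in the rho_(k,j) at T
    = q_eps^n ([tau_rozansky]).

    Both sides are specializations at u = n h of series in two independent variables u and h. Each
    coefficient of a specialization is a polynomial in n, so that equality for all n lifts to the
    two variables ([ev_inj]). Now compare the coefficients of h^1. One side gives eps P_1(e^(eps u))
    / Delta^3. On the other, h W vanishes at h = 0, so that only k = 1, j = 0 and the linear term of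
    the exponential remain, which gives eps rho_(1,0)(e^(eps u)) / Delta^3. As e^(eps u) is
    transcendental, rho_(1,0) = P_1 ([rho_eq_P]).

    The passage from k(q^(1/2)) to Q(eps)[[h]] goes through Q[[z]], z = q^2 - 1. Expansion at
    q^(1/2) = 1 is only a partial map, so matrices, inverses and state sums are carried along
    relations compatible with the ring operations ([ring_rel], [mx_rel_inv], [knot_mx_rel]). *)

Section FpsTheory.
Variable R : nzRingType.
Implicit Types f g : fps R.

Lemma fps_coefD f g n : (f + g) n = f n + g n. Proof. by []. Qed.
Lemma fps_coefN f n : (- f) n = - f n. Proof. by []. Qed.
Lemma fps_coefB f g n : (f - g) n = f n - g n. Proof. by []. Qed.
Lemma fps_coef0 n : (0 : fps R) n = 0. Proof. by []. Qed.
Lemma fps_coef1 n : (1 : fps R) n = (n == 0%N)%:R. Proof. by case: n. Qed.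
Lemma fps_coefM f g n : (f * g) n = \sum_(i < n.+1) f i * g (n - i)%N.
Proof. by []. Qed.

Lemma fps_coef_sum I (r : seq I) (P : pred I) (F : I -> fps R) n :
  (\sum_(i <- r | P i) F i) n = \sum_(i <- r | P i) F i n.
Proof. by elim/big_ind2: _ => // ? ? ? ? <- <-. Qed.

Lemma fps_coefCM c f n : (fps_cst c * f) n = c * f n.
Proof.
by rewrite fps_coefM big_ord_recl subn0 big1 ?addr0 // => i _; rewrite mul0r.
Qed.

Lemma fps_coefMC c f n : (f * fps_cst c) n = f n * c.
Proof.
rewrite fps_coefM big_ord_recr /= subnn big1 ?add0r // => i _.
by case: (n - i)%N (subn_gt0 i n) => [|m _]; rewrite ?ltn_ord ?mulr0.
Qed.

Fact fps_cst_is_zmod_morphism : zmod_morphism (@fps_cst R).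
Proof. by move=> a b; apply: fpsP => -[|n] //=; rewrite subr0. Qed.
Fact fps_cst_is_monoid_morphism : monoid_morphism (@fps_cst R).
Proof.
split=> // a b; apply: fpsP => n; rewrite fps_coefCM.
by case: n => //= n; rewrite mulr0.
Qed.
HB.instance Definition _ := GRing.isZmodMorphism.Build R (fps R) (@fps_cst R)
  fps_cst_is_zmod_morphism.
HB.instance Definition _ := GRing.isMonoidMorphism.Build R (fps R) (@fps_cst R)
  fps_cst_is_monoid_morphism.

Definition fps_at0 f : R := f 0%N.
Fact fps_at0_is_zmod_morphism : zmod_morphism fps_at0. Proof. by []. Qed.
Fact fps_at0_is_monoid_morphism : monoid_morphism fps_at0.
Proof. by split=> // f g; rewrite /fps_at0 fps_coefM big_ord1. Qed.
HB.instance Definition _ := GRing.isZmodMorphism.Build (fps R) R fps_at0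
  fps_at0_is_zmod_morphism.
HB.instance Definition _ := GRing.isMonoidMorphism.Build (fps R) R fps_at0
  fps_at0_is_monoid_morphism.

Lemma fps_coefXM f n : (fps_X * f) n = if n is m.+1 then f m else 0.
Proof.
rewrite fps_coefM; case: n => [|n]; first by rewrite big_ord1 mul0r.
rewrite !big_ord_recl mul0r add0r mul1r /= big1 ?addr0 ?subSS ?subn0 //.
by move=> i _; rewrite mul0r.
Qed.

Lemma fps_X_comm f : fps_X * f = f * fps_X.
Proof.
apply: fpsP => n; rewrite fps_coefXM fps_coefM; case: n => [|n].
  by rewrite big_ord1 mulr0.
rewrite !big_ord_recr /= subnn mulr0 addr0 subSn // subnn mulr1.
rewrite big1 ?add0r // => i _.
have ltin := ltn_ord i.
have -> : ((n.+1 - i)%N == 1%N) = false by apply/eqP; lia.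
by rewrite mulr0.
Qed.

Lemma fps_Xn_comm m f : fps_X ^+ m * f = f * fps_X ^+ m.
Proof.
by elim: m => [|m IH]; rewrite ?mul1r ?mulr1 // exprS -mulrA IH !mulrA fps_X_comm.
Qed.

Lemma fps_coefXnM m f n :
  (fps_X ^+ m * f) n = if (n < m)%N then 0 else f (n - m)%N.
Proof.
elim: m n => [|m IH] n; first by rewrite mul1r subn0.
by rewrite exprS -mulrA fps_coefXM; case: n => [//|n]; rewrite IH subSS ltnS.
Qed.

Definition fps_ord m f := forall i, (i < m)%N -> f i = 0.

Lemma fps_ordW m n f : (n <= m)%N -> fps_ord m f -> fps_ord n f.
Proof. by move=> lenm fm i ltin; apply/fm/(leq_trans ltin). Qed.

Lemma fps_ord0 m : fps_ord m 0. Proof. by []. Qed.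

Lemma fps_ordD m f g : fps_ord m f -> fps_ord m g -> fps_ord m (f + g).
Proof. by move=> fm gm i ltim; rewrite fps_coefD fm ?gm ?addr0. Qed.

Lemma fps_ordN m f : fps_ord m f -> fps_ord m (- f).
Proof. by move=> fm i ltim; rewrite fps_coefN fm ?oppr0. Qed.

Lemma fps_ord_sum m I (r : seq I) (P : pred I) (F : I -> fps R) :
  (forall i, P i -> fps_ord m (F i)) -> fps_ord m (\sum_(i <- r | P i) F i).
Proof. by move=> Fm i ltim; rewrite fps_coef_sum big1 // => j /Fm; apply. Qed.

Lemma fps_ordM m n f g : fps_ord m f -> fps_ord n g -> fps_ord (m + n) (f * g).
Proof.
move=> fm gn i lti; rewrite fps_coefM big1 // => j _.
have [ltjm|lemj] := ltnP j m; first by rewrite fm ?mul0r.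
by have ltji := ltn_ord j; rewrite gn ?mulr0 //; lia.
Qed.

Lemma fps_ordMl m f g : fps_ord m f -> fps_ord m (g * f).
Proof. by move=> fm; apply: (@fps_ordM 0 m). Qed.

Lemma fps_ordMr m f g : fps_ord m f -> fps_ord m (f * g).
Proof. by move=> fm; rewrite -(addn0 m); apply: fps_ordM. Qed.

Lemma fps_ordXn m f k : fps_ord m f -> fps_ord (m * k) (f ^+ k).
Proof.
move=> fm; elim: k => [|k IH]; first by rewrite muln0.
by rewrite mulnS exprS; apply: fps_ordM.
Qed.

Lemma fps_ord1X f k : fps_ord 1 f -> fps_ord k (f ^+ k).
Proof. by move/fps_ordXn => /(_ k); rewrite mul1n. Qed.

Lemma fps_ord_X : fps_ord 1 (fps_X : fps R). Proof. by case. Qed.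

Lemma fps_divXK m f : fps_ord m f -> fps_X ^+ m * fps_divX m f = f.
Proof.
move=> fm; apply: fpsP => n; rewrite fps_coefXnM.
by have [/fm ->|lemn] := ltnP n m; rewrite //= subnK.
Qed.

Lemma fps_Xn_inj m f g : fps_X ^+ m * f = fps_X ^+ m * g -> f = g.
Proof.
move=> E; apply: fpsP => n.
have: (fps_X ^+ m * f) (n + m)%N = (fps_X ^+ m * g) (n + m)%N.
  by rewrite E.
by rewrite !fps_coefXnM ltnNge leq_addl addnK.
Qed.

Definition fps_eqmod m f g := fps_ord m (f - g).

Lemma fps_eqmodP m f g :
  fps_eqmod m f g <-> (forall i, (i < m)%N -> f i = g i).
Proof.
split=> E i lti; first by apply/subr0_eq/(E i lti).
by rewrite fps_coefB E // subrr.
Qed.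

Lemma fps_eqmod0 m f : fps_eqmod m f 0 <-> fps_ord m f.
Proof. by rewrite /fps_eqmod subr0. Qed.

Lemma fps_coefXn k l : (fps_X ^+ k : fps R) l = (l == k)%:R.
Proof.
rewrite -[fps_X ^+ k]mulr1 fps_coefXnM fps_coef1; case: ltngtP => // [ltkl|->].
  by rewrite subn_eq0 leqNgt ltkl.
by rewrite subnn.
Qed.

Lemma fps_trunc_eqmod N f :
  fps_eqmod N f (\sum_(k < N) fps_cst (f k) * fps_X ^+ k).
Proof.
apply/fps_eqmodP => l ltl; rewrite fps_coef_sum (bigD1 (Ordinal ltl)) // big1 => [|k nkl].
  by rewrite /= addr0 [RHS](fps_coefCM (f l) (fps_X ^+ l)) fps_coefXn eqxx mulr1.
rewrite fps_coefCM fps_coefXn; case: (l =P k) nkl => [Ek|_ _]; last by rewrite mulr0.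
by case/eqP; apply: val_inj.
Qed.

Lemma fps_eqmodM m f f' g g' :
  fps_eqmod m f f' -> fps_eqmod m g g' -> fps_eqmod m (f * g) (f' * g').
Proof.
move=> Ef Eg; rewrite /fps_eqmod.
have -> : f * g - f' * g' = (f - f') * g + f' * (g - g').
  by rewrite mulrBl mulrBr addrA subrK.
by apply: fps_ordD; [apply: fps_ordMr | apply: fps_ordMl].
Qed.

Lemma fps_eqmod_all f g : (forall m, fps_eqmod m f g) -> f = g.
Proof. by move=> E; apply: fpsP => n; apply: (fps_eqmodP n.+1 f g).1. Qed.

Lemma fps_sum_eqmod m (u : nat -> fps R) N :
  (forall k, fps_ord k (u k)) ->
  fps_eqmod N (fps_sum m u) (\sum_(m <= k < N) u k).
Proof.
move=> uk; apply/fps_eqmodP => i ltiN /=; rewrite fps_coef_sum.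
have [lemi|ltim] := leqP m i.
  rewrite [RHS](big_cat_nat (n := i.+1)) //=; last exact: leqW.
  rewrite -[LHS]addr0; congr (_ + _); symmetry.
  by rewrite big_nat_cond big1 // => k /andP[/andP[ltik _] _]; apply: uk.
rewrite big_geq // big_nat_cond big1 // => k /andP[/andP[lemk _] _].
by apply: uk; apply: leq_trans lemk.
Qed.

Lemma fps_inv1_eqmod f N : f 0%N = 1 ->
  fps_eqmod N (fps_inv1 f) (\sum_(k < N) (1 - f) ^+ k).
Proof.
move=> f0; rewrite -(big_mkord xpredT (fun k => (1 - f) ^+ k)).
apply: fps_sum_eqmod => k; apply: fps_ord1X => -[|//] _.
by rewrite fps_coefB f0 subrr.
Qed.

Lemma fps_inv1_comm f : f 0%N = 1 -> f * fps_inv1 f = fps_inv1 f * f.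
Proof.
move=> f0; apply: fps_eqmod_all => N.
pose s := \sum_(k < N) (1 - f) ^+ k.
have fs : f * s = s * f.
  rewrite /s mulr_sumr mulr_suml; apply: eq_bigr => k _.
  by apply: commrX; apply: commrB; [apply: commr1 | ].
have E1 : fps_eqmod N (f * fps_inv1 f) (f * s).
  by apply: fps_eqmodM; [rewrite /fps_eqmod subrr | apply: fps_inv1_eqmod].
have E2 : fps_eqmod N (fps_inv1 f * f) (s * f).
  by apply: fps_eqmodM; [apply: fps_inv1_eqmod | rewrite /fps_eqmod subrr].
move/fps_eqmodP: E1 => E1; move/fps_eqmodP: E2 => E2.
by apply/fps_eqmodP => i lti; rewrite E1 // E2 // fs.
Qed.

Lemma fps_inv1K f : f 0%N = 1 -> f * fps_inv1 f = 1.
Proof.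
move=> f0; apply: fps_eqmod_all => N.
have f1 : fps_ord 1 (1 - f) by move=> [|//] _; rewrite fps_coefB f0 subrr.
have: fps_eqmod N (f * fps_inv1 f) (f * \sum_(k < N) (1 - f) ^+ k).
  by apply: fps_eqmodM; [rewrite /fps_eqmod subrr | apply: fps_inv1_eqmod].
move/fps_eqmodP => E; apply/fps_eqmodP => i lti; rewrite E //.
have := subrX1 (1 - f) N.
rewrite [1 - f - 1]addrAC subrr sub0r mulNr => EN.
by rewrite -[f * _]opprK -EN opprB fps_coefB (fps_ord1X f1) // subr0.
Qed.

End FpsTheory.
Arguments fps_ord {R} m f.
Arguments fps_eqmod {R} m f g.

Section FpsCom.
Variable R : comNzRingType.
Fact fps_mulC : @commutative (fps R) (fps R) *%R.
Proof.
move=> f g; apply: fpsP => n; rewrite !fps_coefM (reindex_inj rev_ord_inj) /=.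
apply: eq_bigr => i _; have ltin := ltn_ord i.
by rewrite mulrC !subSS subKn.
Qed.
HB.instance Definition _ :=
  GRing.PzSemiRing_hasCommutativeMul.Build (fps R) fps_mulC.
End FpsCom.

Section FpsField.
Variable K : fieldType.
Implicit Types f g : fps K.

(** The product of the lowest nonzero coefficients of f and g is a nonzero coefficient of f g. *)
Lemma fps_mulf_eq0 f g : f * g = 0 -> f = 0 \/ g = 0.
Proof.
have nzP (u : fps K) : u <> 0 -> exists n, u n != 0 /\ fps_ord n u.
  move=> nz; have [|nex] := pselect (exists n, u n != 0).
    move=> ex; exists (ex_minn ex); case: ex_minnP => m um minm; split=> // i ltim.
    by apply/eqP; apply: contraTT ltim => /minm; rewrite -leqNgt.
  case: nz; apply: fpsP => n; apply/eqP; rewrite fps_coef0.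
  by apply: contra_notT nex => un; exists n.
move=> fg0; have [->|/nzP[m [fm ordf]]] := pselect (f = 0); first by left.
have [->|/nzP[n [gn ordg]]] := pselect (g = 0); first by right.
have: (f * g) (m + n)%N = f m * g n.
  rewrite fps_coefM (bigD1 (inord m)) //= inordK ?ltnS ?leq_addr // addKn.
  rewrite big1 ?addr0 // => i neim; have [ltim|ltmi|eqim] := ltngtP i m.
  - by rewrite ordf ?mul0r.
  - by rewrite ordg ?mulr0 //; have := ltn_ord i; lia.
  - by case/eqP: neim; apply: val_inj; rewrite /= inordK ?ltnS ?leq_addr.
by rewrite fg0 => /esym/eqP; rewrite mulf_eq0 (negPf fm) (negPf gn).
Qed.

Lemma fps_mulIf f g1 g2 : f <> 0 -> f * g1 = f * g2 -> g1 = g2.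
Proof.
move=> nz E; have/fps_mulf_eq0[//|/subr0_eq //] : f * (g1 - g2) = 0.
by rewrite mulrBr E subrr.
Qed.

Lemma fps_invK f : f 0%N != 0 -> f * fps_inv f = 1.
Proof.
move=> f0; rewrite /fps_inv mulrA [f * _]mulrC fps_inv1K //.
by rewrite fps_coefCM mulVf.
Qed.

(** Split off the root 1 as p = r (X - 1)^m with r(1) <> 0: then r(s) has the nonzero constant term
    r(1), and s - 1 is nonzero. So s is transcendental; this serves for q^(1/2) as a series in z and
    for e^(eps u). *)
Lemma poly_at_fps_inj (s : fps K) (p : {poly K}) :
  s 0%N = 1 -> s <> 1 -> (map_poly (@fps_cst K) p).[s] = 0 -> p = 0.
Proof.
move=> s0 s1 ps; apply/eqP/negPn/negP => nzp.
have [m [r rr Ep]] := multiplicity_XsubC p 1; move: rr; rewrite nzp /= => rr.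
move: ps; rewrite Ep rmorphM rmorphXn rmorphB /= map_polyX map_polyC /=.
rewrite hornerM horner_exp !hornerE => /fps_mulf_eq0[].
  move=> /(congr1 (@fps_at0 K)); rewrite rmorph0 -horner_map -map_poly_comp /=.
  rewrite map_poly_id // => E; case/negP: rr; rewrite /root -[X in r.[X]]s0.
  exact/eqP.
elim: m {Ep} => [|m IH].
  by rewrite expr0; move/(congr1 (@fps_at0 K))/eqP; rewrite rmorph1 oner_eq0.
by rewrite exprS => /fps_mulf_eq0[/subr0_eq|].
Qed.

(** In the factorization of u^(m+1) - v^(m+1) the cofactor of u - v has constant term m + 1. This
    identifies the image of q^(1/2) by its fourth power. *)
Lemma fps_at0_unit_inj (u v : fps K) m : (m.+1%:R : K) != 0 ->
  u 0%N = 1 -> v 0%N = 1 -> u ^+ m.+1 = v ^+ m.+1 -> u = v.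
Proof.
move=> nzm u0 v0 /eqP; rewrite -subr_eq0 subrXX => /eqP/fps_mulf_eq0[/subr0_eq//|].
move/(congr1 (@fps_at0 K))/eqP; rewrite rmorph0 rmorph_sum.
rewrite (eq_bigr (fun=> 1)) ?sumr_const ?card_ord ?(negPf nzm) // => i _.
by rewrite rmorphM !rmorphXn /= /fps_at0 u0 v0 !expr1n mulr1.
Qed.

End FpsField.

(** * The exponential series e^(c X) *)

Section Expc.
Variable K : fieldType.
Hypothesis charK : [pchar K] =i pred0.

Lemma natf_neq0_char0 n : (n.+1%:R : K) != 0.
Proof. by rewrite ((pcharf0P K).1 charK). Qed.

Lemma factf_neq0 n : ((n`!)%:R : K) != 0.
Proof. by rewrite ((pcharf0P K).1 charK) -lt0n fact_gt0. Qed.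

Definition expc (c : K) : fps K := Fps (fun n => c ^+ n / (n`!)%:R).

Lemma expc0 : expc 0 = 1.
Proof.
apply: fpsP => -[|n]; first by rewrite /= expr0 fact0 divr1.
by rewrite /= expr0n mul0r.
Qed.

Lemma expcD c d : expc (c + d) = expc c * expc d.
Proof.
apply: fpsP => n; rewrite fps_coefM /= addrC exprDn mulr_suml.
apply: eq_bigr => i _; have lein : (i <= n)%N by rewrite -ltnS ltn_ord.
have := bin_fact lein => /(congr1 (fun m => m%:R : K)); rewrite !natrM => E.
rewrite -mulr_natr -E; have := factf_neq0 i; have := factf_neq0 (n - i).
have: ('C(n, i)%:R : K) != 0.
  by rewrite ((pcharf0P K).1 charK) -lt0n bin_gt0.
by move=> nz1 nz2 nz3; field; rewrite nz1 nz2 nz3.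
Qed.

Lemma expcMn c n : expc (c *+ n) = expc c ^+ n.
Proof. by elim: n => [|n IH]; rewrite ?expc0 // mulrS exprS expcD IH. Qed.

Lemma expcK c : expc c * expc (- c) = 1.
Proof. by rewrite -expcD subrr expc0. Qed.

Lemma expc_at0 c : expc c 0%N = 1.
Proof. by rewrite /= expr0 divr1. Qed.

Lemma expc_neq1 c : c != 0 -> expc c <> 1.
Proof.
move=> nz /(congr1 (fun f : fps K => f 1%N)) /eqP; rewrite /= expr1 divr1.
by rewrite (negPf nz).
Qed.

End Expc.

(** * Continuous substitution in power series *)

Section Substitution.
Variables (R A : nzRingType) (phi : {rmorphism R -> fps A}) (Z : fps A).
Hypotheses (ordZ : fps_ord 1 Z) (Z_comm : forall g, Z * g = g * Z).

(* The continuous extension of phi that maps the variable to Z *)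
Definition fps_subst (f : fps R) : fps A :=
  fps_sum 0 (fun i => phi (f i) * Z ^+ i).

Lemma fps_subst_eqmod N f :
  fps_eqmod N (fps_subst f) (\sum_(i < N) phi (f i) * Z ^+ i).
Proof.
rewrite -(big_mkord xpredT (fun i => phi (f i) * Z ^+ i)).
by apply: fps_sum_eqmod => k; apply/fps_ordMl/fps_ord1X.
Qed.

Lemma fps_subst_coef N M f : (N < M)%N ->
  fps_subst f N = (\sum_(i < M) phi (f i) * Z ^+ i) N.
Proof. by have/fps_eqmodP := @fps_subst_eqmod M f; apply. Qed.

Lemma fps_subst_continuous N f g :
  fps_eqmod N f g -> fps_eqmod N (fps_subst f) (fps_subst g).
Proof.
move/fps_eqmodP=> E; apply/fps_eqmodP => i ltiN.
rewrite !(fps_subst_coef _ (ltnSn i)); congr (fcoef _ i).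
by apply: eq_bigr => j _; rewrite E // (leq_trans (ltn_ord j)).
Qed.

Fact fps_subst_is_zmod_morphism : zmod_morphism fps_subst.
Proof.
move=> f g; apply: fpsP => N; rewrite fps_coefB !(fps_subst_coef _ (ltnSn N)).
rewrite -fps_coefB -sumrB; congr (fcoef _ N).
by apply: eq_bigr => i _; rewrite fps_coefB rmorphB mulrBl.
Qed.

(** Powers Z^i with i > N have no term of degree N. Hence substitution agrees, degree by degree,
    with evaluation of polynomials at Z, from which its multiplicativity is read off. *)
Fact fps_subst_horner N M (p : {poly R}) : (N < M)%N ->
  (map_poly phi p).[Z] N = (\sum_(i < M) phi p`_i * Z ^+ i) N.
Proof.
move=> ltNM; pose L := maxn M (size p).
have lepL : (size (map_poly phi p) <= L)%N.
  by rewrite leq_max size_poly orbT.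
rewrite (horner_coef_wide _ lepL) !fps_coef_sum.
under eq_bigr => i _ do rewrite coef_map.
rewrite [RHS](big_ord_widen L (fun i => (phi p`_i * Z ^+ i) N)) ?leq_maxl //.
rewrite [RHS]big_mkcond; apply: eq_bigr => i _.
case: ltnP => // leMi; apply: fps_ordMl (leq_trans ltNM leMi).
exact: fps_ord1X.
Qed.

Fact fps_subst_is_monoid_morphism : monoid_morphism fps_subst.
Proof.
split=> [|f g]; apply: fpsP => N.
  rewrite (fps_subst_coef _ (ltnSn N)) big_ord_recl big1 => [|i _].
    by rewrite addr0 mulr1 [X in phi X](_ : _ = 1) // rmorph1.
  by rewrite [X in phi X](_ : _ = 0) // rmorph0 mul0r.
have trE (u : fps R) i : (i < N.+1)%N ->
    (map_poly phi (fps_trunc N.+1 u)).[Z] i = fps_subst u i.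
  move=> lti; rewrite (fps_subst_horner _ lti) (fps_subst_coef _ lti).
  congr (fcoef _ i); apply: eq_bigr => j _; congr (phi _ * _).
  by rewrite coef_poly ltn_ord.
transitivity
   ((map_poly phi (fps_trunc N.+1 f * fps_trunc N.+1 g)).[Z] N).
  rewrite (fps_subst_coef _ (ltnSn N)) (fps_subst_horner _ (ltnSn N)).
  congr (fcoef _ N); apply: eq_bigr => i _; congr (phi _ * _).
  exact: (@fps_mul_trunc _ N.+1 f g i (ltn_ord i)).
rewrite rmorphM hornerM_comm; last by rewrite /comm_poly Z_comm.
rewrite !fps_coefM; apply: eq_bigr => i _.
by rewrite !trE // ltnS leq_subr.
Qed.

HB.instance Definition _ := GRing.isZmodMorphism.Build (fps R) (fps A) fps_subst
  fps_subst_is_zmod_morphism.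
HB.instance Definition _ := GRing.isMonoidMorphism.Build (fps R) (fps A) fps_subst
  fps_subst_is_monoid_morphism.

Lemma fps_subst_cst c : fps_subst (fps_cst c) = phi c.
Proof.
apply: fpsP => N; rewrite (fps_subst_coef _ (ltnSn N)) big_ord_recl big1 => [|i _].
  by rewrite addr0 mulr1.
by rewrite [X in phi X](_ : _ = 0) // rmorph0 mul0r.
Qed.

Lemma fps_subst_X : fps_subst fps_X = Z.
Proof.
apply: fpsP => N; rewrite (@fps_subst_coef N N.+2) //.
rewrite !big_ord_recl big1 => [|i _].
  rewrite [X in phi X](_ : _ = 0) // [X in _ + (phi X * _ + _)](_ : _ = 1) //.
  by rewrite rmorph0 rmorph1 mul0r add0r mul1r addr0.
by rewrite [X in phi X](_ : _ = 0) // rmorph0 mul0r.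
Qed.

Lemma fps_subst_ord m f : fps_ord m f -> fps_ord m (fps_subst f).
Proof.
move=> fm; have := @fps_subst_continuous m f 0.
by rewrite /fps_eqmod subr0 rmorph0 subr0; apply.
Qed.

Lemma fps_subst_sum m (u : nat -> fps R) : (forall k, fps_ord k (u k)) ->
  fps_subst (fps_sum m u) = fps_sum m (fun k => fps_subst (u k)).
Proof.
move=> ordu; apply: fps_eqmod_all => N; apply/fps_eqmodP => i ltiN.
have/fps_eqmodP -> // := fps_subst_continuous (fps_sum_eqmod (N := N) m ordu).
have ordsu k : fps_ord k (fps_subst (u k)) by apply: fps_subst_ord.
have/fps_eqmodP -> // := fps_sum_eqmod (N := N) m ordsu.
by rewrite rmorph_sum.
Qed.

Definition fps_subst_morph : {rmorphism fps R -> fps A} := fps_subst.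

End Substitution.

Section FpsMap.
Variables (R A : nzRingType) (phi : {rmorphism R -> A}).
Fact fps_map_is_zmod_morphism : zmod_morphism (fps_map phi).
Proof. by move=> f g; apply: fpsP => n /=; rewrite rmorphB. Qed.
Fact fps_map_is_monoid_morphism : monoid_morphism (fps_map phi).
Proof.
split=> [|f g]; apply: fpsP => n.
  by case: n => [|n] /=; rewrite ?rmorph1 ?rmorph0.
rewrite /fps_map /= rmorph_sum /=.
by apply: eq_bigr => i _; rewrite rmorphM.
Qed.
HB.instance Definition _ := GRing.isZmodMorphism.Build (fps R) (fps A)
  (fps_map phi) fps_map_is_zmod_morphism.
HB.instance Definition _ := GRing.isMonoidMorphism.Build (fps R) (fps A)
  (fps_map phi) fps_map_is_monoid_morphism.
End FpsMap.

(* Relations that are compatible with the ring operations: graphs of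
   morphisms, congruences, ... *)
Record ring_rel (C C' : pzRingType) (r : C -> C' -> Prop) : Prop := RingRel {
  ring_rel0 : r 0 0;
  ring_rel1 : r 1 1;
  ring_relN : forall a a', r a a' -> r (- a) (- a');
  ring_relD : forall a a' b b', r a a' -> r b b' -> r (a + b) (a' + b');
  ring_relM : forall a a' b b', r a a' -> r b b' -> r (a * b) (a' * b')
}.

(** * Transfer of matrix computations along relations *)

Section RingRel.
Variables (C C' : pzRingType) (r : C -> C' -> Prop).
Hypothesis rr : ring_rel r.

Lemma ring_rel_sum I (s : seq I) (P : pred I) F F' :
  (forall i, P i -> r (F i) (F' i)) ->
  r (\sum_(i <- s | P i) F i) (\sum_(i <- s | P i) F' i).
Proof.
by move=> rF; apply: (big_ind2 r) => //; [apply: ring_rel0 | apply: ring_relD].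
Qed.

Lemma ring_rel_prod I (s : seq I) (P : pred I) F F' :
  (forall i, P i -> r (F i) (F' i)) ->
  r (\prod_(i <- s | P i) F i) (\prod_(i <- s | P i) F' i).
Proof.
by move=> rF; apply: (big_ind2 r) => //; [apply: ring_rel1 | apply: ring_relM].
Qed.

Lemma ring_relB a a' b b' : r a a' -> r b b' -> r (a - b) (a' - b').
Proof. by move=> ra rb; apply: ring_relD => //; apply: ring_relN. Qed.

Lemma ring_relX a a' n : r a a' -> r (a ^+ n) (a' ^+ n).
Proof.
move=> ra; elim: n => [|n IH]; first exact: ring_rel1.
by rewrite !exprS; apply: ring_relM.
Qed.

Lemma ring_relMn a a' n : r a a' -> r (a *+ n) (a' *+ n).
Proof.
move=> ra; elim: n => [|n IH]; first exact: ring_rel0.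
by rewrite !mulrS; apply: ring_relD.
Qed.

End RingRel.

Definition mx_rel (C C' : Type) (r : C -> C' -> Prop) m n
  (A : 'M[C]_(m, n)) (A' : 'M[C']_(m, n)) := forall i j, r (A i j) (A' i j).

Section MxRel.
Variables (C C' : comPzRingType) (r : C -> C' -> Prop).
Hypothesis rr : ring_rel r.

Lemma mx_rel_ring n : ring_rel (@mx_rel C C' r n n).
Proof.
split.
- by move=> i j; rewrite !mxE; apply: ring_rel0.
- by move=> i j; rewrite !mxE; apply: (ring_relMn rr); apply: (ring_rel1 rr).
- by move=> A A' rA i j; rewrite !mxE; apply: ring_relN.
- by move=> A A' B B' rA rB i j; rewrite !mxE; apply: ring_relD.
- move=> A A' B B' rA rB i j; rewrite !mxE; apply: ring_rel_sum => // k _.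
  exact: ring_relM.
Qed.

Lemma mx_rel_det n (A : 'M[C]_n) (A' : 'M[C']_n) :
  mx_rel r A A' -> r (\det A) (\det A').
Proof.
move=> rA; apply: ring_rel_sum => // s _; apply: ring_relM => //.
  by apply: (ring_relX rr); apply: (ring_relN rr); apply: (ring_rel1 rr).
exact: ring_rel_prod.
Qed.

Lemma mx_rel_adj n (A : 'M[C]_n) (A' : 'M[C']_n) :
  mx_rel r A A' -> mx_rel r (\adj A) (\adj A').
Proof.
move=> rA i j; rewrite !mxE; apply: ring_relM => //.
  by apply: (ring_relX rr); apply: (ring_relN rr); apply: (ring_rel1 rr).
by apply: mx_rel_det => k l; rewrite !mxE.
Qed.

End MxRel.

(* adj A / det A, computed on the right from an arbitrary inverse X *)
Lemma mx_rel_inv (F : fieldType) (C : comNzRingType) (r : F -> C -> Prop) n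
    (A : 'M[F]_n) (A' X : 'M[C]_n) :
  ring_rel r -> (forall a a' x, r a a' -> a' * x = 1 -> a != 0 /\ r a^-1 x) ->
  mx_rel r A A' -> A' *m X = 1%:M -> mx_rel r (invmx A) X.
Proof.
move=> rr rV rA AX i j.
have detAX : \det A' * \det X = 1 by rewrite -det_mulmx AX det1.
have [detA rdetA] := rV _ _ _ (mx_rel_det rr rA) detAX.
have -> : X = \det X *: \adj A'.
  have : \adj A' *m (A' *m X) = \adj A' by rewrite AX mulmx1.
  rewrite mulmxA mul_adj_mx mul_scalar_mx => <-.
  by rewrite scalerA mulrC detAX scale1r.
rewrite /invmx unitmxE unitfE detA !mxE.
by apply: (ring_relM rr) => //; have := mx_rel_adj rr rA i j; rewrite !mxE.
Qed.

(** * The open strand of a diagram *)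

Lemma uniq_pmap_in (T U : eqType) (f : T -> option U) (s : seq T) :
  (forall x y u, x \in s -> y \in s -> f x = Some u -> f y = Some u -> x = y) ->
  uniq s -> uniq (pmap f s).
Proof.
elim: s => //= x s IH finj /andP[xs us].
have us' : uniq (pmap f s).
  by apply: IH us => y z u ys zs; apply: finj; rewrite inE ?ys ?zs orbT.
case fx: (f x) => [u|] //=; rewrite us' andbT mem_pmap.
apply/negP => /mapP[y ys fy]; case/negP: xs.
by rewrite (finj x y u) // inE ?eqxx ?ys ?orbT.
Qed.

Section Trace.
Variables (T : eqType) (next : T -> option T) (x0 : T).
Hypotheses (next_inj : forall x y z, next x = Some z -> next y = Some z -> x = y)
           (next_x0 : forall x, next x <> Some x0).

Fixpoint trace fuel x : seq T :=
  if fuel is fuel'.+1 then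
    x :: (if next x is Some y then trace fuel' y else [::])
  else [::].

Definition reached k x := iter k (obind next) (Some x0) = Some x.

Lemma reachedS k x : reached k.+1 x -> exists2 y, reached k y & next y = Some x.
Proof.
by rewrite /reached iterS; case: (iter _ _ _) => //= y yx; exists y.
Qed.

(** A point reached after i and after j > i steps could be followed backwards, by injectivity of
    [next], to a return to [x0], which is not in the image of [next]. *)
Lemma reached_inj i j x : reached i x -> reached j x -> i = j.
Proof.
have no0 k : ~ reached k.+1 x0 by case/reachedS => y _ /next_x0.
elim: i j x => [|i IH] [|j] x //.
- by move=> [<-] /no0.
- by move=> + [E]; rewrite -E => /no0.
- case/reachedS => y ry yx /reachedS[z rz zx]; congr _.+1.
  by apply: IH ry _; rewrite (next_inj yx zx).
Qed.

Lemma trace_uniq fuel : uniq (trace fuel x0).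
Proof.
have memP f k x y : reached k x -> y \in trace f x -> exists j, reached (k + j) y.
  elim: f k x => //= f IH k x rx; rewrite inE => /predU1P[->|].
    by exists 0%N; rewrite addn0.
  case E: (next x) => [z|] // /(IH k.+1)[|j]; first by rewrite /reached iterS rx.
  by rewrite addSnnS; exists j.+1.
have: reached 0 x0 by [].
elim: fuel {1 2}x0 {1}0%N => //= f IH x k rx; case E: (next x) => [y|] //.
have ry : reached k.+1 y by rewrite /reached iterS rx.
rewrite (IH _ _ ry) andbT; apply/negP => /(memP _ _ _ _ ry)[j rj].
by have := reached_inj rx rj; lia.
Qed.

Lemma trace_inv (P : T -> Prop) fuel : P x0 ->
  (forall x y, P x -> next x = Some y -> P y) ->
  forall x, x \in trace fuel x0 -> P x.
Proof.
move=> Px0 Pnext x; move: Px0; elim: fuel {1 2}x0 => //= f IH y Py.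
rewrite inE => /predU1P[->//|]; case E: (next y) => [z|] //.
exact/IH/(Pnext _ _ Py E).
Qed.

End Trace.

(** * The numbering of the regions of a diagram *)

Definition oriented (b : bool) : int := if b then 1 else -1.

(** Up to sign, the Alexander numbering of the region just left of position p: crossing a strand
    changes it by 1. *)
Definition winding (s : seq bool) (p : nat) : int :=
  \sum_(b <- take p s) oriented b.

Lemma winding_cat s1 s2 p :
  winding (s1 ++ s2) p =
    if (p <= size s1)%N then winding s1 p
    else winding s1 (size s1) + winding s2 (p - size s1).
Proof.
rewrite /winding take_cat take_size; case: ltngtP => // [_|->].
  by rewrite big_cat.
by rewrite subnn take0 cats0 take_size.
Qed.

Lemma winding_cons b s p : winding (b :: s) p.+1 = oriented b + winding s p.
Proof. by rewrite /winding /= big_cons. Qed.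

Lemma winding0 s : winding s 0 = 0.
Proof. by rewrite /winding take0 big_nil. Qed.

Lemma winding_at a r k :
  winding (a ++ r) (size a + k) = winding a (size a) + winding r k.
Proof.
rewrite winding_cat addKn; case: leqP => //.
by rewrite -{2}[size a]addn0 leq_add2l leqn0 => /eqP ->; rewrite addn0 winding0 addr0.
Qed.

(* The new position of strand p when two strands are inserted at position i *)
Definition ins i p : nat := if (p < i)%N then p else p.+2.

Lemma ins_del i p : p <> i -> p <> i.+1 ->
  p = ins i (if (p < i)%N then p else (p - 2)%N).
Proof.
move=> npi npi1; rewrite /ins; case: (ltnP p i) => lpi; first by rewrite lpi.
by rewrite ifN; lia.
Qed.

Section Insertion.
Variables (a b : seq bool) (u v : bool).

Lemma nth_ins0 : nth false (a ++ [:: u, v & b]) (size a) = u.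
Proof. by rewrite nth_cat ltnn subnn. Qed.

Lemma nth_ins1 : nth false (a ++ [:: u, v & b]) (size a).+1 = v.
Proof. by rewrite nth_cat ltnNge leqnSn subSn // subnn. Qed.

Lemma nth_ins p :
  nth false (a ++ [:: u, v & b]) (ins (size a) p) = nth false (a ++ b) p.
Proof.
rewrite /ins !nth_cat; case: (ltnP p (size a)) => [->//|lap].
by rewrite ltnNge !leqW //= !subSn // leqW.
Qed.

Lemma size_ins p :
  (ins (size a) p < size (a ++ [:: u, v & b]))%N = (p < size (a ++ b))%N.
Proof.
rewrite /ins !size_cat /= !addnS; case: (ltnP p (size a)) => // lap.
by have h := ltn_addr (size b) lap; rewrite h; apply/idP; lia.
Qed.

End Insertion.

Lemma winding_ins a b u p :
  winding (a ++ [:: u, ~~ u & b]) (ins (size a) p) = winding (a ++ b) p.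
Proof.
rewrite /ins; case: (ltnP p (size a)) => [lpa|lap].
  by rewrite !winding_cat ltnW.
rewrite -(subnKC lap) -!addnS !winding_at !winding_cons; congr (_ + _).
by case: u; rewrite /= addrA ?subrr ?addNr add0r.
Qed.

Lemma winding_insS a b u p :
  winding (a ++ [:: u, ~~ u & b]) (ins (size a) p).+1 = winding (a ++ b) p.+1.
Proof.
rewrite /ins; case: (ltnP p (size a)) => [lpa|lap].
  by rewrite !winding_cat lpa.
rewrite -(subnKC lap) -!addnS !winding_at !winding_cons; congr (_ + _).
by case: u; rewrite /= addrA ?subrr ?addNr add0r.
Qed.

(** The two ends of an extremum have opposite orientations, so that the regions on either side of
    the pair have the same index. *)
Lemma winding_turn a b u : winding (a ++ [:: u, ~~ u & b]) (size a).+2 =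
  winding (a ++ [:: u, ~~ u & b]) (size a).
Proof.
rewrite -[in RHS](addn0 (size a)) -addn2 !winding_at !winding_cons !winding0.
by case: u; rewrite /oriented /=; ring.
Qed.

Section Strand.
Variable D : seq layer.
Hypothesis Dwf : isSome (top_boundary D [:: true]).

Definition ori lev : seq bool := odflt [::] (top_boundary (take lev D) [:: true]).
Definition lay lev : layer := nth (0%N, Cross true) D lev.

Lemma ori_step lev : (lev < size D)%N ->
  layer_boundary (ori lev) (lay lev) = Some (ori lev.+1).
Proof.
move=> ltlev.
have someP l : isSome (top_boundary (take l D) [:: true]).
  move: Dwf; rewrite -{1}(cat_take_drop l D) /top_boundary foldl_cat.
  case: (foldl _ _ (take l D)) => //.
  by elim: (drop l D).
have := someP lev.+1; have := someP lev; rewrite /ori.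
rewrite (take_nth (0%N, Cross true) ltlev) /top_boundary foldl_rcons -/(lay lev).
by case: (foldl _ _ _) => //= s _; case: layer_boundary.
Qed.

Definition state := (nat * nat * bool)%type.

(** [walk] without its events. At an extremum the level stays the same and the direction is
    reversed, as in [walk]. *)
Definition step (x : state) : option state :=
  let: (lev, p, up) := x in
  if up then
    if (size D <= lev)%N then None else
    let: (i, e) := lay lev in
    match e with
    | Cross _ => Some (lev.+1, if p == i then i.+1 else if p == i.+1 then i else p, true)
    | Cap _ =>
        if p == i then Some (lev, i.+1, false)
        else if p == i.+1 then Some (lev, i, false)
        else Some (lev.+1, if (p < i)%N then p else (p - 2)%N, true)
    | Cup _ => Some (lev.+1, if (p < i)%N then p else p.+2, true)
    end
  else if lev isn't lev'.+1 then None else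
    let: (i, e) := lay lev' in
    match e with
    | Cross _ => Some (lev', p, false)
    | Cap _ => Some (lev', if (p < i)%N then p else p.+2, false)
    | Cup _ =>
        if p == i then Some (lev, i.+1, true)
        else if p == i.+1 then Some (lev, i, true)
        else Some (lev', if (p < i)%N then p else (p - 2)%N, false)
    end.

Definition event_at (x : state) : option event :=
  let: (lev, p, up) := x in
  if up then
    if (size D <= lev)%N then None else
    let: (i, e) := lay lev in
    match e with
    | Cross pos =>
        if p == i then Some (if pos then EOver lev else EUnder lev)
        else if p == i.+1 then Some (if pos then EUnder lev else EOver lev)
        else None
    | Cap _ =>
        if p == i then Some (ETurn true)
        else if p == i.+1 then Some (ETurn false) else None
    | Cup _ => None
    end
  else if lev isn't lev'.+1 then None else
    let: (i, e) := lay lev' in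
    match e with
    | Cup _ =>
        if p == i then Some (ETurn false)
        else if p == i.+1 then Some (ETurn true) else None
    | _ => None
    end.

Lemma walk_trace fuel lev p up :
  walk D fuel lev p up = pmap event_at (trace step fuel (lev, p, up)).
Proof.
elim: fuel lev p up => //= fuel IH lev p [].
  case: leqP => //= _; rewrite -/(lay lev); case: (lay lev) => i [pos|u|u].
  - by case: eqP => _; [|case: eqP => _]; rewrite /= IH.
  - by case: eqP => _; [|case: eqP => _]; rewrite /= IH.
  - by rewrite /= IH.
case: lev => [|lev] //=; rewrite -/(lay lev); case: (lay lev) => i [pos|u|u].
- by rewrite /= IH.
- by rewrite /= IH.
- by case: eqP => _; [|case: eqP => _]; rewrite /= IH.
Qed.

(** A left inverse of [step], written out to show that the walk is injective and never returns to
    its starting point. *)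
Definition back (x : state) : option state :=
  let: (lev, p, up) := x in
  if up then
    if lev isn't lev'.+1 then None else
    let: (i, e) := lay lev' in
    match e with
    | Cross _ => Some (lev', if p == i then i.+1 else if p == i.+1 then i else p, true)
    | Cap _ => Some (lev', if (p < i)%N then p else p.+2, true)
    | Cup _ =>
        if p == i then Some (lev, i.+1, false)
        else if p == i.+1 then Some (lev, i, false)
        else Some (lev', if (p < i)%N then p else (p - 2)%N, true)
    end
  else
    let: (i, e) := lay lev in
    match e with
    | Cross _ => Some (lev.+1, p, false)
    | Cap _ =>
        if p == i then Some (lev, i.+1, true)
        else if p == i.+1 then Some (lev, i, true)
        else Some (lev.+1, if (p < i)%N then p else (p - 2)%N, false)
    | Cup _ => Some (lev.+1, if (p < i)%N then p else p.+2, false)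
    end.

Lemma stepK x y : step x = Some y -> back y = Some x.
Proof.
have dec (a b : nat) : (a == b) = true -> a = b by move/eqP.
case: x => [[lev p] [|]] /=.
  case: leqP => // _; case E: (lay lev) => [i [pos|u|u]].
  - case=> <- /=; rewrite E; congr (Some (_, _, _)).
    case: (p =P i) => [->|pi]; first by rewrite gtn_eqF // eqxx.
    case: (p =P i.+1) => [->|pi1]; first by rewrite eqxx.
    by case: eqP => //; case: eqP.
  - case: eqP => [->|npi]; first by case=> <- /=; rewrite E eqxx ifN ?gtn_eqF.
    case: eqP => [->|npi1]; first by case=> <- /=; rewrite E eqxx.
    by case=> <- /=; rewrite E; congr (Some (_, _, _)); case: (ltnP p i) => lpi; [rewrite lpi | rewrite ifN; lia].
  - case=> <- /=; rewrite E; case: (ltnP p i) => lpi.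
      by rewrite (ltn_eqF lpi) (ltn_eqF (leqW lpi)) lpi.
    rewrite !gtn_eqF ?ltnS ?leqW // ltnNge !leqW //=.
    by rewrite -addn2 addnK.
case: lev => [|lev] //; case E: (lay lev) => [i [pos|u|u]].
- by case=> <- /=; rewrite E.
- case=> <- /=; rewrite E; case: (ltnP p i) => lpi.
    by rewrite (ltn_eqF lpi) (ltn_eqF (leqW lpi)) lpi.
  rewrite !gtn_eqF ?ltnS ?leqW // ltnNge !leqW //=.
  by rewrite -addn2 addnK.
- case: eqP => [->|npi]; first by case=> <- /=; rewrite E eqxx ifN ?gtn_eqF.
  case: eqP => [->|npi1]; first by case=> <- /=; rewrite E eqxx.
  by case=> <- /=; rewrite E; congr (Some (_, _, _)); case: (ltnP p i) => lpi; [rewrite lpi | rewrite ifN; lia].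
Qed.

Lemma step_inj x y z : step x = Some z -> step y = Some z -> x = y.
Proof. by move=> /stepK zx /stepK; rewrite zx => -[]. Qed.

Lemma step_bottom x : step x <> Some (0%N, 0%N, true).
Proof. by move/stepK. Qed.

Definition valid (x : state) : Prop :=
  let: (lev, p, up) := x in
  [/\ (lev <= size D)%N, (p < size (ori lev))%N & nth false (ori lev) p = up].

Lemma take2_drop (s : seq bool) i x y : take 2 (drop i s) == [:: x; y] ->
  exists a b, [/\ size a = i, s = a ++ x :: y :: b,
                  take i s = a & drop i.+2 s = b].
Proof.
move=> /eqP E; have lis : (i <= size s)%N.
  by case: (leqP i (size s)) => // /ltnW /drop_oversize dr; rewrite dr in E.
exists (take i s), (drop i.+2 s); rewrite size_takel //; split=> //.
rewrite -{1}(cat_take_drop i s) -(cat_take_drop 2 (drop i s)) E drop_drop.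
by rewrite add2n.
Qed.

Lemma layP lev : (lev < size D)%N ->
  let: (i, e) := lay lev in
  exists a b, size a = i /\
    match e with
    | Cross _ => ori lev = a ++ [:: true, true & b] /\ ori lev.+1 = ori lev
    | Cap u => ori lev = a ++ [:: u, ~~ u & b] /\ ori lev.+1 = a ++ b
    | Cup u => ori lev = a ++ b /\ ori lev.+1 = a ++ [:: u, ~~ u & b]
    end.
Proof.
move/ori_step; case: (lay lev) => i [pos|u|u] /=; case: ifP => //.
- by move/take2_drop => [a [b [sa E _ _]]] [<-]; exists a, b.
- by move/take2_drop => [a [b [sa E -> ->]]] [<-]; exists a, b.
- move=> lis [<-]; exists (take i (ori lev)), (drop i (ori lev)).
  by rewrite size_takel // cat_take_drop.
Qed.

(** Minus the index of the region on the left of the strand, as seen in the direction of travel; for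
    a downward strand this is the region at position p + 1. *)
Definition height (x : state) : int :=
  let: (lev, p, up) := x in - winding (ori lev) (if up then p else p.+1).

(* The height of the overstrand before the crossing in layer l; the region to
   the left of the crossing has index winding i. *)
Definition cross_height l : int :=
  let: (i, e) := lay l in
  - winding (ori l) i - (if e is Cross false then 1 else 0).

Definition cross_sign l : bool := if (lay l).2 is Cross false then false else true.

(** The two strands of a crossing of sign s use the same two heights h and h - s: the overstrand
    passes from h to h - s, the understrand from h - s to h. Elsewhere the height is constant. *)
Definition height_ok (x y : state) : Prop :=
  match event_at x with
  | Some (EOver l) =>
      height x = cross_height l /\ height y = height x - oriented (cross_sign l)
  | Some (EUnder l) =>
      height y = cross_height l /\ height y = height x + oriented (cross_sign l)
  | _ => height y = height x
  end.

(** The region on the left follows the strand around an extremum ([winding_turn]) and keeps its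
    index when an opposite pair of strands appears or disappears ([winding_ins], [winding_insS]). At
    a crossing the strand changes places with one upward strand, which shifts the index by 1. *)
Lemma step_valid x y : valid x -> step x = Some y -> valid y /\ height_ok x y.
Proof.
case: x => [[lev p] [|]] [lelev ltp np] /=.
  case: leqP => // ltlev; have := layP ltlev.
  rewrite /height_ok /= leqNgt ltlev /= /cross_height /cross_sign.
  case E: (lay lev) => [i [pos|u|u]] /= [a [b [sa []]]] E1 E2.
  - have [si si1] : nth false (ori lev) i /\ nth false (ori lev) i.+1.
      by rewrite E1 !nth_cat -sa ltnn ltnNge leqnSn subnn subSn // subnn.
    have szi : (i.+1 < size (ori lev))%N.
      by rewrite E1 size_cat /= sa !addnS !ltnS leq_addr.
    have wi : winding (ori lev) i.+1 = winding (ori lev) i + 1.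
      by rewrite E1 -addn1 -{2}[i]addn0 -sa !winding_at /= winding0 addr0 winding_cons winding0 addr0.
    case: eqP => [->|_] [<-]; last case: eqP => [->|_].
    + rewrite /= E2; split; first by split.
      by case: pos E => E; rewrite /= E /oriented wi; split=> /=; ring.
    + rewrite /= E2; split; first by split=> //; exact: ltnW.
      by case: pos E => E; rewrite /= E /oriented wi; split=> /=; ring.
    + by rewrite /= E2.
  - case: eqP => [Ep|npi]; last case: eqP => [Ep|npi1].
    + case=> <- /=; rewrite E1 -sa; move: np; rewrite E1 Ep -sa nth_ins0 => ->.
      rewrite nth_ins1 winding_turn; split=> //; split=> //.
      by rewrite size_cat /=; lia.
    + case=> <- /=; move: np; rewrite E1 Ep -sa nth_ins1 nth_ins0.
      move/(canRL negbK) => ->; split=> //; split=> //.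
      by rewrite size_cat /=; lia.
    + case=> <- /=; have := ins_del npi npi1.
      move: (if (p < i)%N then p else (p - 2)%N) => p' Ep.
      move: ltp np; rewrite E1 E2 Ep -sa winding_ins size_ins nth_ins.
      by move=> ltp np; do !split => //.
  - case=> <- /=; rewrite E1 E2 -sa -/(ins _ _) winding_ins size_ins nth_ins -E1.
    by do !split.
case: lev lelev ltp np => [|lev] // ltlev ltp np.
have := layP ltlev; rewrite /height_ok /=.
case E: (lay lev) => [i [pos|u|u]] /= [a [b [sa []]]] E1 E2.
- by case=> <- /=; rewrite -E2; do !split => //; apply: ltnW.
- case=> <- /=; rewrite E1 E2 -sa -/(ins _ _) winding_insS size_ins nth_ins -E2.
  by do !split => //; apply: ltnW.
- case: eqP => [Ep|npi]; last case: eqP => [Ep|npi1].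
  + case=> <- /=; move: np; rewrite E2 Ep -sa nth_ins0 nth_ins1 => ->.
    split=> //; split=> //.
    by rewrite size_cat /=; lia.
  + case=> <- /=; rewrite E2 -sa; move: np; rewrite E2 Ep -sa nth_ins1 => /negbFE ->.
    rewrite nth_ins0 winding_turn; split=> //; split=> //.
    by rewrite size_cat /=; lia.
  + case=> <- /=; have := ins_del npi npi1.
    move: (if (p < i)%N then p else (p - 2)%N) => p' Ep.
    move: ltp np; rewrite E1 E2 Ep -sa winding_insS size_ins nth_ins.
    by move=> ltp np; do !split => //; apply: ltnW.
Qed.
End Strand.

(** * The events met along the strand *)

Section StrandEvents.
Variable D : seq layer.
Hypothesis Dwf : isSome (top_boundary D [:: true]).

Lemma valid_bottom : valid D (0%N, 0%N, true).
Proof. by rewrite /valid /ori take0. Qed.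

Lemma trace_valid fuel x :
  x \in trace (step D) fuel (0%N, 0%N, true) -> valid D x.
Proof.
apply: (trace_inv (P := valid D)); first exact: valid_bottom.
by move=> y z vy yz; have [] := step_valid Dwf vy yz.
Qed.

(** The layer of the event, where [false] marks the understrand of a crossing: a crossing has two
    tags, an extremum one. On the way down the layer met is the one below the current level. *)
Definition event_tag (x : state) : option (nat * bool) :=
  omap (fun e => match e with
                 | EOver l => (l, true)
                 | EUnder l => (l, false)
                 | ETurn _ => (if x.2 then x.1.1 else x.1.1.-1, true)
                 end) (event_at D x).

(** An extremum has two ends, but the orientation fixes the one by which it is entered. So the tag
    determines the point of the strand. *)
Lemma event_tag_inj x y t : valid D x -> valid D y ->
  event_tag x = Some t -> event_tag y = Some t -> x = y.
Proof.
have tagP z : valid D z -> event_tag z = Some t ->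
    exists i e, [/\ lay D t.1 = (i, e), (t.1 < size D)%N &
    z = match e with
        | Cross pos => (t.1, if t.2 == pos then i else i.+1, true)
        | Cap u => (t.1, if u then i else i.+1, true)
        | Cup u => (t.1.+1, if u then i.+1 else i, false)
        end].
  case: z => [[lev p] [|]] [lelev ltp np] /=; rewrite /event_tag /=.
    case: (leqP (size D) lev) => // ltlev; have := layP Dwf ltlev.
    case E: (lay D lev) => [i [pos|u|u]] //= [a [b [sa [E1 E2]]]].
    - case: eqP => [->|_]; last case: eqP => // ->.
        by case: pos E => E [<-]; (do 2!eexists); (split; first exact: E).
      by case: pos E => E [<-]; (do 2!eexists); (split; first exact: E).
    - case: eqP => [Ep|_]; last case: eqP => // Ep.
        move: np; rewrite E1 Ep -sa nth_ins0 => Eu [<-].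
        by exists (size a), (Cap u); rewrite /= E sa Eu; split.
      move: np; rewrite E1 Ep -sa nth_ins1 => /negPf Eu [<-].
      by exists (size a), (Cap u); rewrite /= E sa Eu; split.
  case: lev lelev ltp np => [|lev] //= ltlev ltp np; have := layP Dwf ltlev.
  case E: (lay D lev) => [i [pos|u|u]] //= [a [b [sa [E1 E2]]]].
  case: eqP => [Ep|_]; last case: eqP => // Ep.
    move: np; rewrite E2 Ep -sa nth_ins0 => Eu [<-].
    by exists (size a), (Cup u); rewrite /= E sa Eu; split.
  move: np; rewrite E2 Ep -sa nth_ins1 => /negbFE Eu [<-].
  by exists (size a), (Cup u); rewrite /= E sa Eu; split.
move=> vx vy /(tagP _ vx)[i [e [E _ ->]]] /(tagP _ vy)[i' [e' [E' _ ->]]].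
by move: E'; rewrite E => -[<- <-].
Qed.

Definition tags_of (l : nat) : seq (nat * bool) :=
  if is_cross (lay D l) then [:: (l, true); (l, false)] else [:: (l, true)].

Definition all_tags : seq (nat * bool) := flatten (map tags_of (iota 0 (size D))).

Lemma size_all_tags : size all_tags = event_count D.
Proof.
rewrite /all_tags size_flatten /shape -map_comp /event_count; congr sumn.
rewrite -[in RHS](mkseq_nth (0%N, Cross true) D) -map_comp.
by apply: eq_map => l /=; rewrite /tags_of -/(lay D l); case: is_cross.
Qed.

Definition crossings : seq nat := [seq l <- iota 0 (size D) | is_cross (lay D l)].

Definition overs (es : seq event) : seq nat :=
  pmap (fun e => if e is EOver l then Some l else None) es.
Definition unders (es : seq event) : seq nat :=
  pmap (fun e => if e is EUnder l then Some l else None) es.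

Lemma tags_overs s : overs (pmap (event_at D) s) =
  [seq t.1 | t <- pmap event_tag s & t.2 && is_cross (lay D t.1)].
Proof.
elim: s => //= x s IH; rewrite /event_tag; case E: (event_at D x) => [e|] //=.
suff: if e is ETurn _ then ~~ is_cross (lay D (if x.2 then x.1.1 else x.1.1.-1))
      else if e is EOver l then is_cross (lay D l) else true.
  by case: e {E} => [l /= ->|l|u /negPf /= ->] //=; rewrite IH.
case: x E => [[lev p] [|]] /=.
  case: (leqP (size D) lev) => // _; case E: (lay D lev) => [i [pos|u|u]] //.
  - by case: eqP => _; [|case: eqP => // _]; case: pos E => E [<-]; rewrite ?E.
  - by case: eqP => _; [|case: eqP => // _]; case=> <-.
case: lev => [|lev] //; case E: (lay D lev) => [i [pos|u|u]] //.
by case: eqP => _; [|case: eqP => // _]; case=> <-.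
Qed.

Lemma tags_unders s : unders (pmap (event_at D) s) =
  [seq t.1 | t <- pmap event_tag s & ~~ t.2].
Proof.
elim: s => //= x s IH; rewrite /event_tag; case: (event_at D x) => [e|] //=.
by case: e => //= l; rewrite IH.
Qed.

Hypothesis Dall : size (events D) = event_count D.

(** The tags met are distinct and belong to [all_tags]. Since there is no closed component there are
    as many of them, so that each tag occurs exactly once. *)
Lemma events_tags :
  perm_eq (pmap event_tag (trace (step D) ((2 * size D).+2 ^ 2) (0%N, 0%N, true)))
    all_tags.
Proof.
set s := trace _ _ _; have sval x : x \in s -> valid D x by apply: trace_valid.
have uts : uniq (pmap event_tag s).
  apply: uniq_pmap_in => [x y t /sval vx /sval vy|]; first exact: event_tag_inj.
  by apply: trace_uniq; [apply: step_inj | apply: step_bottom].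
have szs : size (pmap event_tag s) = size all_tags.
  rewrite size_all_tags -Dall /events walk_trace -/s !size_pmap.
  by apply: eq_count => x /=; rewrite /event_tag; case: event_at.
have sub : {subset pmap event_tag s <= all_tags}.
  move=> t; rewrite mem_pmap => /mapP[x /sval vx].
  case: x vx => [[lev p] [|]] [lelev ltp np]; rewrite /event_tag /=.
    case: (leqP (size D) lev) => // ltlev; case E: (lay D lev) => [i [pos|u|u]] //= tE;
      (apply/flatten_mapP; exists lev; first by rewrite mem_iota);
      rewrite /tags_of E /=; move: tE; case: eqP => _; [|case: eqP => // _| |case: eqP => // _];
      by case: pos {E} || idtac; case=> ->; rewrite !inE ?eqxx ?orbT.
  case: lev lelev ltp np => [|lev] // ltlev _ _.
  case E: (lay D lev) => [i [pos|u|u]] //= tE.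
  apply/flatten_mapP; exists lev; first by rewrite mem_iota.
  rewrite /tags_of E /=; move: tE; case: eqP => _; last case: eqP => // _.
    by case=> ->; rewrite inE.
  by case=> ->; rewrite inE.
have [_ eqi] := uniq_min_size uts sub (eq_leq (esym szs)).
by apply: uniq_perm => //; apply: leq_size_uniq uts sub (eq_leq (esym szs)).
Qed.

Lemma events_overs : perm_eq (overs (events D)) crossings.
Proof.
rewrite /events walk_trace tags_overs.
apply: perm_trans (perm_map _ (perm_filter _ events_tags)) _.
rewrite /all_tags /crossings; elim: (iota _ _) => //= l r IH.
rewrite filter_cat map_cat {1}/tags_of; case E: (is_cross (lay D l)) => /=.
  by rewrite E perm_cons.
by rewrite E.
Qed.

Lemma events_unders : perm_eq (unders (events D)) crossings.
Proof.
rewrite /events walk_trace tags_unders.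
apply: perm_trans (perm_map _ (perm_filter _ events_tags)) _.
rewrite /all_tags /crossings; elim: (iota _ _) => //= l r IH.
rewrite filter_cat map_cat {1}/tags_of; case E: (is_cross (lay D l)) => //=.
by rewrite perm_cons.
Qed.

Fixpoint events_gauge (w : int) (es : seq event) : Prop :=
  match es with
  | [::] => True
  | EOver l :: es' =>
      w = cross_height D l /\ events_gauge (w - oriented (cross_sign D l)) es'
  | EUnder l :: es' =>
      w + oriented (cross_sign D l) = cross_height D l
      /\ events_gauge (w + oriented (cross_sign D l)) es'
  | ETurn _ :: es' => events_gauge w es'
  end.

(** At the bottom no strand lies to the left of the open one, so that the heights start from 0. *)
Lemma events_gaugeP : events_gauge 0 (events D).
Proof.
have -> : 0 = height D (0%N, 0%N, true) by rewrite /height /ori take0 winding0 oppr0.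
rewrite /events walk_trace; move: valid_bottom (_ ^ 2)%N.
move: (0%N, 0%N, true) => x vx fuel; elim: fuel x vx => //= fuel IH x vx.
case xy: (step D x) => [y|]; last first.
  suff -> : event_at D x = None by [].
  case: x xy {vx} => [[lev p] [|]] /=.
    case: (leqP (size D) lev) => // _; case: (lay D lev) => i [pos|u|u] //.
    by case: eqP => // _; case: eqP.
  case: lev => [|lev] //; case: (lay D lev) => i [pos|u|u] //.
  by case: eqP => // _; case: eqP.
have [/IH gy] := step_valid Dwf vx xy; rewrite /height_ok.
case: (event_at D x) => [[l|l|u]|] /=.
- by case=> <- <-.
- by case=> E <-.
- by move <-.
- by move <-.
Qed.

End StrandEvents.

Fixpoint bead_gauge (D : seq layer) (w : int) (bs : seq bead) : Prop :=
  match bs with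
  | [::] => True
  | Over l :: bs' =>
      w = cross_height D l /\ bead_gauge D (w - oriented (cross_sign D l)) bs'
  | Under l :: bs' =>
      w + oriented (cross_sign D l) = cross_height D l
      /\ bead_gauge D (w + oriented (cross_sign D l)) bs'
  | Rot _ :: bs' => bead_gauge D w bs'
  end.

Definition bead_overs (bs : seq bead) : seq nat :=
  pmap (fun b => if b is Over l then Some l else None) bs.
Definition bead_unders (bs : seq bead) : seq nat :=
  pmap (fun b => if b is Under l then Some l else None) bs.

(** Extrema leave the height unchanged, so that merging two of them into a rotation keeps the gauge
    condition. The induction is on the size because a rotation consumes two events. *)
Lemma rotations_beads D es bs : rotations es = Some bs ->
  [/\ bead_overs bs = overs es, bead_unders bs = unders es
    & forall w, events_gauge D w es -> bead_gauge D w bs].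
Proof.
have [n] := ubnP (size es); elim: n es bs => // n IH [|e es] bs /=; first by move=> _ [<-].
case: e => [l|l|u] lt.
- case E: (rotations es) => [bs'|] //= [<-]; have [//|<- <- g] := IH _ _ _ E.
  by split=> // w /= [-> /g].
- case E: (rotations es) => [bs'|] //= [<-]; have [//|<- <- g] := IH _ _ _ E.
  by split=> // w /= [-> /g].
- case: es lt => [|[l|l|v] es] lt //; case: eqP => // _.
  case E: (rotations es) => [bs'|] //= [<-]; have [|<- <- g] := IH _ _ _ E.
    exact: ltnW lt.
  by split=> // w /= /g.
Qed.

Section Knot.
Variable K : long_knot.

Lemma knot_wf : [/\ isSome (top_boundary K [:: true]),
  size (events K) = event_count K & isSome (rotations (events K))].
Proof. by have /and3P[/eqP -> /eqP -> ->] := diagram_wf K. Qed.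

Lemma knot_beads : [/\ perm_eq (bead_overs (beads K)) (crossings K),
  perm_eq (bead_unders (beads K)) (crossings K) & bead_gauge K 0 (beads K)].
Proof.
have [Kwf Kall Krot] := knot_wf.
rewrite /beads; case E: (rotations (events K)) Krot => [bs|] //= _.
have [-> -> g] := rotations_beads K E.
by split; [apply: events_overs | apply: events_unders | apply/g/events_gaugeP].
Qed.

Lemma framing_crossings :
  framing K = \sum_(l <- crossings K) oriented (cross_sign K l).
Proof.
rewrite /framing -[X in \sum_(_ <- X) _](mkseq_nth (0%N, Cross true)) big_map.
rewrite big_filter [RHS]big_mkcond; apply: eq_bigr => l _.
by rewrite /is_cross /cross_sign -/(lay K l); case: (lay K l) => i [[]|u|u].
Qed.

End Knot.

(** * Dependence of the universal invariant on the R-matrix *)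

Section Labelings.
Variable T : Type.

Definition labels (Ls : seq (seq T)) : seq (seq T) :=
  foldr (fun L V => [seq x :: v | x <- L, v <- V]) [:: [::]] Ls.

Lemma size_labels Ls : all (fun v => size v == size Ls) (labels Ls).
Proof.
elim: Ls => //= L Ls IH; elim: L => //= x L IHL.
by rewrite all_cat IHL andbT all_map; apply: sub_all IH => v /eqP /= ->.
Qed.

Variable M : nmodType.

Lemma sum_labels_cons L Ls (F : seq T -> M) :
  \sum_(v <- labels (L :: Ls)) F v =
  \sum_(x <- L) \sum_(v <- labels Ls) F (x :: v).
Proof. by rewrite big_allpairs_dep. Qed.

(** The lists are replaced one position at a time, with all other labels kept fixed. *)
Lemma sum_labels_replace Ls Ls' (F : seq T -> M) : size Ls = size Ls' ->
  (forall u w, (size u < size Ls)%N ->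
    \sum_(x <- nth [::] Ls (size u)) F (u ++ x :: w) =
    \sum_(x <- nth [::] Ls' (size u)) F (u ++ x :: w)) ->
  \sum_(v <- labels Ls) F v = \sum_(v <- labels Ls') F v.
Proof.
elim: Ls Ls' F => [|L Ls IH] [|L' Ls'] F // [szL] EF.
rewrite !sum_labels_cons.
under eq_bigr => x _.
  rewrite (IH Ls' (fun v => F (x :: v))) //; last first.
    by move=> u w ltu; apply: (EF (x :: u)).
  over.
by rewrite exchange_big [RHS]exchange_big; apply: eq_bigr => v _; apply: (EF [::]).
Qed.

Fixpoint mapi (f : nat -> T -> T) k (v : seq T) : seq T :=
  if v is x :: v' then f k x :: mapi f k.+1 v' else [::].

Lemma size_mapi f k v : size (mapi f k v) = size v.
Proof. by elim: v k => //= x v IH k; rewrite IH. Qed.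

Lemma nth_mapi x0 f k v i : (i < size v)%N ->
  nth x0 (mapi f k v) i = f (k + i)%N (nth x0 v i).
Proof.
elim: v k i => //= x v IH k [|i]; first by rewrite addn0.
by move=> lti; rewrite /= IH ?addSnnS.
Qed.

Fixpoint mapli (f : nat -> T -> T) k (Ls : seq (seq T)) : seq (seq T) :=
  if Ls is L :: Ls' then map (f k) L :: mapli f k.+1 Ls' else [::].

Lemma size_mapli f k Ls : size (mapli f k Ls) = size Ls.
Proof. by elim: Ls k => //= x v IH k; rewrite IH. Qed.

Lemma nth_mapli f k Ls i :
  nth [::] (mapli f k Ls) i = map (f (k + i)%N) (nth [::] Ls i).
Proof.
by elim: Ls k i => [|L Ls IH] k [|i] //=; rewrite ?addn0 // IH addSnnS.
Qed.

Lemma sum_labels_mapli f k Ls (F : seq T -> M) :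
  \sum_(v <- labels (mapli f k Ls)) F v = \sum_(v <- labels Ls) F (mapi f k v).
Proof.
elim: Ls k F => [|L Ls IH] k F /=; first by rewrite !big_seq1.
rewrite !sum_labels_cons big_map; apply: eq_bigr => x _.
by rewrite (IH _ (fun v => F (f k x :: v))).
Qed.

End Labelings.

Section StateSum.
Variable A : pzRingType.
Variables kappa kappainv : A.

Definition bead_prod (v : seq (A * A)) (bs : seq bead) : A :=
  \prod_(b <- rev bs) bead_val kappa kappainv v b.

Definition state_sum (Ls : seq (seq (A * A))) (bs : seq bead) : A :=
  \sum_(v <- labels Ls) bead_prod v bs.

Lemma bead_prod_cons v b bs :
  bead_prod v (b :: bs) = bead_prod v bs * bead_val kappa kappainv v b.
Proof. by rewrite /bead_prod rev_cons big_rcons. Qed.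

Lemma bead_prod_cat v bs1 bs2 :
  bead_prod v (bs1 ++ bs2) = bead_prod v bs2 * bead_prod v bs1.
Proof. by rewrite /bead_prod rev_cat big_cat. Qed.

Lemma bead_prod_eq u x y w bs : size u \notin bead_overs bs ->
  size u \notin bead_unders bs ->
  bead_prod (u ++ x :: w) bs = bead_prod (u ++ y :: w) bs.
Proof.
have nthE l : l <> size u ->
    nth (1, 1) (u ++ x :: w) l = nth (1, 1) (u ++ y :: w) l.
  rewrite !nth_cat => nl; case: ltnP => // lul.
  have: (0 < l - size u)%N by rewrite subn_gt0 ltn_neqAle lul andbT; apply/eqP/nesym.
  by case: (l - size u)%N.
elim: bs => [|b bs IH]; first by rewrite /bead_prod !big_nil.
rewrite !bead_prod_cons.
case: b => [l|l|r] /=; rewrite ?inE ?negb_or.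
- by move=> /andP[/eqP nl no] nu; rewrite IH // nthE //; apply/nesym.
- by move=> no /andP[/eqP nl nu]; rewrite IH // nthE //; apply/nesym.
- by move=> no nu; rewrite IH.
Qed.

End StateSum.

Lemma universal_invariantE (A : pzRingType) R Rinv (kappa kappainv : A) K :
  universal_invariant R Rinv kappa kappainv K =
  state_sum kappa kappainv (map (layer_beads R Rinv) K) (beads K).
Proof.
rewrite /universal_invariant /state_sum /bead_prod.
suff -> : labelings R Rinv K = labels (map (layer_beads R Rinv) K) by [].
by rewrite /labelings /labels; elim: (diagram K) => //= l D ->.
Qed.

Lemma universal_invariant_morph (A B : pzRingType) (f : {rmorphism A -> B})
    R Rinv kappa kappainv K :
  f (universal_invariant R Rinv kappa kappainv K) =
  universal_invariant [seq (f x.1, f x.2) | x <- R] [seq (f x.1, f x.2) | x <- Rinv]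
    (f kappa) (f kappainv) K.
Proof.
rewrite !universal_invariantE /state_sum rmorph_sum /=.
have -> : map (layer_beads [seq (f x.1, f x.2) | x <- R]
                [seq (f x.1, f x.2) | x <- Rinv]) K =
    map (map (fun x => (f x.1, f x.2))) (map (layer_beads R Rinv) K).
  rewrite -map_comp; apply: eq_map => -[i [[]|u|u]] //=;
    by rewrite /layer_beads /= !rmorph1.
have labE Ls : labels (map (map (fun x => (f x.1, f x.2))) Ls) =
    map (map (fun x => (f x.1, f x.2))) (labels Ls).
  elim: Ls => //= L Ls ->; elim: L => //= x L IH.
  by rewrite map_cat IH -!map_comp.
rewrite labE big_map; apply: eq_bigr => v _.
rewrite /bead_prod rmorph_prod; apply: eq_bigr => -[l|l|[]] _ //=.
  by elim: v l => [|x v IH] [|l] //=; rewrite rmorph1.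
by elim: v l => [|x v IH] [|l] //=; rewrite rmorph1.
Qed.

Section Kron.
Variables (C : comPzRingType) (n : nat).
Implicit Types X : seq ('M[C]_n * 'M[C]_n).

Definition kron X : 'M[C]_(n * n) := \sum_(x <- X) x.1 *t x.2.

(** The decomposition along matrix units; [Uq_Rinv] is its value at the inverse of the R-matrix. *)
Definition pure_tensors (T : 'M[C]_(n * n)) : seq ('M[C]_n * 'M[C]_n) :=
  [seq (T (mxtens_index ij) (mxtens_index ij') *: delta_mx ij.1 ij'.1,
        delta_mx ij.2 ij'.2)
     | ij <- enum {: 'I_n * 'I_n}, ij' <- enum {: 'I_n * 'I_n}].

Lemma kronE X i j k l :
  kron X (mxtens_index (i, j)) (mxtens_index (k, l)) =
  \sum_(x <- X) x.1 i k * x.2 j l.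
Proof. by rewrite summxE; apply: eq_bigr => x _; rewrite tensmxE. Qed.

Lemma kron_pure_tensors T : kron (pure_tensors T) = T.
Proof.
apply/matrixP => a b; rewrite -(mxtens_unindexK a) -(mxtens_unindexK b).
case: (mxtens_unindex a) (mxtens_unindex b) => [i j] [k l].
rewrite kronE big_allpairs_dep big_enum /=.
under eq_bigr => p _ do rewrite big_enum /=.
rewrite (bigD1 (i, j)) //= (bigD1 (k, l)) //= !mxE !eqxx !mulr1 big1 ?addr0 => [|[k' l'] /= nkl].
  rewrite big1 ?addr0 // => -[i' j'] /= nij; rewrite big1 // => ij' _.
  rewrite !mxE; move: nij; rewrite xpair_eqE eq_sym [j' == j]eq_sym.
  by case: eqP => //= _; rewrite ?mulr0 ?mul0r // => /negPf ->; rewrite mulr0.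
rewrite !mxE; move: nkl; rewrite xpair_eqE eq_sym [l' == l]eq_sym.
by case: eqP => //= _; rewrite ?andbF ?mulr0 ?mul0r // => /negPf ->; rewrite andbF mulr0.
Qed.

(** Expanding both slots in matrix units shows that the sum depends on the tensor alone, and not on
    its decomposition into pure tensors. *)
Lemma kron_bilinear X (f : 'M[C]_n -> 'M[C]_n -> C) :
  (forall a x x' y, f (a *: x + x') y = a * f x y + f x' y) ->
  (forall a x y y', f x (a *: y + y') = a * f x y + f x y') ->
  \sum_(x <- X) f x.1 x.2 =
  \sum_(p : 'I_n * 'I_n) \sum_(q : 'I_n * 'I_n)
    kron X (mxtens_index (p.1, q.1)) (mxtens_index (p.2, q.2))
      * f (delta_mx p.1 p.2) (delta_mx q.1 q.2).
Proof.
move=> fl fr.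
have fl0 y : f 0 y = 0.
  by have := fl (-1) 0 0 y; rewrite scaler0 addr0 mulN1r addNr.
have fr0 x : f x 0 = 0.
  by have := fr (-1) x 0 0; rewrite scaler0 addr0 mulN1r addNr.
have flD I (s : seq I) (c : I -> C) (m : I -> 'M_n) y :
    f (\sum_(i <- s) c i *: m i) y = \sum_(i <- s) c i * f (m i) y.
  by elim: s => [|i s IH]; rewrite ?big_nil // !big_cons fl IH.
have frD I (s : seq I) (c : I -> C) (m : I -> 'M_n) x :
    f x (\sum_(i <- s) c i *: m i) = \sum_(i <- s) c i * f x (m i).
  by elim: s => [|i s IH]; rewrite ?big_nil // !big_cons fr IH.
have mxD (x : 'M[C]_n) :
    x = \sum_(p : 'I_n * 'I_n) x p.1 p.2 *: delta_mx p.1 p.2.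
  by rewrite {1}[x]matrix_sum_delta pair_big.
under eq_bigr => x _.
  rewrite [x.1]mxD [x.2]mxD flD.
  under eq_bigr => p _ do rewrite frD mulr_sumr.
  over.
rewrite exchange_big; apply: eq_bigr => p _.
rewrite exchange_big; apply: eq_bigr => q _.
rewrite kronE mulr_suml; apply: eq_bigr => x _.
by rewrite mulrA.
Qed.

Lemma kron_slots X X' (P1 P2 P3 : 'M[C]_n) : kron X = kron X' ->
  \sum_(x <- X) P1 * x.1 * P2 * x.2 * P3 = \sum_(x <- X') P1 * x.1 * P2 * x.2 * P3
  /\ \sum_(x <- X) P1 * x.2 * P2 * x.1 * P3 =
     \sum_(x <- X') P1 * x.2 * P2 * x.1 * P3.
Proof.
move=> EX; split; apply/matrixP => i j; rewrite !summxE.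
  pose f (x y : 'M[C]_n) := (P1 * x * P2 * y * P3) i j.
  rewrite !(@kron_bilinear _ f) ?EX // /f => a x y z;
  by rewrite -!mulmxE !(mulmxDr, mulmxDl) -!(scalemxAr, scalemxAl) !mxE.
pose f (x y : 'M[C]_n) := (P1 * y * P2 * x * P3) i j.
rewrite !(@kron_bilinear _ f) ?EX // /f => a x y z;
by rewrite -!mulmxE !(mulmxDr, mulmxDl) -!(scalemxAr, scalemxAl) !mxE.
Qed.

End Kron.

Lemma split_beads (bs : seq bead) l :
  count_mem l (bead_overs bs) = 1%N -> count_mem l (bead_unders bs) = 1%N ->
  exists b1 b2 b3,
    (bs = b1 ++ Over l :: b2 ++ Under l :: b3 \/
     bs = b1 ++ Under l :: b2 ++ Over l :: b3) /\
    [/\ l \notin bead_overs (b1 ++ b2 ++ b3) & l \notin bead_unders (b1 ++ b2 ++ b3)].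
Proof.
have one (P : bead -> option nat) (u : bead) bs' :
  (forall b, P b = Some l -> b = u) -> count_mem l (pmap P bs') = 1%N ->
  exists b1 b2, bs' = b1 ++ u :: b2 /\ l \notin pmap P (b1 ++ b2).
- move=> Pu; elim: bs' => //= b bs' IH; case Pb: (P b) => [l'|] /=; last first.
    by case/IH => b1 [b2 [-> nl]]; exists (b :: b1), b2; rewrite /= Pb.
  case: eqP => [El|nl].
    rewrite add1n => -[/eqP c0]; exists [::], bs'.
    by rewrite (Pu b) ?Pb ?El //= -has_pred1 has_count -eqn0Ngt.
  rewrite add0n => /IH [b1 [b2 [-> nl2]]]; exists (b :: b1), b2.
  by split=> //=; rewrite Pb /= inE negb_or nl2 andbT; apply/eqP/nesym.
move=> co cu.
have overP b : (if b is Over l' then Some l' else None) = Some l -> b = Over l.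
  by case: b => // l' [->].
have underP b : (if b is Under l' then Some l' else None) = Some l -> b = Under l.
  by case: b => // l' [->].
have [b1 [b2 [E no]]] := one _ _ _ overP co.
have notin (b : seq nat) : count_mem l b = 0%N -> l \notin b.
  by move/eqP; rewrite -has_pred1 has_count -eqn0Ngt.
rewrite pmap_cat mem_cat negb_or in no; case/andP: no => no1 no2.
move: cu; rewrite E /bead_unders pmap_cat count_cat /=.
case c1: (count_mem l (pmap _ b1)) => [|[|m]] // c2.
  have [b3 [b4 [E2 nu]]] := one _ _ _ underP c2.
  exists b1, b3, b4; split; first by left; rewrite E2.
  move: no2; rewrite E2 /bead_overs /bead_unders !pmap_cat /= !mem_cat.
  move=> /norP[no2 no3]; rewrite !negb_or no1 no2 no3 notin //=.
  by split=> //; move: nu; rewrite pmap_cat mem_cat negb_or => /andP[-> ->].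
have [b3 [b4 [E2 nu]]] := one _ _ _ underP c1.
exists b3, b4, b2; split; first by right; rewrite E2 -catA.
have c2' : count_mem l (bead_unders b2) = 0%N by case: c2.
move: no1; rewrite E2 /bead_overs /bead_unders !pmap_cat /= !mem_cat.
move=> /norP[no1 no3]; rewrite !negb_or no1 no2 no3 (notin _ c2') andbT /=.
by split=> //; move: nu; rewrite pmap_cat mem_cat negb_or => /andP[-> ->].
Qed.

(* Each crossing is met exactly once on either strand, so that the state sum is
   bilinear in the two beads of a crossing. *)
Lemma state_sum_kron (C : comPzRingType) n (kappa kappainv : 'M[C]_n)
    (Ls Ls' : seq (seq ('M[C]_n * 'M[C]_n))) bs :
  size Ls = size Ls' ->
  (forall l, (l < size Ls)%N -> nth [::] Ls l = nth [::] Ls' l \/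
     [/\ count_mem l (bead_overs bs) = 1%N, count_mem l (bead_unders bs) = 1%N
       & kron (nth [::] Ls l) = kron (nth [::] Ls' l)]) ->
  state_sum kappa kappainv Ls bs = state_sum kappa kappainv Ls' bs.
Proof.
move=> szL EL; apply: sum_labels_replace => // u w ltu.
have [->//|[co cu EX]] := EL _ ltu.
have [b1 [b2 [b3 [Ebs [no nu]]]]] := split_beads co cu.
pose y : 'M[C]_n * 'M[C]_n := (1, 1).
pose P b := bead_prod kappa kappainv (u ++ y :: w) b.
have PE x b : {subset bead_overs b <= bead_overs (b1 ++ b2 ++ b3)} ->
    {subset bead_unders b <= bead_unders (b1 ++ b2 ++ b3)} ->
    bead_prod kappa kappainv (u ++ x :: w) b = P b.
  by move=> so su; apply: bead_prod_eq; [apply: contra no => /so|apply: contra nu => /su].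
have E x : [/\ bead_prod kappa kappainv (u ++ x :: w) b1 = P b1,
    bead_prod kappa kappainv (u ++ x :: w) b2 = P b2
  & bead_prod kappa kappainv (u ++ x :: w) b3 = P b3].
  split; apply: PE => z; rewrite /bead_overs /bead_unders !pmap_cat !mem_cat => ->;
  by rewrite ?orbT.
have valO x : bead_val kappa kappainv (u ++ x :: w) (Over (size u)) = x.1.
  by rewrite /= nth_cat ltnn subnn.
have valU x : bead_val kappa kappainv (u ++ x :: w) (Under (size u)) = x.2.
  by rewrite /= nth_cat ltnn subnn.
have [ES1 ES2] := kron_slots (P b3) (P b2) (P b1) EX.
case: Ebs => ->.
  have F x : bead_prod kappa kappainv (u ++ x :: w)
      (b1 ++ Over (size u) :: b2 ++ Under (size u) :: b3) =
      P b3 * x.2 * P b2 * x.1 * P b1.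
    rewrite bead_prod_cat bead_prod_cons bead_prod_cat bead_prod_cons valO valU.
    by have [-> -> ->] := E x.
  by under eq_bigr do rewrite F; under [RHS]eq_bigr do rewrite F.
have F x : bead_prod kappa kappainv (u ++ x :: w)
    (b1 ++ Under (size u) :: b2 ++ Over (size u) :: b3) =
    P b3 * x.1 * P b2 * x.2 * P b1.
  rewrite bead_prod_cat bead_prod_cons bead_prod_cat bead_prod_cons valO valU.
  by have [-> -> ->] := E x.
by under eq_bigr do rewrite F; under [RHS]eq_bigr do rewrite F.
Qed.

Lemma knot_crossing_count (K : long_knot) l :
  (l < size K)%N -> is_cross (lay K l) ->
  count_mem l (bead_overs (beads K)) = 1%N /\
  count_mem l (bead_unders (beads K)) = 1%N.
Proof.
move=> ltl cl; have [/permP -> /permP -> _] := knot_beads K.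
rewrite count_uniq_mem ?filter_uniq ?iota_uniq //.
by rewrite mem_filter cl mem_iota add0n ltl.
Qed.

Section KronInvariant.
Variables (C : comPzRingType) (n : nat).

Lemma universal_invariant_kron (R R' Rinv Rinv' : seq ('M[C]_n * 'M[C]_n))
    kappa kappainv K :
  kron R = kron R' -> kron Rinv = kron Rinv' ->
  universal_invariant R Rinv kappa kappainv K =
  universal_invariant R' Rinv' kappa kappainv K.
Proof.
move=> ER ERinv; rewrite !universal_invariantE; apply: state_sum_kron.
  by rewrite !size_map.
move=> l; rewrite size_map => ltl.
rewrite !(nth_map (0%N, Cross true)) // -/(lay K l).
have := knot_crossing_count ltl; rewrite /is_cross /layer_beads.
by case: (lay K l) => i [[]|u|u] /=; [case=> // ? ?; right..|left|left].
Qed.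

(** The invariant as a function of the matrices of R and its inverse. It no longer depends on chosen
    sums of pure tensors, so that it can be compared over different rings entry by entry. *)
Definition knot_mx (R Rinv : 'M[C]_(n * n)) (kappa kappainv : 'M[C]_n) K :=
  universal_invariant (pure_tensors R) (pure_tensors Rinv) kappa kappainv K.

Lemma universal_invariant_knot_mx R Rinv kappa kappainv K :
  universal_invariant R Rinv kappa kappainv K =
  knot_mx (kron R) (kron Rinv) kappa kappainv K.
Proof. by apply: universal_invariant_kron; rewrite kron_pure_tensors. Qed.

End KronInvariant.

Lemma Forall2_cat (T T' : Type) (r : T -> T' -> Prop) s1 s1' s2 s2' :
  List.Forall2 r s1 s1' -> List.Forall2 r s2 s2' ->
  List.Forall2 r (s1 ++ s2) (s1' ++ s2').
Proof. by move=> r1 r2; elim: r1 => //= x x' s s' rx _ IH; constructor. Qed.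

(** For a fixed diagram the entries of the state sum are obtained from those of the four matrices by
    sums and products only, and these respect r. *)
Lemma knot_mx_rel (C C' : comPzRingType) (r : C -> C' -> Prop) n
    (R Rinv : 'M[C]_(n * n)) (R' Rinv' : 'M[C']_(n * n))
    (kappa kappainv : 'M[C]_n) (kappa' kappainv' : 'M[C']_n) K :
  ring_rel r -> mx_rel r R R' -> mx_rel r Rinv Rinv' ->
  mx_rel r kappa kappa' -> mx_rel r kappainv kappainv' ->
  mx_rel r (knot_mx R Rinv kappa kappainv K) (knot_mx R' Rinv' kappa' kappainv' K).
Proof.
move=> rr rR rRinv rk rki; have mrr := mx_rel_ring rr n.
have rdelta i j : mx_rel r (delta_mx i j : 'M[C]_n) (delta_mx i j).
  by move=> i' j'; rewrite !mxE; apply: (ring_relMn rr); apply: ring_rel1 rr.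
rewrite /knot_mx !universal_invariantE /state_sum.
pose rp (x : 'M[C]_n * 'M[C]_n) (x' : 'M[C']_n * 'M[C']_n) :=
  mx_rel r x.1 x'.1 /\ mx_rel r x.2 x'.2.
have rp1 : rp (1, 1) (1, 1) by split; apply: ring_rel1 mrr.
have rpure (T : 'M[C]_(n * n)) (T' : 'M[C']_(n * n)) : mx_rel r T T' ->
    List.Forall2 rp (pure_tensors T) (pure_tensors T').
  move=> rT; rewrite /pure_tensors; elim: (enum _) {1 3}(enum _) => //= ij e IH e'.
  apply: Forall2_cat => //; elim: e' => //= ij' e' IHe; constructor=> //.
  by split=> //= i j; rewrite !mxE; apply: (ring_relM rr) => //; have := rdelta ij.1 ij'.1 i j; rewrite !mxE.
have rlay : List.Forall2 (List.Forall2 rp)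
    (map (layer_beads (pure_tensors R) (pure_tensors Rinv)) K)
    (map (layer_beads (pure_tensors R') (pure_tensors Rinv')) K).
  elim: (diagram K) => //= -[i [[]|u|u]] D IH; constructor=> //; try exact: rpure;
  by constructor=> //; constructor.
have rlab : List.Forall2 (List.Forall2 rp)
    (labels (map (layer_beads (pure_tensors R) (pure_tensors Rinv)) K))
    (labels (map (layer_beads (pure_tensors R') (pure_tensors Rinv')) K)).
  elim: rlay => [|L L' Ls Ls' rL _ IH] /=; first by constructor=> //; constructor.
  elim: rL => //= x x' s s' rx _ IHs; apply: Forall2_cat => //.
  by elim: IH => //= v v' V V' rv _ IHv; constructor=> //; constructor.
elim: rlab => [|v v' V V' rv _ IH]; first by rewrite !big_nil; apply: ring_rel0 mrr.
rewrite !big_cons; apply: (ring_relD mrr) => //; apply: (ring_rel_prod mrr).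
have rnth l : rp (nth (1, 1) v l) (nth (1, 1) v' l).
  by elim: rv l => [|x x' s s' rx _ IHs] [|l] /=.
by move=> [l|l|[]] _ //=; have [] := rnth l.
Qed.

Lemma tens11 (C : pzRingType) n : (1%:M : 'M[C]_n) *t (1%:M : 'M[C]_n) = 1%:M.
Proof.
apply/matrixP => a b; rewrite -(mxtens_unindexK a) -(mxtens_unindexK b).
case: (mxtens_unindex a) (mxtens_unindex b) => [i j] [k l].
by rewrite tensmxE !mxE (can_eq (@mxtens_indexK n n)) xpair_eqE -natrM mulnb.
Qed.

(** * Gauge transformations of the R-matrix *)

Section Gauge.
Variables (C : comPzRingType) (n : nat) (K : long_knot).
Variables (G : int -> 'M[C]_n) (kappa kappainv : 'M[C]_n) (c cinv : C).
Hypotheses (G0 : G 0 = 1) (GD : forall i j, G (i + j) = G i * G j).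
Hypotheses (Gk : forall i, G i * kappa = kappa * G i)
           (Gki : forall i, G i * kappainv = kappainv * G i).
Hypothesis cK : c * cinv = 1.

Definition gauge_scalar (s : bool) : C := if s then c else cinv.

(** A bead gets G of the height at which its strand enters the crossing on the right, and the
    inverse of G of the height at which it leaves on the left. Since beads are multiplied from right
    to left, factors from consecutive beads cancel. The scalar is put on the overstrand only, and so
    counts once per crossing. *)
Definition gauge_bead (l : nat) (x : 'M[C]_n * 'M[C]_n) : 'M[C]_n * 'M[C]_n :=
  if is_cross (lay K l) then
    let h := cross_height K l in
    let s := cross_sign K l in
    (gauge_scalar s *: (G (- (h - oriented s)) * x.1 * G h),
     G (- h) * x.2 * G (h - oriented s))
  else x.

Lemma gaugeK i : G i * G (- i) = 1.
Proof. by rewrite -GD subrr. Qed.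

(** By telescoping only G at the initial height w and the inverse of G at the final height survive;
    the rotation beads commute with G. *)
Lemma bead_prod_gauge v w bs : size v = size K ->
  {subset bead_overs bs <= crossings K} -> {subset bead_unders bs <= crossings K} ->
  bead_gauge K w bs ->
  bead_prod kappa kappainv (mapi gauge_bead 0 v) bs =
  (\prod_(l <- bead_overs bs) gauge_scalar (cross_sign K l)) *:
    (G (- (w - \sum_(l <- bead_overs bs) oriented (cross_sign K l)
             + \sum_(l <- bead_unders bs) oriented (cross_sign K l)))
     * bead_prod kappa kappainv v bs * G w).
Proof.
move=> szv; have nthE l : l \in crossings K ->
    nth (1, 1) (mapi gauge_bead 0 v) l = gauge_bead l (nth (1, 1) v l)
    /\ is_cross (lay K l).
  rewrite mem_filter mem_iota add0n => /andP[cl ltl].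
  by rewrite nth_mapi ?szv // add0n.
elim: bs w => [|b bs IH] w.
  by rewrite /bead_prod !big_nil /= subr0 addr0 scale1r mulr1 -GD addNr G0.
case: b => [l|l|r] /= so su; rewrite !bead_prod_cons.
- have [E cl] := nthE l (so _ (mem_head _ _)).
  case=> Ew /IH ->; last by []; last first.
    by move=> l' l'b; apply: so; rewrite inE l'b orbT.
  rewrite !big_cons /= E /gauge_bead cl /= -Ew.
  rewrite -!mulmxE -scalemxAl -scalemxAr scalerA mulrC !mulmxE; congr (_ *: _).
  rewrite !mulrA -[_ * G (w - _) * _]mulrA gaugeK mulr1.
  by congr (G _ * _ * _ * _); ring.
- have [E cl] := nthE l (su _ (mem_head _ _)).
  case=> Ew /IH ->; last first.
  + by move=> l' l'b; apply: su; rewrite inE l'b orbT.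
  + by [].
  rewrite !big_cons /= E /gauge_bead cl /= -Ew addrK.
  rewrite -!mulmxE -scalemxAl !mulmxE; congr (_ *: _).
  rewrite !mulrA -[_ * G (w + _) * _]mulrA gaugeK mulr1.
  by congr (G _ * _ * _ * _); ring.
- move/IH => ->; [|by []|by []].
  rewrite -!mulmxE -scalemxAl !mulmxE; congr (_ *: _).
  rewrite -!mulrA; do 2!congr (_ * _).
  by case: r; rewrite ?Gk ?Gki.
Qed.

Variables T Tinv : 'M[C]_(n * n).
Hypotheses (GT : forall i, (G i *t G i) *m T = T *m (G i *t G i))
           (GTinv : forall i, (G i *t G i) *m Tinv = Tinv *m (G i *t G i)).

(** The two slots share the factor G(h - s), which passes through the tensor because G (x) G
    commutes with it, and cancels. What remains depends on the sign of the crossing but not on its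
    height. *)
Lemma kron_gauge l (X : seq ('M[C]_n * 'M[C]_n)) (o := oriented (cross_sign K l)) :
  (forall i, (G i *t G i) *m kron X = kron X *m (G i *t G i)) ->
  is_cross (lay K l) ->
  kron (map (gauge_bead l) X) =
  gauge_scalar (cross_sign K l) *: ((1 *t G (- o)) *m kron X *m (G o *t 1)).
Proof.
move=> GX cl; rewrite /gauge_bead cl -/o.
set h := cross_height K l; set g := gauge_scalar _.
transitivity (g *: ((G (- (h - o)) *t G (- h)) *m kron X *m (G h *t G (h - o)))).
  rewrite /kron big_map mulmx_sumr mulmx_suml scaler_sumr.
  apply: eq_bigr => x _ /=; rewrite !tensmx_mul.
  by apply/matrixP => i j; rewrite !mxE mulrA.
congr (_ *: _).
have -> : G (- (h - o)) *t G (- h) =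
    (1 *t G (- o)) *m (G (- (h - o)) *t G (- (h - o))).
  by rewrite tensmx_mul !mulmxE mul1r -GD; congr (_ *t G _); ring.
have -> : G h *t G (h - o) = (G (h - o) *t G (h - o)) *m (G o *t 1).
  by rewrite tensmx_mul !mulmxE mulr1 -GD subrK.
rewrite -!mulmxA; congr (_ *m _); rewrite !mulmxA GX; congr (_ *m _).
rewrite -mulmxA tensmx_mul !mulmxE -GD addNr G0.
by rewrite -[1]/(1%:M) tens11 mulr1.
Qed.

(** By [kron_gauge] the change of R-matrix can be made on the beads of each crossing. Every crossing
    is passed once over and once under, so that the strand ends at the height 0 at which it began
    and no G is left; the scalars multiply to c to the power of the writhe. *)
Lemma knot_mx_gauge : framing K = 0 ->
  knot_mx (c *: ((1 *t G (- 1)) *m T *m (G 1 *t 1)))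
          (cinv *: ((1 *t G 1) *m Tinv *m (G (- 1) *t 1))) kappa kappainv K
  = knot_mx T Tinv kappa kappainv K.
Proof.
move=> fr0; have [pov pun bg] := knot_beads K.
rewrite /knot_mx !universal_invariantE.
set Ls := map (layer_beads (pure_tensors T) _) K.
transitivity (state_sum kappa kappainv (mapli gauge_bead 0 Ls) (beads K)).
  apply: state_sum_kron; first by rewrite size_mapli !size_map.
  move=> l; rewrite size_map => ltl; rewrite nth_mapli add0n.
  rewrite !(nth_map (0%N, Cross true)) // -/(lay K l).
  have [cl|ncl] := boolP (is_cross (lay K l)); last first.
    left; rewrite /gauge_bead (negPf ncl) map_id.
    by move: ncl; rewrite /is_cross /layer_beads; case: (lay K l) => i [[]|u|u].
  right; have [-> ->] := knot_crossing_count ltl cl; split=> //.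
  rewrite kron_gauge // /layer_beads /cross_sign.
    by move: cl; rewrite /is_cross; case: (lay K l) => i [[]|u|u] //= _;
      rewrite !kron_pure_tensors ?opprK.
  by move: cl; rewrite /is_cross; case: (lay K l) => i [[]|u|u] //= _ j;
    rewrite kron_pure_tensors.
rewrite /state_sum sum_labels_mapli big_seq [RHS]big_seq.
apply: eq_bigr => v /(allP (size_labels Ls)); rewrite size_map => /eqP szv.
rewrite (@bead_prod_gauge v 0) //.
- rewrite !(perm_big _ pov) /= (perm_big _ pun) /= sub0r addNr oppr0 G0 mul1r mulr1.
  rewrite -[RHS]scale1r; congr (_ *: _).
  move: fr0; rewrite framing_crossings.
  have -> (r : seq nat) : \prod_(l <- r) gauge_scalar (cross_sign K l) =
      c ^+ count (cross_sign K) r * cinv ^+ count (predC (cross_sign K)) r.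
    elim: r => [|l r IH]; first by rewrite big_nil mulr1.
    rewrite big_cons IH /= /gauge_scalar.
    case: cross_sign => /=; rewrite add1n add0n exprS ?mulrA //.
    by rewrite mulrAC mulrC mulrA.
  have -> (r : seq nat) : \sum_(l <- r) oriented (cross_sign K l) =
      (count (cross_sign K) r)%:Z - (count (predC (cross_sign K)) r)%:Z.
    elim: r => [|l r IH]; first by rewrite big_nil.
    by rewrite big_cons IH /= /oriented; case: cross_sign; rewrite /=; lia.
  by move/subr0_eq => -[->]; rewrite -exprMn cK expr1n.
- by move=> l; rewrite (perm_mem pov).
- by move=> l; rewrite (perm_mem pun).
Qed.
End Gauge.

(** * A module over the algebra D *)

Section FpsMx.
Variables (R : comNzRingType) (m : nat).

Definition mx_of_fps (f : fps 'M[R]_m.+1) : 'M[fps R]_m.+1 :=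
  \matrix_(i, j) Fps (fun k => f k i j).
Definition fps_of_mx (A : 'M[fps R]_m.+1) : fps 'M[R]_m.+1 :=
  Fps (fun k => \matrix_(i, j) A i j k).

Lemma fps_of_mxK : cancel fps_of_mx mx_of_fps.
Proof. by move=> A; apply/matrixP => i j; rewrite mxE; apply: fpsP => k; rewrite /= mxE. Qed.

Lemma mx_of_fpsK : cancel mx_of_fps fps_of_mx.
Proof. by move=> f; apply: fpsP => k; apply/matrixP => i j; rewrite /= !mxE. Qed.

Fact mx_of_fps_is_zmod_morphism : zmod_morphism mx_of_fps.
Proof.
move=> f g; apply/matrixP => i j; rewrite !mxE; apply: fpsP => k.
by rewrite fps_coefB /= !mxE.
Qed.

Fact mx_of_fps_is_monoid_morphism : monoid_morphism mx_of_fps.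
Proof.
split=> [|f g]; apply/matrixP => i j; rewrite !mxE; apply: fpsP => k.
  rewrite /=; case: k => [|k]; rewrite ?mxE.
    by case: eqP => _; rewrite ?mulr1n ?mulr0n.
  by case: eqP => _; rewrite ?mulr1n ?mulr0n.
rewrite -[LHS]/((f * g) k i j) fps_coefM summxE fps_coef_sum.
under eq_bigr => l _ do rewrite mxE.
under [RHS]eq_bigr => l _ do rewrite fps_coefM !mxE.
by rewrite exchange_big.
Qed.

HB.instance Definition _ := GRing.isZmodMorphism.Build (fps 'M[R]_m.+1)
  'M[fps R]_m.+1 mx_of_fps mx_of_fps_is_zmod_morphism.
HB.instance Definition _ := GRing.isMonoidMorphism.Build (fps 'M[R]_m.+1)
  'M[fps R]_m.+1 mx_of_fps mx_of_fps_is_monoid_morphism.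

Fact fps_of_mx_is_zmod_morphism : zmod_morphism fps_of_mx.
Proof. by move=> A B; apply: (can_inj mx_of_fpsK); rewrite rmorphB /= !fps_of_mxK. Qed.
Fact fps_of_mx_is_monoid_morphism : monoid_morphism fps_of_mx.
Proof.
split=> [|A B]; apply: (can_inj mx_of_fpsK).
  by rewrite rmorph1 fps_of_mxK.
by rewrite rmorphM /= !fps_of_mxK.
Qed.
HB.instance Definition _ := GRing.isZmodMorphism.Build 'M[fps R]_m.+1
  (fps 'M[R]_m.+1) fps_of_mx fps_of_mx_is_zmod_morphism.
HB.instance Definition _ := GRing.isMonoidMorphism.Build 'M[fps R]_m.+1
  (fps 'M[R]_m.+1) fps_of_mx fps_of_mx_is_monoid_morphism.

End FpsMx.

Local Opaque Qe fps_subst.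

(** * Values of the free algebra in matrices over series *)

Section FreeAlgebra.
Variables (m : nat) (gen : 'I_4 -> 'M[fps Qe]_m.+1).
Local Notation S := (fps Qe).

Definition word_val (w : {fmonom 'I_4}) : 'M[S]_m.+1 := \prod_(i <- (w : seq 'I_4)) gen i.

Fact word_val_mmorphism : mmorphism word_val.
Proof.
split=> [w1 w2|]; first by rewrite /word_val fmM big_cat.
by rewrite /word_val fm1 big_nil.
Qed.
HB.instance Definition _ := monalg.isMultiplicative.Build {fmonom 'I_4} 'M[S]_m.+1
  word_val word_val_mmorphism.

Definition scalar_val (c : Qe) : 'M[S]_m.+1 := (fps_cst c)%:M.
Fact scalar_val_is_zmod_morphism : zmod_morphism scalar_val.
Proof. by move=> a b; rewrite /scalar_val !raddfB. Qed.
Fact scalar_val_is_monoid_morphism : monoid_morphism scalar_val.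
Proof.
by split=> [|a b]; rewrite /scalar_val ?rmorph1 // rmorphM scalar_mxM.
Qed.
HB.instance Definition _ := GRing.isZmodMorphism.Build Qe 'M[S]_m.+1
  scalar_val scalar_val_is_zmod_morphism.
HB.instance Definition _ := GRing.isMonoidMorphism.Build Qe 'M[S]_m.+1
  scalar_val scalar_val_is_monoid_morphism.

Definition free_val (u : freeD) : 'M[S]_m.+1 := mmap scalar_val word_val u.

Fact free_val_is_zmod_morphism : zmod_morphism free_val.
Proof. exact: mmap_is_additive. Qed.
Fact free_val_is_monoid_morphism : monoid_morphism free_val.
Proof.
have [M1 M2] : multiplicative (mmap scalar_val word_val).
  apply: commr_mmap_is_multiplicative => g w w' /=.
  by rewrite /GRing.comm /scalar_val -!mulmxE scalar_mxC.
by split.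
Qed.
HB.instance Definition _ := GRing.isZmodMorphism.Build freeD 'M[S]_m.+1
  free_val free_val_is_zmod_morphism.
HB.instance Definition _ := GRing.isMonoidMorphism.Build freeD 'M[S]_m.+1
  free_val free_val_is_monoid_morphism.

Lemma free_valU i : free_val (<< fmu i >> : {malg Qe[{fmonom 'I_4}]}) = gen i.
Proof.
rewrite /free_val mmapU /= (_ : scalar_val _ = 1) ?rmorph1 //.
by rewrite mul1r /word_val fmU big_seq1.
Qed.

Lemma free_valZ c u : free_val (c *: u) = fps_cst c *: free_val u.
Proof. by rewrite /free_val mmapZ /= /scalar_val -mulmxE mul_scalar_mx. Qed.

(* The value of u in D at y, b, a, x := gen 0, .., gen 3 *)
Definition rep (u : fps freeD) : 'M[S]_m.+1 :=
  mx_of_fps (fps_subst (@fps_of_mx Qe m \o free_val) fps_X u).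

(* The same, but with h replaced by a new variable *)
Definition rep_split (u : fps freeD) : 'M[fps S]_m.+1 :=
  mx_of_fps (fps_map free_val u).

Lemma X_comm (g : fps 'M[Qe]_m.+1) : fps_X * g = g * fps_X.
Proof. exact: fps_X_comm. Qed.

Lemma X_ord : fps_ord 1 (fps_X : fps 'M[Qe]_m.+1).
Proof. exact: fps_ord_X. Qed.

Fact rep_is_zmod_morphism : zmod_morphism rep.
Proof.
move=> u v; rewrite /rep -rmorphB; congr mx_of_fps.
exact: fps_subst_is_zmod_morphism X_ord u v.
Qed.
Fact rep_is_monoid_morphism : monoid_morphism rep.
Proof.
have [S1 SM] := fps_subst_is_monoid_morphism (@fps_of_mx Qe m \o free_val)
  X_ord X_comm.
by split=> [|u v]; rewrite /rep ?S1 ?rmorph1 // SM rmorphM.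
Qed.
HB.instance Definition _ := GRing.isZmodMorphism.Build (fps freeD) 'M[S]_m.+1
  rep rep_is_zmod_morphism.
HB.instance Definition _ := GRing.isMonoidMorphism.Build (fps freeD) 'M[S]_m.+1
  rep rep_is_monoid_morphism.

Fact rep_split_is_zmod_morphism : zmod_morphism rep_split.
Proof. by move=> u v; rewrite /rep_split rmorphB rmorphB. Qed.
Fact rep_split_is_monoid_morphism : monoid_morphism rep_split.
Proof. by split=> [|u v]; rewrite /rep_split ?rmorph1 // rmorphM rmorphM. Qed.
HB.instance Definition _ := GRing.isZmodMorphism.Build (fps freeD) 'M[fps S]_m.+1
  rep_split rep_split_is_zmod_morphism.
HB.instance Definition _ := GRing.isMonoidMorphism.Build (fps freeD) 'M[fps S]_m.+1
  rep_split rep_split_is_monoid_morphism.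

Lemma rep_gen i : rep (genD i) = gen i.
Proof.
by rewrite /rep (fps_subst_cst _ X_ord) /= free_valU fps_of_mxK.
Qed.

Lemma mx_of_fps_X : mx_of_fps (fps_X : fps 'M[Qe]_m.+1) = fps_X%:M.
Proof.
apply/matrixP => i j; rewrite !mxE; apply: fpsP => k /=.
by case E: (k == 1%N); rewrite ?mulr1n ?mulr0n !mxE; case: (i == j);
  rewrite ?mulr1n ?mulr0n //= E.
Qed.

Lemma rep_X : rep fps_X = fps_X%:M.
Proof. by rewrite /rep (fps_subst_X _ X_ord) mx_of_fps_X. Qed.

Lemma rep_coefE u i j k : rep u i j k =
  fps_subst (@fps_of_mx Qe m \o free_val) fps_X u k i j.
Proof. by rewrite mxE. Qed.

Lemma rep_eqmod N u v i j :
  fps_eqmod N u v -> fps_eqmod N (rep u i j) (rep v i j).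
Proof.
move=> E; apply/fps_eqmodP => k ltk.
have/fps_eqmodP H := fps_subst_continuous (@fps_of_mx Qe m \o free_val) X_ord E.
apply: (eq_trans (rep_coefE u i j k)); apply: esym.
apply: (eq_trans (rep_coefE v i j k)); apply: esym.
by refine (congr1 (fun M : 'M_m.+1 => M i j) (H k ltk)).
Qed.

Lemma rep_cst e : rep (fps_cst e) = free_val e.
Proof. by rewrite /rep (fps_subst_cst _ X_ord) /= fps_of_mxK. Qed.

Local Opaque rep.

Lemma rep_ord N u i j : fps_ord N u -> fps_ord N (rep u i j).
Proof.
move=> uN; apply/fps_eqmod0.
have <- : rep 0 i j = 0 by rewrite rmorph0 mxE.
by apply/rep_eqmod/fps_eqmod0.
Qed.

Lemma rep_monomial e k : rep (fps_cst e * fps_X ^+ k) = fps_X ^+ k *: free_val e.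
Proof.
transitivity (rep (fps_cst e) * rep fps_X ^+ k); first by rewrite rmorphM rmorphXn.
by rewrite rep_cst rep_X -(rmorphXn (@scalar_mx _ _)) -mulmxE mul_mx_scalar.
Qed.

Lemma rep_eqmod_sum N u i j :
  fps_eqmod N (rep u i j) (\sum_(k < N) fps_X ^+ k * free_val (u k) i j).
Proof.
have -> : \sum_(k < N) fps_X ^+ k * free_val (u k) i j =
    rep (\sum_(k < N) fps_cst (u k) * fps_X ^+ k) i j.
  rewrite rmorph_sum summxE; apply: eq_bigr => k _.
  transitivity ((fps_X ^+ k *: free_val (u k)) i j); first by rewrite mxE.
  by refine (congr1 (fun M : 'M_m.+1 => M i j) (esym (rep_monomial (u k) k))).
exact: rep_eqmod (@fps_trunc_eqmod _ N u).
Qed.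

Lemma rep_scal c : rep (scal c) = c%:M.
Proof.
apply/matrixP => i j; apply: fps_eqmod_all => N.
have/fps_eqmodP E := @rep_eqmod_sum N (scal c) i j.
apply/fps_eqmodP => k ltk; rewrite E //.
under eq_bigr => l _ do rewrite /= free_valZ rmorph1 !mxE mulr_natr mulrnAr.
rewrite sumrMnl mxE; case: (i == j); rewrite ?mulr1n ?mulr0n //.
have/fps_eqmodP H := @fps_trunc_eqmod _ N c; rewrite H //.
by congr (fcoef _ k); apply: eq_bigr => l _; apply: fps_Xn_comm.
Qed.

Lemma rep_split_cst e : rep_split (fps_cst e) = map_mx (@fps_cst _) (free_val e).
Proof.
apply/matrixP => i j; rewrite !mxE; apply: fpsP => -[|k] /=; rewrite ?mxE //.
by rewrite rmorph0 mxE.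
Qed.

Lemma rep_split_coef u i j k : rep_split u i j k = free_val (u k) i j.
Proof. by rewrite mxE. Qed.

End FreeAlgebra.

Local Transparent Qe fps_subst rep.

Section DoubleSum.
Variable R : nzRingType.
Implicit Type F : nat -> nat -> fps R.

Definition fps_sum2 F := fps_sum 0 (fun m => fps_sum 0 (F m)).

Lemma fps_sum2_eqmod N F : (forall m n, fps_ord (m + n) (F m n)) ->
  fps_eqmod N (fps_sum2 F) (\sum_(0 <= m < N) \sum_(0 <= n < N) F m n).
Proof.
move=> ordF; have ordn m n : fps_ord n (F m n).
  exact: fps_ordW (leq_addl _ _) (ordF m n).
have ordm m : fps_ord m (fps_sum 0 (F m)).
  move=> i ltim; rewrite /= big1_seq // => n _.
  exact: fps_ordW (leq_addr n m) (ordF m n) _ ltim.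
have/fps_eqmodP E := @fps_sum_eqmod _ 0 _ N ordm.
apply/fps_eqmodP => i lti; rewrite E // !fps_coef_sum.
apply: eq_bigr => m _; have/fps_eqmodP Em := @fps_sum_eqmod _ 0 _ N (ordn m).
by rewrite Em.
Qed.

End DoubleSum.

Section MxEqmod.
Variable R : comNzRingType.

Definition mx_eqmod N q := @mx_rel (fps R) (fps R) (fps_eqmod N) q q.

Lemma fps_eqmod_ring N : ring_rel (@fps_eqmod R N).
Proof.
split; try by apply/fps_eqmodP.
- by move=> a a' /fps_eqmodP E; apply/fps_eqmodP => i lti; rewrite !fps_coefN E.
- move=> a a' b b' /fps_eqmodP E /fps_eqmodP E'.
  by apply/fps_eqmodP => i lti; rewrite !fps_coefD E ?E'.
- by move=> *; apply: fps_eqmodM.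
Qed.

Lemma fps_eqmod_refl N (f : fps R) : fps_eqmod N f f.
Proof. by apply/fps_eqmodP. Qed.

Lemma fps_eqmod_sym N (f g : fps R) : fps_eqmod N f g -> fps_eqmod N g f.
Proof. by move/fps_eqmodP=> E; apply/fps_eqmodP => i lti; rewrite E. Qed.

Lemma fps_eqmod_trans N (f g h : fps R) :
  fps_eqmod N f g -> fps_eqmod N g h -> fps_eqmod N f h.
Proof.
by move=> /fps_eqmodP E /fps_eqmodP E'; apply/fps_eqmodP => i lti; rewrite E ?E'.
Qed.

Lemma mx_ordX q (A : 'M[fps R]_q) k : (forall i j, fps_ord 1 (A i j)) ->
  forall i j, fps_ord k ((A ^+ k) i j).
Proof.
move=> ordA; elim: k => [|k IH] i j //.
rewrite exprS mxE; apply: fps_ord_sum => l _.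
by rewrite -add1n; apply: fps_ordM.
Qed.

Lemma mx_inv_eqmod1 q (G : 'M[fps R]_q) : mx_eqmod 1 G 1%:M ->
  exists X, G *m X = 1%:M /\ X *m G = 1%:M.
Proof.
move=> G1; have: fps_eqmod 1 (\det G) (\det (1%:M : 'M[fps R]_q)).
  exact: mx_rel_det (fps_eqmod_ring 1) _ _ _ G1.
move/fps_eqmodP/(_ 0%N isT); rewrite det1 => detG.
have dK : fps_inv1 (\det G) * \det G = 1 by rewrite mulrC fps_inv1K.
exists (fps_inv1 (\det G) *: \adj G).
rewrite -scalemxAl -scalemxAr mul_mx_adj mul_adj_mx.
by rewrite scale_scalar_mx dK.
Qed.

(* The geometric series for the inverse of G *)
Lemma geometric_eqmod q (G X r : 'M[fps R]_q) N : mx_eqmod 1 G 1%:M ->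
  X *m G = 1%:M -> mx_eqmod N.+1 r G ->
  mx_eqmod N.+1 (\sum_(k < N.+1) (1 - r) ^+ k) X.
Proof.
move=> G1 XG rG; have rr := mx_rel_ring (fps_eqmod_ring N.+1) q.
set s := \sum_(k < _) _.
have mrefl (A : 'M[fps R]_q) : mx_rel (fps_eqmod N.+1) A A.
  by move=> i j; apply: fps_eqmod_refl.
have ord1 i j : fps_ord 1 ((1 - r) i j).
  have/fps_eqmodP r1 : fps_eqmod 1 (r i j) ((1%:M : 'M[fps R]_q) i j).
    apply: fps_eqmod_trans (G1 i j).
    by apply/fps_eqmodP => -[|//] _; have/fps_eqmodP -> := rG i j.
  by move=> k ltk; rewrite !mxE fps_coefB r1 // !mxE subrr.
have rs : r * s = 1 - (1 - r) ^+ N.+1.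
  have := subrX1 (1 - r) N.+1; rewrite [1 - r - 1]addrAC subrr sub0r mulNr => E.
  by rewrite -[LHS]opprK -E opprB.
have : mx_rel (fps_eqmod N.+1) (G * s) 1.
  have Gs : mx_rel (fps_eqmod N.+1) (G * s) (r * s).
    apply: (ring_relM rr) => // i j; apply: fps_eqmod_sym; exact: rG.
  move=> i j; apply: fps_eqmod_trans (Gs i j) _; rewrite rs.
  rewrite /fps_eqmod !mxE addrAC subrr sub0r.
  by apply: fps_ordN; apply: mx_ordX.
move/(ring_relM rr (mrefl X)); rewrite mulrA (_ : X * G = 1) // mulr1 mul1r.
by apply.
Qed.

End MxEqmod.

(** * The invariant of D in a matrix representation *)

Section DInvariant.
Variables (R : comNzRingType) (m : nat) (f : {rmorphism fps freeD -> 'M[fps R]_m.+1}).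
Hypothesis ord_f : forall N u i j, fps_ord N u -> fps_ord N (f u i j).
Local Notation n := m.+1.

Definition pair_map (x : fps freeD * fps freeD) := (f x.1, f x.2).

Lemma kron_tens_mul u v :
  kron (map pair_map (tens_mul u v)) = kron (map pair_map u) *m kron (map pair_map v).
Proof.
rewrite /kron !big_map big_allpairs_dep mulmx_suml; apply: eq_bigr => x _.
rewrite mulmx_sumr; apply: eq_bigr => y _.
rewrite tensmx_mul /pair_map.
congr (_ *t _).
  by refine (rmorphM f x.1 y.1).
by refine (rmorphM f x.2 y.2).
Qed.

Lemma kron_tens_one : kron (map pair_map [:: (1, 1)]) = 1%:M.
Proof. by rewrite /kron big_seq1 /pair_map [X in X *t _]rmorph1 [X in _ *t X]rmorph1 tens11. Qed.

Lemma kron_D_Rinv N : kron (map pair_map (D_Rinv N)) =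
  \sum_(k < N.+1) (1 - kron (map pair_map (D_R N))) ^+ k.
Proof.
rewrite /D_Rinv; set u := _ :: _.
have Eu : kron (map pair_map u) = 1 - kron (map pair_map (D_R N)).
  rewrite /kron /u map_cons big_cons; congr (_ + _).
    by rewrite /pair_map [X in X *t _]rmorph1 [X in _ *t X]rmorph1 tens11.
  rewrite !big_map -sumrN; apply: eq_bigr => x _; rewrite /pair_map.
  by rewrite [X in X *t _ = _]rmorphN; apply/matrixP => i j; rewrite !mxE mulNr.
have Ek k : kron (map pair_map (iter k (tens_mul u) [:: (1, 1)])) =
    (1 - kron (map pair_map (D_R N))) ^+ k.
  elim: k => [|k IH]; first exact: kron_tens_one.
  by rewrite iterS kron_tens_mul IH Eu exprS mulmxE.
rewrite -(big_mkord xpredT (fun k => (1 - kron (map pair_map (D_R N))) ^+ k)).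
rewrite /index_iota subn0; elim: (iota _ _) => [|k s IH].
  by rewrite big_nil /kron big_nil.
by rewrite big_cons -IH -Ek [flatten _]/= map_cat /kron big_cat.
Qed.

Definition R_entry i j k l (p q : nat) : fps R :=
  f (D_R_term p q).1 i k * f (D_R_term p q).2 j l.

(** The h-adic limit of the images of the truncations [D_R]. *)
Definition R_mx : 'M[fps R]_(n * n) :=
  \matrix_(a, b) let: (i, j) := mxtens_unindex a in
                 let: (k, l) := mxtens_unindex b in
                 fps_sum2 (R_entry i j k l).

Lemma scal_ord N c : fps_ord N c -> fps_ord N (scal c).
Proof. by move=> cN i lti; rewrite /= cN // scale0r. Qed.

Lemma R_entry_ord i j k l p q : fps_ord (p + q) (R_entry i j k l p q).
Proof.
apply/fps_ordMr/ord_f; rewrite /D_R_term -!mulrA; apply/fps_ordMr/scal_ord/fps_ordMr.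
by move=> r ltr; rewrite fps_coefXn ltn_eqF.
Qed.

Lemma kron_D_R N : mx_eqmod N.+1 (kron (map pair_map (D_R N))) R_mx.
Proof.
move=> a b; rewrite mxE -{1}(mxtens_unindexK a) -{1}(mxtens_unindexK b).
case: (mxtens_unindex a) (mxtens_unindex b) => [i j] [k l].
apply: fps_eqmod_sym; have := fps_sum2_eqmod (N := N.+1) (R_entry_ord i j k l).
rewrite kronE big_map /D_R big_allpairs_dep /index_iota subn0.
by apply.
Qed.

Lemma R_mx_eqmod1 : mx_eqmod 1 R_mx 1%:M.
Proof.
move=> a b; apply: fps_eqmod_trans (fps_eqmod_sym (@kron_D_R 0 a b)) _.
have -> : D_R 0 = [:: (1, 1)].
  rewrite -[D_R 0]/[:: D_R_term 0 0] /D_R_term addn0 !expr0 !mulr1.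
  have -> : qe_fact 0 = 1 by rewrite /qe_fact big_geq.
  have inv1 : fps_inv (1 : fps Qe) = 1.
    by rewrite -[LHS]mul1r fps_invK // fps_coef1 oner_neq0.
  have scal1 : scal 1 = 1 by apply: fpsP => -[|k] /=; rewrite ?scale1r ?scale0r.
  have inv1' : 1 * fps_inv (1 : fps Qe) = 1 by rewrite mul1r.
  by congr [:: (_, _)]; rewrite -[RHS]scal1 -[in RHS]inv1'.
by rewrite kron_tens_one; apply: fps_eqmod_refl.
Qed.

(** Modulo h^(N+1) the truncated R-matrix agrees with [R_mx] and the truncated geometric series with
    its inverse; congruence is a relation to which [knot_mx_rel] applies. *)
Lemma D_invariant_eqmod X N K : X *m R_mx = 1%:M ->
  mx_eqmod N.+1
    (f (universal_invariant (D_R N) (D_Rinv N) kappaD kappaDinv K))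
    (knot_mx R_mx X (f kappaD) (f kappaDinv) K).
Proof.
move=> XR; rewrite universal_invariant_morph universal_invariant_knot_mx.
apply: knot_mx_rel; try by move=> i j; apply: fps_eqmod_refl.
- exact: fps_eqmod_ring.
- exact: kron_D_R.
- move=> i j; rewrite -/pair_map kron_D_Rinv.
  have H := @geometric_eqmod _ _ _ _ _ _ (@R_mx_eqmod1) XR (@kron_D_R N).
  exact: H.
Qed.

End DInvariant.

(** [Z_D] takes its coefficient of h^k from the truncation of order k, while the congruences concern
    a single truncation. They are reconciled by showing that the k-th coefficient has the same
    matrix value in every truncation of order at least k. *)
Lemma rep_Z_D m (gen : 'I_4 -> 'M[fps Qe]_m.+1) X K :
  X *m R_mx (rep gen) = 1%:M ->
  rep gen (Z_D K) = knot_mx (R_mx (rep gen)) X (rep gen kappaD) (rep gen kappaDinv) K.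
Proof.
move=> XR; apply/matrixP => i j; apply: fps_eqmod_all => N.
pose U M := universal_invariant (D_R M) (D_Rinv M) kappaD kappaDinv K.
have ord_split M u k l : fps_ord M u -> fps_ord M (rep_split gen u k l).
  by move=> uM r ltr; rewrite rep_split_coef uM // rmorph0 mxE.
have [X' [_ X'R]] := mx_inv_eqmod1 (@R_mx_eqmod1 _ _ _ ord_split).
(* The generators may depend on h themselves, so that [rep] mixes coefficients. In [rep_split] the
   powers of h are kept apart by a new variable, and all truncations are compared with the same full
   invariant. *)
have stable k : (k <= N)%N -> free_val gen (Z_D K k) = free_val gen (U N k).
  move=> lekN; apply/matrixP => r s.
  have E M : (k <= M)%N -> free_val gen (U M k) r s =
      knot_mx (R_mx (rep_split gen)) X' (rep_split gen kappaD)
        (rep_split gen kappaDinv) K r s k.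
    move=> lekM; rewrite -rep_split_coef.
    have/fps_eqmodP := @D_invariant_eqmod _ _ _ ord_split X' M K X'R r s.
    by apply; rewrite ltnS.
  by rewrite [RHS]E //; refine (E k (leqnn k)).
have UN : fps_eqmod N (rep gen (Z_D K) i j) (rep gen (U N) i j).
  have ES : \sum_(k < N) fps_X ^+ k * free_val gen (Z_D K k) i j =
            \sum_(k < N) fps_X ^+ k * free_val gen (U N k) i j.
    refine (eq_bigr _ (fun k _ => _)).
    by refine (congr1 (fun M : 'M_m.+1 => _ * M i j) (stable k (ltnW (ltn_ord k)))).
  have H := @rep_eqmod_sum _ gen N (Z_D K) i j; rewrite ES in H.
  by refine (fps_eqmod_trans H (fps_eqmod_sym (@rep_eqmod_sum _ gen N (U N) i j))).
apply: fps_eqmod_trans UN _.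
have := @D_invariant_eqmod _ _ _ (@rep_ord _ gen) X N K XR i j.
by move/fps_eqmodP => H; apply/fps_eqmodP => k ltk; apply/H/ltnW.
Qed.

Lemma char_Qe : [pchar Qe] =i pred0.
Proof.
have injC (c : rat) : (tofrac (polyC c) == 0 :> Qe) = (c == 0).
  by rewrite tofrac_eq0 polyC_eq0.
apply/(pcharf0P Qe) => k.
have -> : (k%:R : Qe) = tofrac (k%:R%:P : {poly rat}) by rewrite !rmorph_nat.
by rewrite injC Num.Theory.pnatr_eq0.
Qed.

Lemma eps_neq0 : eps != 0.
Proof. by rewrite /eps tofrac_eq0 polyX_eq0. Qed.

Section FexpTheory.
Variable K : fieldType.

Definition fexp (f : fps K) : fps K :=
  fps_sum 0 (fun k => fps_cst (k`!%:R^-1) * f ^+ k).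

Lemma fexp_X c : fexp (fps_cst c * fps_X) = expc c.
Proof.
apply: fpsP => n; rewrite -[LHS]/(\sum_(0 <= k < n.+1)
  (fps_cst (k`!%:R^-1) * (fps_cst c * fps_X) ^+ k) n).
have E k : (fps_cst (k`!%:R^-1) * (fps_cst c * fps_X) ^+ k : fps K) n =
    (c ^+ k / k`!%:R) *+ (n == k).
  by rewrite fps_coefCM exprMn -rmorphXn fps_coefCM fps_coefXn mulrC mulr_natr mulrnAl.
rewrite (eq_bigr _ (fun k _ => E k)) big_mkord (bigD1 ord_max) // eqxx mulr1n.
rewrite big1 => [|k nk]; first exact: addr0.
by case: (n =P k) nk => // En /eqP[]; apply: val_inj.
Qed.

End FexpTheory.

Section DiagMx.
Variables (R : comNzRingType) (n : nat).

Definition dg (d : 'I_n -> R) : 'M[R]_n := \matrix_(i, j) (d i *+ (i == j)).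

Lemma dgM d e : dg d *m dg e = dg (fun i => d i * e i).
Proof.
apply/matrixP => i j; rewrite !mxE (bigD1 i) //= !mxE eqxx mulr1n.
rewrite big1 ?addr0 ?mulrnAr // => k nki.
by rewrite !mxE eq_sym (negPf nki) mul0r.
Qed.

Lemma dgD d e : dg d + dg e = dg (fun i => d i + e i).
Proof. by apply/matrixP => i j; rewrite !mxE mulrnDl. Qed.

Lemma dgN d : - dg d = dg (fun i => - d i).
Proof. by apply/matrixP => i j; rewrite !mxE mulNrn. Qed.

Lemma dgZ c d : c *: dg d = dg (fun i => c * d i).
Proof. by apply/matrixP => i j; rewrite !mxE mulrnAr. Qed.

Lemma dg_scalar c : dg (fun=> c) = c%:M.
Proof. by apply/matrixP => i j; rewrite !mxE. Qed.

Lemma eq_dg d e : (forall i, d i = e i) -> dg d = dg e.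
Proof. by move=> E; apply/matrixP => i j; rewrite !mxE E. Qed.

Lemma mul_dgmx d (A : 'M[R]_n) i j : (dg d *m A) i j = d i * A i j.
Proof.
rewrite mxE (bigD1 i) //= !mxE eqxx mulr1n big1 ?addr0 // => k nki.
by rewrite !mxE eq_sym (negPf nki) mul0r.
Qed.

Lemma mul_mxdg d (A : 'M[R]_n) i j : (A *m dg d) i j = A i j * d j.
Proof.
rewrite mxE (bigD1 j) //= !mxE eqxx mulr1n big1 ?addr0 // => k nkj.
by rewrite !mxE (negPf nkj) mulr0.
Qed.

End DiagMx.

Lemma dgX (R : comNzRingType) m (d : 'I_m.+1 -> R) k :
  dg d ^+ k = dg (fun i => d i ^+ k).
Proof.
elim: k => [|k IH]; first by rewrite expr0 (eq_dg (e := fun=> 1)) ?dg_scalar.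
by rewrite exprS IH -mulmxE dgM; apply: eq_dg => i; rewrite exprS.
Qed.

Section RepTheory.
Variables (m : nat) (gen : 'I_4 -> 'M[fps Qe]_m.+1).
Local Notation rep := (rep gen).

Lemma repD u v : rep (u + v) = rep u + rep v. Proof. exact: rmorphD. Qed.
Lemma repB u v : rep (u - v) = rep u - rep v. Proof. exact: rmorphB. Qed.
Lemma repN u : rep (- u) = - rep u. Proof. exact: rmorphN. Qed.
Lemma repM u v : rep (u * v) = rep u * rep v. Proof. exact: rmorphM. Qed.
Lemma rep1 : rep 1 = 1. Proof. exact: rmorph1. Qed.
Lemma rep0 : rep 0 = 0. Proof. exact: rmorph0. Qed.
Lemma repXn u k : rep (u ^+ k) = rep u ^+ k. Proof. exact: rmorphXn. Qed.
Lemma rep_bigsum I (r : seq I) (P : pred I) F :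
  rep (\sum_(i <- r | P i) F i) = \sum_(i <- r | P i) rep (F i).
Proof. exact: rmorph_sum. Qed.

Lemma rep_scalM c u : rep (scal c * u) = c *: rep u.
Proof. by rewrite repM rep_scal -mulmxE mul_scalar_mx. Qed.

Lemma rep_hM u : rep (h_ * u) = fps_X *: rep u.
Proof. by rewrite repM rep_X -mulmxE mul_scalar_mx. Qed.

Lemma rep_fps_sum k0 (u : nat -> fps freeD) i j : (forall k, fps_ord k (u k)) ->
  rep (fps_sum k0 u) i j = fps_sum k0 (fun k => rep (u k) i j).
Proof.
move=> ordu; apply: fps_eqmod_all => N.
apply: fps_eqmod_trans (rep_eqmod gen i j (@fps_sum_eqmod _ k0 _ N ordu)) _.
have ordr k : fps_ord k (rep (u k) i j) by apply: rep_ord.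
apply: fps_eqmod_trans (fps_eqmod_sym (@fps_sum_eqmod _ k0 _ N ordr)).
by rewrite rep_bigsum summxE; apply: fps_eqmod_refl.
Qed.

Lemma rep_exp (u : fps freeD) d : fps_ord 1 u -> rep u = dg d ->
  rep (fps_exp u) = dg (fun i => fexp (d i)).
Proof.
move=> u1 Eu.
have -> : fps_exp u = fps_sum 0 (fun k => scal (fps_cst (k`!%:R^-1)) * u ^+ k).
  apply: fpsP => N; rewrite -[RHS]/(\sum_(0 <= k < N.+1)
    (scal (fps_cst k`!%:R^-1) * u ^+ k) N) big_mkord; apply: eq_bigr => k _.
  have -> : scal (fps_cst (k`!%:R^-1)) = fps_cst ((k`!%:R^-1)%:A).
    by apply: fpsP => -[|l] //=; rewrite scale0r.
  by rewrite -[RHS]/((fps_cst _ * _) N) fps_coefCM -scalerAl mul1r.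
apply/matrixP => i j; rewrite rep_fps_sum; last first.
  by move=> k; apply/fps_ordMl/fps_ord1X.
apply: fpsP => N; rewrite /= !mxE.
have -> : (fexp (d i) *+ (i == j)) N = fexp (d i) N *+ (i == j).
  by case: (i == j).
rewrite -[fexp (d i) N]/(\sum_(0 <= k < N.+1) _) -sumrMnl.
apply: eq_bigr => k _; rewrite rep_scalM repXn Eu dgX !mxE.
by case: (i == j); rewrite ?mulr1n // mulr0n mulr0.
Qed.

Lemma rep_inv1 (u : fps freeD) (c : fps Qe) : u 0%N = 1 -> c 0%N = 1 -> rep u = c%:M ->
  rep (fps_inv1 u) = (fps_inv1 c)%:M.
Proof.
move=> u0 c0 Eu; have := congr1 rep (fps_inv1K u0).
rewrite repM Eu rep1 -mulmxE mul_scalar_mx => E.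
have := congr1 ( *:%R (fps_inv1 c)) E.
by rewrite scalerA mulrC fps_inv1K // scale1r scalemx1.
Qed.

Lemma rep_divX k u : fps_ord k u -> fps_X ^+ k *: rep (fps_divX k u) = rep u.
Proof.
move=> uk; rewrite -[in RHS](fps_divXK uk) repM repXn rep_X.
by rewrite -(rmorphXn (@scalar_mx _ _)) -mulmxE mul_scalar_mx.
Qed.

Lemma rep_D_eq u v : (forall k, rep (nth 0 relations k) = 0) ->
  D_eq u v -> rep u = rep v.
Proof.
move=> rel0 E; apply/eqP; rewrite -subr_eq0 -repB; apply/eqP/matrixP => i j.
apply: fps_eqmod_all => N; have [s Es] := E N.
have H : fps_eqmod N (u - v) (\sum_(c <- s) c.1.1 * nth 0 relations c.1.2 * c.2).
  by apply/fps_eqmodP.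
apply: fps_eqmod_trans (rep_eqmod gen i j H) _.
rewrite rep_bigsum summxE big1 ?mxE; first exact: fps_eqmod_refl.
by move=> c _; rewrite !repM rel0 mulr0 mul0r mxE.
Qed.

End RepTheory.

Local Opaque Qe.

(* q_eps ^ c, for c a constant *)
Definition qpow (c : Qe) : fps Qe := expc (eps * c).

Lemma qpowD c d : qpow (c + d) = qpow c * qpow d.
Proof. by rewrite /qpow mulrDr (expcD char_Qe). Qed.

Lemma qpow0 : qpow 0 = 1.
Proof. by rewrite /qpow mulr0 expc0. Qed.

Lemma qpow_at0 c : qpow c 0%N = 1.
Proof. exact: expc_at0. Qed.

Lemma qpowMn c k : qpow (c *+ k) = qpow c ^+ k.
Proof. by rewrite /qpow mulrnAr (expcMn char_Qe). Qed.

Lemma qpowN c : qpow c * qpow (- c) = 1.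
Proof. by rewrite -qpowD subrr qpow0. Qed.

Lemma q_epsE : q_eps = qpow 1.
Proof. by apply: fpsP => k; rewrite /= mulr1. Qed.

Lemma two_neq0 : (2 : Qe) != 0.
Proof. exact: natf_neq0_char0 char_Qe 1. Qed.

Lemma qpow_neq1 c : c != 0 -> qpow c <> 1.
Proof. by move=> c0; refine (expc_neq1 (mulf_neq0 eps_neq0 c0)). Qed.

(** * Quantum integers at q = q_eps^(1/2) *)

Definition qdiff : fps Qe := qpow 2^-1 - qpow (- 2^-1).

Lemma qdiff_neq0 : qdiff <> 0.
Proof.
move/subr0_eq => E; have: qpow 2^-1 * qpow 2^-1 = 1 by rewrite {2}E qpowN.
rewrite -qpowD; apply: qpow_neq1.
have -> : (2^-1 + 2^-1 : Qe) = 1 by field; apply: two_neq0.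
exact: oner_neq0.
Qed.

Lemma qdiff_ord : fps_ord 1 qdiff.
Proof. by move=> [|//] _; rewrite fps_coefB !qpow_at0 subrr. Qed.

Definition qquot : fps Qe := fps_divX 1 qdiff.

Lemma qquotE : fps_X * qquot = qdiff.
Proof. by rewrite -[X in X * _]expr1 fps_divXK //; apply: qdiff_ord. Qed.

(** The quantum integer [p], given as a sum because q - q^-1 is divisible by h and so has no inverse
    among the series. *)
Definition qint (p : nat) : fps Qe :=
  \sum_(i < p) qpow ((p%:R - 1) / 2 - i%:R).

Lemma qint0 : qint 0 = 0.
Proof. by rewrite /qint big_ord0. Qed.

Lemma qdiff_qint p : qdiff * qint p = qpow (p%:R / 2) - qpow (- (p%:R / 2)).
Proof.
have nz := two_neq0; rewrite /qint mulr_sumr.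
pose u i := - qpow (p%:R / 2 - i%:R).
rewrite (eq_bigr (fun i : 'I_p => u i.+1 - u i)); last first.
  move=> i _; rewrite /u /qdiff mulrBl -!qpowD opprK addrC -natr1.
  by congr (- qpow _ + qpow _); field.
rewrite -(big_mkord xpredT (fun i => u i.+1 - u i)) telescope_sumr // /u opprK addrC.
by rewrite subr0; congr (_ - qpow _); field.
Qed.

(** * The n-dimensional module *)

Section Module.
Variable m : nat.
Local Notation n := m.+1.
Local Notation S := (fps Qe).

(** The relations of D see only differences of weights and the combination eps a + b. The latter is
    chosen to make (A B)^(1/2) act as K; the remaining freedom is used, through the shift 1/2, to
    make T act as q_eps^n. *)
Definition a_wt (p : nat) : Qe := p%:R + 2^-1.
Definition b_wt (p : nat) : Qe := eps * (a_wt p - n%:R).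
Definition half_wt (p : nat) : Qe := (n%:R - 1) / 2 - p%:R.

Definition y_mx : 'M[S]_n := \matrix_(i, j) (qint j *+ (j == i.+1 :> nat)).
Definition f_mx : 'M[S]_n := \matrix_(i, j) (qint (n - i) *+ (i == j.+1 :> nat)).
(** This is x = ((q - q^-1) / h) K F. With y = E and E K = q^-2 K E, the difference x y - q_eps y x
    is ((q - q^-1) / h) K (F E - E F) = (1 - K^2) / h, where K^2 = A B. *)
Definition x_mx : 'M[S]_n := dg (fun i : 'I_n => qquot * qpow (half_wt i)) *m f_mx.
Definition a_mx : 'M[S]_n := dg (fun i : 'I_n => fps_cst (a_wt i)).
Definition b_mx : 'M[S]_n := dg (fun i : 'I_n => fps_cst (b_wt i)).

Definition gens (i : 'I_4) : 'M[S]_n := nth 0 [:: y_mx; b_mx; a_mx; x_mx] i.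

Local Notation rep := (rep gens).

Lemma rep_y : rep y_ = y_mx. Proof. by rewrite rep_gen /gens inordK. Qed.
Lemma rep_b : rep b_ = b_mx. Proof. by rewrite rep_gen /gens inordK. Qed.
Lemma rep_a : rep a_ = a_mx. Proof. by rewrite rep_gen /gens inordK. Qed.
Lemma rep_x : rep x_ = x_mx. Proof. by rewrite rep_gen /gens inordK. Qed.

Lemma rep_eps_a : rep (eps_ * a_) = dg (fun i : 'I_n => fps_cst (eps * a_wt i)).
Proof.
rewrite rep_scalM rep_a dgZ; apply: eq_dg => i.
by rewrite -(rmorphM (@fps_cst Qe)).
Qed.

Lemma rep_exp_hM (u : fps freeD) (d : 'I_n -> Qe) :
  rep u = dg (fun i => fps_cst (d i)) -> rep (fps_exp (h_ * u)) = dg (fun i => expc (d i)).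
Proof.
move=> Eu; rewrite (rep_exp (d := fun i => fps_cst (d i) * fps_X)).
- by apply: eq_dg => i; rewrite fexp_X.
- by apply: fps_ordMr; apply: fps_ord_X.
- by rewrite rep_hM Eu dgZ; apply: eq_dg => i; rewrite mulrC.
Qed.

Lemma scal_h_comm c (u : fps freeD) : scal c * h_ * u = h_ * (scal c * u).
Proof. by rewrite mulrA; congr (_ * u); rewrite /h_ -fps_X_comm. Qed.

Lemma rep_Ainv : rep Ainv = dg (fun i : 'I_n => qpow (a_wt i)).
Proof.
by rewrite /Ainv scal_h_comm (rep_exp_hM (d := fun i => eps * a_wt i)) ?rep_eps_a.
Qed.

Lemma rep_A : rep A_ = dg (fun i : 'I_n => qpow (- a_wt i)).
Proof.
rewrite /A_ scal_h_comm -mulrN (rep_exp_hM (d := fun i => eps * - a_wt i)) //.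
by rewrite repN rep_eps_a dgN; apply: eq_dg => i; rewrite mulrN rmorphN.
Qed.

Lemma rep_B : rep B_ = dg (fun i : 'I_n => qpow (n%:R - a_wt i)).
Proof.
rewrite /B_ -mulrN (rep_exp_hM (d := fun i => eps * (n%:R - a_wt i))) //.
by rewrite repN rep_b dgN; apply: eq_dg => i; rewrite -rmorphN /b_wt -mulrN opprB.
Qed.

Lemma rep_t : rep t_ = dg (fun i : 'I_n => fps_cst (eps * - n%:R)).
Proof.
rewrite /t_ repB rep_b rep_eps_a dgN dgD; apply: eq_dg => i.
by rewrite -rmorphB /b_wt -mulrBr; congr (fps_cst (_ * _)); ring.
Qed.

Lemma rep_T : rep T_ = (qpow n%:R)%:M.
Proof.
rewrite /T_ -mulrN (rep_exp_hM (d := fun i => eps * n%:R)); first exact: dg_scalar.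
by rewrite repN rep_t dgN; apply: eq_dg => i; rewrite -rmorphN mulrN opprK.
Qed.

Lemma rep_Tinv : rep Tinv = (qpow (- n%:R))%:M.
Proof.
rewrite /Tinv (rep_exp_hM (d := fun i => eps * - n%:R)); first exact: dg_scalar.
exact: rep_t.
Qed.

Lemma half_wtE p : eps * half_wt p = - (2^-1 * (eps * a_wt p + b_wt p)).
Proof. by have nz := two_neq0; rewrite /half_wt /b_wt /a_wt; field. Qed.

Lemma rep_half_ab : rep (Defs.half * (eps_ * a_ + b_)) =
  dg (fun i : 'I_n => fps_cst (2^-1 * (eps * a_wt i + b_wt i))).
Proof.
rewrite /Defs.half rep_scalM repD rep_eps_a rep_b dgD dgZ; apply: eq_dg => i.
by rewrite -rmorphD -(rmorphM (@fps_cst Qe)).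
Qed.

Lemma rep_kappa : rep kappaD = dg (fun i : 'I_n => qpow (half_wt i)).
Proof.
rewrite /kappaD scal_h_comm -mulrN (rep_exp_hM (d := fun i => eps * half_wt i)) //.
by rewrite repN rep_half_ab dgN; apply: eq_dg => i; rewrite half_wtE rmorphN.
Qed.

Lemma rep_kappainv : rep kappaDinv = dg (fun i : 'I_n => qpow (- half_wt i)).
Proof.
rewrite /kappaDinv scal_h_comm (rep_exp_hM (d := fun i => eps * - half_wt i)) //.
by rewrite rep_half_ab; apply: eq_dg => i; rewrite mulrN half_wtE opprK.
Qed.

End Module.

Lemma qpow_prod h a b :
  qpow h * ((qpow a - qpow (- a)) * (qpow b - qpow (- b))) =
  qpow (h + a + b) - qpow (h + a - b) - qpow (h - a + b) + qpow (h - a - b).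
Proof. by rewrite !qpowD; ring. Qed.

(** * The relations of D on the module *)

Section ModuleRelations.
Variable m : nat.
Local Notation n := m.+1.
Local Notation S := (fps Qe).
Local Notation rep := (rep (@gens m)).
Local Notation half_wt := (half_wt m).

Lemma f_mx_y_mx : f_mx m *m y_mx m = dg (fun i : 'I_n => qint (n - i) * qint i).
Proof.
apply/matrixP => i j; rewrite !mxE; case: i => [[|i] lti] /=.
  rewrite qint0 mulr0 mul0rn big1 // => k _.
  by rewrite !mxE mulr0n mul0r.
have lti' : (i < n)%N by apply: ltnW.
rewrite (bigD1 (Ordinal lti')) // big1 => [|k nk].
  apply: etrans (addr0 _) _; rewrite !mxE /= eqxx mulr1n mulrnAr.
  by rewrite -[Ordinal lti == j]val_eqE /= [i.+1 == _]eq_sym; case: eqP => // ->.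
rewrite !mxE /= eqSS (_ : (i == k) = false) ?mul0r //.
by apply: contraNF nk => /eqP E; apply/eqP/val_inj.
Qed.

Lemma y_mx_f_mx (d : nat -> S) : y_mx m *m (dg (fun i : 'I_n => d i) *m f_mx m) =
  dg (fun i : 'I_n => qint i.+1 * (d i.+1 * qint (n - i.+1))).
Proof.
apply/matrixP => i j; rewrite mxE [RHS]mxE; case: (ltnP i.+1 n) => [lti|lei].
  rewrite (bigD1 (Ordinal lti)) // big1 => [|k nk].
    apply: etrans (addr0 _) _.
    by rewrite mul_dgmx !mxE /= eqxx mulr1n eqSS -val_eqE /= !mulrnAr.
  rewrite !mxE (_ : (nat_of_ord k == i.+1) = false) ?mulr0n ?mul0r //.
  by apply: contraNF nk => /eqP E; apply/eqP/val_inj.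
have -> : (n - i.+1 = 0)%N by apply/eqP; rewrite subn_eq0.
rewrite qint0 !mulr0 mul0rn big1 // => k _.
by rewrite !mxE (ltn_eqF (leq_trans (ltn_ord k) lei)) mulr0n mul0r.
Qed.

Lemma y_mx_x_mx : y_mx m *m x_mx m =
  dg (fun i : 'I_n => qint i.+1 * (qquot * qpow (half_wt i.+1) * qint (n - i.+1))).
Proof. exact: (y_mx_f_mx (fun i => qquot * qpow (half_wt i))). Qed.

Lemma scale_X_inj (M N : 'M[S]_n) k : fps_X ^+ k *: M = fps_X ^+ k *: N -> M = N.
Proof.
move=> E; apply/matrixP => i j; apply: (@fps_Xn_inj _ k).
by have := congr1 (fun M : 'M_n => M i j) E; rewrite !mxE.
Qed.

(** This is the relation between x and y on v_p, multiplied by h. After a further multiplication by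
    q - q^-1 the quantum integers become differences of powers of q_eps, and it remains to compare
    exponents. *)
Lemma yx_commutation p : (p < n)%N ->
  fps_X * (qquot * qpow (half_wt p) * (qint (n - p) * qint p)
           - qpow 1 * (qint p.+1 * (qquot * qpow (half_wt p.+1) * qint (n - p.+1)))) =
  1 - qpow (n%:R - a_wt p - a_wt p).
Proof.
move=> ltpn; apply: (fps_mulIf qdiff_neq0); have nz := two_neq0.
transitivity (qpow (half_wt p) * ((qdiff * qint (n - p)) * (qdiff * qint p))
  - qpow (1 + half_wt p.+1) * ((qdiff * qint p.+1) * (qdiff * qint (n - p.+1)))).
  rewrite (qpowD 1 (half_wt p.+1)); transitivity (qdiff * (fps_X * qquot *
    (qpow (half_wt p) * (qint (n - p) * qint p)
     - qpow 1 * qpow (half_wt p.+1) * (qint p.+1 * qint (n - p.+1))))); first by ring.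
  by rewrite qquotE; ring.
rewrite !qdiff_qint !qpow_prod !natrB ?(ltnW ltpn) // /half_wt /a_wt -[p.+1%:R]natr1.
set N : Qe := n%:R; set x : Qe := p%:R.
have -> : (N - 1) / 2 - x + (N - x) / 2 + x / 2 = N - 2^-1 - x by field.
have -> : (N - 1) / 2 - x + (N - x) / 2 - x / 2 = N - 2^-1 - x - x by field.
have -> : (N - 1) / 2 - x - (N - x) / 2 + x / 2 = - 2^-1 by field.
have -> : (N - 1) / 2 - x - (N - x) / 2 - x / 2 = - 2^-1 - x by field.
have -> : 1 + ((N - 1) / 2 - (x + 1)) + (x + 1) / 2 + (N - (x + 1)) / 2 =
  N - 2^-1 - x by field.
have -> : 1 + ((N - 1) / 2 - (x + 1)) + (x + 1) / 2 - (N - (x + 1)) / 2 =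
  2^-1 by field.
have -> : 1 + ((N - 1) / 2 - (x + 1)) - (x + 1) / 2 + (N - (x + 1)) / 2 =
  N - 2^-1 - x - x - 1 by field.
have -> : 1 + ((N - 1) / 2 - (x + 1)) - (x + 1) / 2 - (N - (x + 1)) / 2 =
  - 2^-1 - x by field.
rewrite /qdiff mulrBr mulr1 mulrBl -!qpowD.
have -> : 2^-1 + (N - (x + 2^-1) - (x + 2^-1)) = N - 2^-1 - x - x by field.
have -> : - 2^-1 + (N - (x + 2^-1) - (x + 2^-1)) = N - 2^-1 - x - x - 1 by field.
ring.
Qed.

Lemma fps_exp_at0 (u : fps freeD) : fps_at0 (fps_exp u) = 1.
Proof. by rewrite /fps_at0 /= big_ord1 fact0 invr1 scale1r. Qed.

Lemma rep_commutator d (e : Qe) (M : 'M[S]_n) :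
  (forall i j : 'I_n, M i j != 0 -> d i - d j = fps_cst e) ->
  dg d *m M - M *m dg d = fps_cst e *: M.
Proof.
move=> E; apply/matrixP => i j.
rewrite mxE [X in _ + X = _]mxE mul_dgmx mul_mxdg [RHS]mxE.
rewrite [M i j * _]mulrC -mulrBl; have [->|/E -> //] := eqVneq (M i j) 0.
by rewrite !mulr0.
Qed.

Lemma x_mx_neq0 (i j : 'I_n) : x_mx m i j != 0 -> i = j.+1 :> nat.
Proof.
by rewrite mul_dgmx mxE; case: (nat_of_ord i =P j.+1) => // _; rewrite mulr0n mulr0 eqxx.
Qed.

Lemma y_mx_neq0 (i j : 'I_n) : y_mx m i j != 0 -> j = i.+1 :> nat.
Proof. by rewrite mxE; case: (nat_of_ord j =P i.+1) => // _; rewrite mulr0n eqxx. Qed.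

Local Opaque qpow qint qquot qdiff A_ Ainv B_ T_ Tinv t_ h_ eps_ x_ y_ a_ b_ fps_divX scal.

Lemma rep_relation_xy :
  rep (x_ * y_ - (scal q_eps * y_ * x_ + fps_divX 1 (1 - A_ * B_))) = 0.
Proof.
have Exy : x_mx m *m y_mx m =
    dg (fun i : 'I_n => qquot * qpow (half_wt i) * (qint (n - i) * qint i)).
  by rewrite /x_mx -mulmxA f_mx_y_mx dgM.
have EA : fps_at0 A_ = 1 := fps_exp_at0 _.
have EB : fps_at0 B_ = 1 := fps_exp_at0 _.
have ordAB : fps_ord 1 (1 - A_ * B_).
  move=> [|//] _; apply: (etrans (rmorphB (@fps_at0 freeD) 1 (A_ * B_))).
  apply: (etrans (congr2 (fun a b : freeD => a - b) (rmorph1 _)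
    (etrans (rmorphM _ A_ B_) (congr2 *%R EA EB)))).
  by rewrite mulr1 subrr.
have EAB : rep (1 - A_ * B_) = _ := etrans (repB _ 1 (A_ * B_))
  (congr2 (fun a b : 'M[S]_n => a - b) (rep1 _)
     (etrans (repM _ A_ B_) (etrans (congr2 *%R (rep_A m) (rep_B m)) (dgM _ _)))).
have Eyx : rep (scal q_eps * y_ * x_) = qpow 1 *: (y_mx m *m x_mx m).
  apply: etrans (congr1 rep (esym (mulrA (scal q_eps) y_ x_))) _.
  apply: etrans (rep_scalM _ _ (y_ * x_)) _; rewrite q_epsE; congr (_ *: _).
  exact: etrans (repM _ y_ x_) (congr2 *%R (rep_y m) (rep_x m)).
apply: etrans (repB _ (x_ * y_) _) _.
rewrite (repM _ x_ y_ : _ = rep x_ *m rep y_) rep_x rep_y Exy.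
rewrite (repD _ (scal q_eps * y_ * x_)) Eyx y_mx_x_mx.
(* Multiplication by h undoes the division by h in the relation. *)
apply: (@scale_X_inj _ _ 1); rewrite scaler0 scalerBr scalerDr.
have dg1 : (1 : 'M[S]_n) = dg (fun=> 1) by rewrite dg_scalar.
rewrite (rep_divX _ ordAB) EAB dg1.
rewrite !dgZ dgN dgD dgD dgN dgD.
rewrite (eq_dg (e := fun=> 0)) ?dg_scalar ?raddf0 // => i.
have := yx_commutation (ltn_ord i); rewrite expr1 mulrBr => E.
have Eq : qpow (- a_wt i) * qpow (n%:R - a_wt i) = qpow (n%:R - a_wt i - a_wt i).
  by rewrite -(qpowD (- a_wt i) (n%:R - a_wt i)) addrC.
have sub0 (u v w : S) : u - v = w -> u - (v + w) = 0.
  by move=> <-; rewrite opprD addrA subrr.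
by refine (sub0 _ _ _ (etrans E (congr1 (fun z => 1 - z) (esym Eq)))).
Qed.

Lemma rep_comm u v M N : rep u = M -> rep v = N ->
  rep (u * v - v * u) = M *m N - N *m M.
Proof.
move=> <- <-.
exact: etrans (repB _ (u * v) (v * u)) (congr2 (fun M N => M - N) (repM _ u v) (repM _ v u)).
Qed.

Lemma rep_relations k : rep (nth 0 relations k) = 0.
Proof.
have one : fps_cst (1 : Qe) = 1 by rewrite rmorph1.
have sub u v M : rep u = M -> rep v = M -> rep (u - v) = 0.
  by move=> Eu Ev; apply: etrans (repB _ u v) _; rewrite Eu Ev; apply: subrr.
have add u v M : rep u = - M -> rep v = M -> rep (u + v) = 0.
  by move=> Eu Ev; apply: etrans (repD _ u v) _; rewrite Eu Ev; apply: addNr.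
have wt_a (i j : 'I_n) : i = j.+1 :> nat ->
    fps_cst (a_wt i) - fps_cst (a_wt j) = fps_cst 1.
  by move=> Ei; rewrite -rmorphB /a_wt Ei -natr1; congr fps_cst; ring.
have wt_b (i j : 'I_n) : i = j.+1 :> nat ->
    fps_cst (b_wt m i) - fps_cst (b_wt m j) = fps_cst eps.
  by move=> Ei; rewrite -rmorphB /b_wt /a_wt Ei -natr1; congr fps_cst; ring.
case: k => [|[|[|[|[|[|k]]]]]].
- exact: rep_relation_xy.
- apply: sub (rep_comm (rep_a m) (rep_x m)) _.
  rewrite (@rep_commutator _ 1) => [|i j /x_mx_neq0 /wt_a //].
  apply: etrans (rep_x m) (esym (etrans (congr1 (fun c => c *: x_mx m) one) _)).
  exact: scale1r.
- apply: sub (rep_comm (rep_b m) (rep_x m)) _.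
  rewrite (@rep_commutator _ eps) => [|i j /x_mx_neq0 /wt_b //].
  exact: etrans (rep_scalM _ _ x_) (congr1 _ (rep_x m)).
- apply: add (etrans (rep_comm (rep_a m) (rep_y m)) _) (rep_y m).
  rewrite (@rep_commutator _ (- 1)) => [|i j /y_mx_neq0 /wt_a E].
    rewrite rmorphN scaleNr; congr (- _).
    exact: etrans (congr1 (fun c => c *: y_mx m) one) (scale1r _).
  by rewrite -opprB; apply: etrans (congr1 -%R E) (esym (rmorphN (@fps_cst Qe) 1)).
- apply: add (etrans (rep_comm (rep_b m) (rep_y m)) _)
             (etrans (rep_scalM _ _ y_) (congr1 _ (rep_y m))).
  rewrite (@rep_commutator _ (- eps)) => [|i j /y_mx_neq0 /wt_b E].
    by rewrite rmorphN scaleNr.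
  by rewrite -opprB; apply: etrans (congr1 -%R E) (esym (rmorphN (@fps_cst Qe) eps)).
- apply: etrans (rep_comm (rep_a m) (rep_b m)) _.
  rewrite dgM dgM -[RHS](subrr (dg (fun i : 'I_n => fps_cst (a_wt i) * fps_cst (b_wt m i)))).
  by congr (_ - _); apply: eq_dg => i; rewrite mulrC.
(* [D_eq] admits indices beyond the list of relations, where [nth] gives 0. *)
- by rewrite nth_default // rep0.
Qed.

End ModuleRelations.

Local Transparent qpow qint qquot qdiff A_ Ainv B_ T_ Tinv t_ h_ eps_ x_ y_ a_ b_
  fps_divX scal.

Lemma laurent_eval_morph (R R' : nzRingType) (f : {rmorphism R -> R'}) u v P :
  f (laurent_eval u v P) = laurent_eval (f u) (f v) P.
Proof.
rewrite /laurent_eval rmorph_sum; apply: eq_bigr => i _.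
by rewrite rmorphMz; case: i => k; rewrite rmorphXn.
Qed.

Lemma laurent_eval11 (R : nzRingType) P :
  laurent_eval (1 : R) 1 P = (laurent_eval (1 : int) 1 P)%:~R.
Proof. by rewrite (laurent_eval_morph intr) rmorph1. Qed.

(* The numerator of the second term of W *)
Lemma W_numerator_ord (R : nzRingType) (q a a' t h : fps R) :
  q 0%N = 1 -> a 0%N = 1 -> a' 0%N = 1 -> t 0%N = 1 -> h 0%N + h 0%N = 1 ->
  a' 1%N = - a 1%N -> h 1%N = 0 ->
  fps_ord 2 (q * a + a' * t - h * (1 + t) * (q + 1)).
Proof.
move=> q0 a0 a'0 t0 h0 a'1 h1.
have hh (x : R) : h 0%N * (x + x) = x by rewrite mulrDr -mulrDl h0 mul1r.
have c1 (f g : fps R) : (f * g) 1%N = f 0%N * g 1%N + f 1%N * g 0%N.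
  by rewrite fps_coefM big_ord_recl big_ord1.
have c0 (f g : fps R) : (f * g) 0%N = f 0%N * g 0%N.
  by rewrite fps_coefM big_ord1.
case=> [|[|//]] _; rewrite fps_coefB !fps_coefD.
  rewrite !c0 !fps_coefD q0 a0 a'0 t0 !fps_coef1 /= !mulr1.
  by rewrite hh mul1r subrr.
rewrite -mulrA !c1 !c0 !fps_coefD !fps_coef1 q0 a0 a'0 t0 a'1 h1 /=.
rewrite mul0r addr0 !mulr1 !mul1r !addr0 !add0r [1 + 1]addrC.
have -> : (1 + 1) * q 1%N + t 1%N * (1 + 1) = q 1%N + t 1%N + (q 1%N + t 1%N).
  by rewrite mulrDl mulrDr mul1r mulr1 addrACA.
by rewrite hh [a 1%N + _]addrC addrACA subrr addr0 subrr.
Qed.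

Lemma scale_combine (C : comNzRingType) k (q z zi X w : C) (Y d : 'I_k -> C)
    (M : 'M[C]_k) :
  X * z = q -> z * zi = 1 -> X ^+ 2 *: M = dg d ->
  (forall i, q * (X * Y i) + d i = q * w) ->
  q *: (X *: (dg Y + zi *: M)) = q *: w%:M.
Proof.
move=> Xz zK EM E; rewrite !scalerDr [X *: (zi *: M)]scalerA [q *: (_ *: M)]scalerA.
have -> : q * (X * zi) = X ^+ 2.
  by rewrite -Xz -[RHS]mulr1 -zK expr2; ring.
rewrite EM !dgZ dgD scale_scalar_mx -dg_scalar.
exact: eq_dg.
Qed.

Lemma scale_inj (K : fieldType) k (c : fps K) (M N : 'M_k) :
  c <> 0 -> c *: M = c *: N -> M = N.
Proof.
move=> c0 E; apply/matrixP => i j; apply: (fps_mulIf c0).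
by have := congr1 (fun M : 'M_k => M i j) E; rewrite !mxE.
Qed.

(** * The central element W on the module *)

Section W.
Variable m : nat.
Local Notation n := m.+1.
Local Notation S := (fps Qe).
Local Notation rep := (rep (@gens m)).
Local Notation half_wt := (half_wt m).

(* The value of h W *)
Definition hW_val : S :=
  - (fps_cst 2^-1 * (1 + qpow n%:R) * (qpow 2^-1 - 1) * fps_inv (qpow 2^-1 + 1)).

Lemma hW_val_ord : fps_ord 1 hW_val.
Proof.
apply/fps_ordN/fps_ordMr/fps_ordMl => -[|//] _.
by rewrite fps_coefB fps_coef1 qpow_at0 subrr.
Qed.

Lemma q_sub1E : qpow 1 - 1 = (qpow 2^-1 + 1) * (qpow 2^-1 - 1).
Proof.
have nz := two_neq0; have -> : qpow 1 = qpow 2^-1 * qpow 2^-1.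
  by rewrite -qpowD; congr qpow; field.
ring.
Qed.

Lemma q_sub1_neq0 : qpow 1 - 1 <> 0.
Proof. by move/subr0_eq; apply: qpow_neq1; apply: oner_neq0. Qed.

Lemma hW_valE : (qpow 1 - 1) * hW_val =
  - (fps_cst 2^-1 * (1 + qpow n%:R) * ((qpow 2^-1 - 1) * (qpow 2^-1 - 1))).
Proof.
have inv : (qpow 2^-1 + 1) * fps_inv (qpow 2^-1 + 1) = 1.
  apply: fps_invK; rewrite fps_coefD fps_coef1 qpow_at0; exact: two_neq0.
apply: etrans (congr1 (fun z => z * hW_val) q_sub1E) _; rewrite /hW_val.
move: (fps_inv _) inv; move: (fps_cst 2^-1) (qpow n%:R) (qpow 2^-1) => c u s i inv.
transitivity (- (c * (1 + u) * ((s - 1) * (s - 1)) * ((s + 1) * i))); first by ring.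
by rewrite inv mulr1.
Qed.

Lemma W_exponents p : (p < n)%N ->
  qpow 2^-1 * (qpow (a_wt p.+1) * qpow (half_wt p.+1))
     * ((qdiff * qint p.+1) * (qdiff * qint (n - p.+1))) =
  qpow 2^-1 * qpow n%:R - qpow 1 * qpow (a_wt p) - qpow (- a_wt p) * qpow n%:R
  + qpow 2^-1.
Proof.
move=> ltpn; have nz := two_neq0.
pose e := 2^-1 + (a_wt p.+1 + half_wt p.+1).
have Ee : qpow 2^-1 * (qpow (a_wt p.+1) * qpow (half_wt p.+1)) = qpow e.
  exact: etrans (congr1 _ (esym (qpowD _ _))) (esym (qpowD _ _)).
apply: etrans (congr2 *%R Ee (congr2 *%R (qdiff_qint p.+1) (qdiff_qint (n - p.+1)))) _.
apply: etrans (qpow_prod _ _ _) _; rewrite /e natrB // /half_wt /a_wt -[p.+1%:R]natr1.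
set N : Qe := n%:R; set x : Qe := p%:R.
have E1 : qpow (2^-1 + N) = qpow 2^-1 * qpow N by apply: qpowD.
have E2 : qpow (1 + (x + 2^-1)) = qpow 1 * qpow (x + 2^-1) by apply: qpowD.
have E3 : qpow (- (x + 2^-1) + N) = qpow (- (x + 2^-1)) * qpow N by apply: qpowD.
apply: etrans _ (congr1 (fun z => z + qpow 2^-1) (congr2 (fun u v => u - v)
  (congr2 (fun u v => u - v) E1 E2) E3)).
congr (qpow _ - qpow _ - qpow _ + qpow _); by field.
Qed.

(** This is (q_eps - 1) h W on v_p. By [W_exponents] the first summand is s (1 + T) - q_eps A^-1 - A
    T, with s = q_eps^(1/2). The terms depending on p cancel, and s (1 + T) - (1 + T) (s^2 + 1) / 2
    = -(1 + T) (s - 1)^2 / 2 remains. *)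
Lemma W_scalar_identity p : (p < n)%N ->
  (qpow 1 - 1) * (fps_X * (qint p.+1 *
     (qpow (a_wt p.+1) * (qquot * qpow (half_wt p.+1)) * qint (n - p.+1)))) +
  (qpow 1 * qpow (a_wt p) + qpow (- a_wt p) * qpow n%:R
   - fps_cst 2^-1 * (1 + qpow n%:R) * (qpow 1 + 1)) = (qpow 1 - 1) * hW_val.
Proof.
move=> ltpn; have nz := two_neq0; rewrite hW_valE.
have q1E : qpow 1 = qpow 2^-1 * qpow 2^-1 by rewrite -qpowD; congr qpow; field.
have c2 : fps_cst (2^-1 : Qe) * (1 + 1) = 1.
  rewrite mulrDr mulr1 -rmorphD (_ : 2^-1 + 2^-1 = 1 :> Qe) ?rmorph1 //.
  by field.
have q1d : qpow 1 - 1 = qpow 2^-1 * qdiff.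
  rewrite /qdiff mulrBr (qpowN 2^-1).
  by apply: etrans (congr1 (fun z => z - 1) q1E) _.
have := W_exponents ltpn; have := qquotE; move: q1d; move: q1E.
move: (qpow 1) (qpow 2^-1) (fps_cst _) c2 => q s c c2.
move: (qpow (a_wt p.+1)) (qpow (half_wt p.+1)) (qint p.+1) (qint (n - p.+1)) => A H u v.
move: (qpow (a_wt p)) (qpow (- a_wt p)) (qpow n%:R) (fps_X) qquot qdiff => a a' w X r d.
move=> q1E q1d XrE E.
transitivity ((q - 1) * (X * r) * (A * H) * u * v + (q * a + a' * w - c * (1 + w) * (q + 1))).
  ring.
rewrite XrE q1d.
transitivity (s * (A * H) * ((d * u) * (d * v)) + (q * a + a' * w - c * (1 + w) * (q + 1))).
  ring.
rewrite E q1E.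
transitivity (s * (1 + w) * (c * (1 + 1)) - c * (1 + w) * (s * s + 1)); last ring.
by rewrite c2; ring.
Qed.

Lemma fps_coef_exp1 (u : fps freeD) : fps_ord 1 u -> fps_exp u 1%N = u 1%N.
Proof.
move=> u1; rewrite /= big_ord_recl big_ord1 /=.
by rewrite scaler0 add0r (_ : 1`! = 1%N) // invr1 scale1r expr1.
Qed.

Definition W_num : fps freeD :=
  scal q_eps * Ainv + A_ * T_ - Defs.half * (1 + T_) * (scal q_eps + 1).

Lemma W_num_ord : fps_ord 2 W_num.
Proof.
have ordh u : fps_ord 1 (eps_ * h_ * u).
  by apply/fps_ordMr/fps_ordMl/fps_ord_X.
apply: W_numerator_ord; try exact: fps_exp_at0.
- by rewrite /= expr0 fact0 divr1 scale1r.
- by rewrite /= -scalerDl (_ : 2^-1 + 2^-1 = 1) ?scale1r //; have := two_neq0 => ?; field.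
- exact: etrans (fps_coef_exp1 (fps_ordN (ordh a_)))
    (congr1 -%R (esym (fps_coef_exp1 (ordh a_)))).
- by rewrite /= scale0r.
Qed.

Lemma rep_W_num : rep W_num = dg (fun i : 'I_n =>
  qpow 1 * qpow (a_wt i) + qpow (- a_wt i) * qpow n%:R
   - fps_cst 2^-1 * (1 + qpow n%:R) * (qpow 1 + 1)).
Proof.
have dg1 : (1 : 'M[S]_n) = dg (fun=> 1) by rewrite dg_scalar.
have dgT : rep T_ = dg (fun=> qpow n%:R) := etrans (rep_T m) (esym (dg_scalar _ _)).
have dgq : rep (scal q_eps) = dg (fun=> qpow 1).
  exact: etrans (rep_scal _ _) (etrans (congr1 _ q_epsE) (esym (dg_scalar _ _))).
have dgh : rep Defs.half = dg (fun=> fps_cst 2^-1).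
  exact: etrans (rep_scal _ _) (esym (dg_scalar _ _)).
have mulE u v d e : rep u = dg d -> rep v = dg e -> rep (u * v) = dg (fun i => d i * e i).
  by move=> Eu Ev; apply: etrans (repM _ u v) (etrans (congr2 *%R Eu Ev) (dgM d e)).
have addE u v d e : rep u = dg d -> rep v = dg e -> rep (u + v) = dg (fun i => d i + e i).
  by move=> Eu Ev; apply: etrans (repD _ u v) (etrans (congr2 +%R Eu Ev) (dgD d e)).
have subE u v d e : rep u = dg d -> rep v = dg e -> rep (u - v) = dg (fun i => d i - e i).
  move=> Eu Ev; apply: etrans (repB _ u v) (etrans (congr2 (fun M N => M - N) Eu Ev) _).
  by rewrite dgN dgD.
have rep1' : rep 1 = dg (fun=> 1) := etrans (rep1 _) dg1.
exact: subE _ _ _ _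
  (addE _ _ _ _ (mulE _ _ _ _ dgq (rep_Ainv m)) (mulE _ _ _ _ (rep_A m) dgT))
  (mulE _ _ _ _ (mulE _ _ _ _ dgh (addE _ _ _ _ rep1' dgT)) (addE _ _ _ _ dgq rep1')).
Qed.

(** Multiplying by q_eps - 1, which is nonzero in a domain, clears the denominator of W and reduces
    the claim to [W_scalar_identity] on each basis vector. *)
Lemma rep_hW : fps_X *: rep W_ = hW_val%:M.
Proof.
pose z : S := fps_divX 1 (q_eps - 1).
have Xz : fps_X * z = qpow 1 - 1.
  have ordq : fps_ord 1 (qpow 1 - 1).
    by move=> [|//] _; rewrite fps_coefB fps_coef1 qpow_at0 subrr.
  by rewrite /z q_epsE -[X in X * _]expr1 fps_divXK.
have zinv : z * fps_inv z = 1.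
  apply: fps_invK; rewrite /z /= expr1 divr1 subr0; exact: eps_neq0.
pose d p := qpow (a_wt p) * (qquot * qpow (half_wt p)).
have EY : rep (y_ * Ainv * x_) =
    dg (fun i : 'I_n => qint i.+1 * (d i.+1 * qint (n - i.+1))).
  apply: etrans (congr1 rep (esym (mulrA y_ Ainv x_))) _.
  apply: etrans (repM _ y_ (Ainv * x_)) _.
  apply: etrans (congr2 *%R (rep_y m) (etrans (repM _ Ainv x_)
    (congr2 *%R (rep_Ainv m) (rep_x m)))) _.
  refine (etrans (congr1 (mulmx (y_mx m)) _) (y_mx_f_mx m d)).
  refine (etrans (mulmxA _ _ _) (congr1 (mulmx^~ (f_mx m)) (dgM _ _))).
have EW : rep W_ = rep (y_ * Ainv * x_) + fps_inv z *: rep (fps_divX 2 W_num).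
  refine (etrans (repD _ (y_ * Ainv * x_) _) (congr1 (fun M => _ + M) _)).
  exact: rep_scalM.
have E2 : fps_X ^+ 2 *: rep (fps_divX 2 W_num) = _ := etrans (rep_divX _ W_num_ord) rep_W_num.
apply: etrans (congr1 _ EW) _; rewrite EY.
apply: (scale_inj q_sub1_neq0); apply: scale_combine Xz zinv E2 _ => i.
exact: W_scalar_identity (ltn_ord i).
Qed.

End W.

(** * The scalar given by the expansion of Z_D *)

Section DValue.
Variables (m : nat) (Delta : laurent) (rho : nat -> nat -> laurent).
Hypothesis Delta1 : laurent_eval (1 : int) 1 Delta = 1.
Local Notation n := m.+1.
Local Notation S := (fps Qe).
Local Notation rep := (rep (@gens m)).

Definition eval_qn (P : laurent) : S := laurent_eval (qpow n%:R) (qpow (- n%:R)) P.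

Definition BV_term (k : nat) : S :=
  fps_cst (eps ^+ k) * fps_X ^+ k *
  \sum_(0 <= j < (2 * k).+1)
     eval_qn (rho k j) * hW_val m ^+ j * fps_inv1 (eval_qn Delta) ^+ (2 * k - j).

Definition BV_value : S := fps_inv1 (eval_qn Delta) * fexp (fps_sum 1 BV_term).

Lemma rep_eval_T P : rep (eval_T P) = (eval_qn P)%:M.
Proof.
apply: etrans (laurent_eval_morph rep T_ Tinv P) _.
apply: etrans (congr2 (fun u v => laurent_eval u v P) (rep_T m) (rep_Tinv m)) _.
exact: esym (laurent_eval_morph (@scalar_mx S n) _ _ P).
Qed.

Lemma eval_qn_Delta0 : eval_qn Delta 0%N = 1.
Proof.
apply: etrans (laurent_eval_morph (@fps_at0 Qe) _ _ _) _.
apply: etrans (congr2 (fun u v => laurent_eval u v Delta) (qpow_at0 _) (qpow_at0 _)) _.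
by rewrite laurent_eval11 Delta1.
Qed.

Lemma eval_T_Delta0 : eval_T Delta 0%N = 1.
Proof.
apply: etrans (laurent_eval_morph (@fps_at0 freeD) _ _ _) _.
apply: etrans (congr2 (fun u v => laurent_eval u v Delta)
  (fps_exp_at0 _) (fps_exp_at0 _)) _.
by rewrite laurent_eval11 Delta1.
Qed.

Lemma rep_scalarM u v (c d : S) : rep u = c%:M -> rep v = d%:M -> rep (u * v) = (c * d)%:M.
Proof.
move=> Eu Ev; apply: etrans (repM _ u v) _.
exact: etrans (congr2 *%R Eu Ev) (esym (scalar_mxM _ _ _)).
Qed.

Lemma rep_scalarX u (c : S) k : rep u = c%:M -> rep (u ^+ k) = (c ^+ k)%:M.
Proof.
move=> Eu; apply: etrans (repXn _ u k) _.
by apply: etrans (congr1 (fun M => M ^+ k) Eu) _; rewrite (rmorphXn (@scalar_mx S n)).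
Qed.

Lemma rep_scalar_sum I (r : seq I) (F : I -> fps freeD) (f : I -> S) :
  (forall i, rep (F i) = (f i)%:M) ->
  rep (\sum_(i <- r) F i) = (\sum_(i <- r) f i)%:M.
Proof.
move=> E; apply: etrans (rep_bigsum _ r xpredT F) _.
by rewrite raddf_sum; apply: eq_bigr => i _; apply: E.
Qed.

Lemma rep_hWX j : rep (h_ ^+ j * W_ ^+ j) = (hW_val m ^+ j)%:M.
Proof.
apply: etrans (repM _ (h_ ^+ j) (W_ ^+ j)) _.
apply: etrans (congr2 *%R (rep_scalarX j (rep_X _)) (repXn _ W_ j)) _.
apply: etrans (mul_scalar_mx _ _) _; apply: etrans (esym (exprZn _ _ j)) _.
apply: etrans (congr1 (fun M => M ^+ j) (rep_hW m)) _.
exact: esym (rmorphXn (@scalar_mx S n) j _).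
Qed.

Lemma rep_Dinv : rep (fps_inv1 (eval_T Delta)) = (fps_inv1 (eval_qn Delta))%:M.
Proof. exact: rep_inv1 eval_T_Delta0 eval_qn_Delta0 (rep_eval_T Delta). Qed.

Lemma rep_BV_term k :
  rep (eps_ ^+ k * h_ ^+ k * \sum_(0 <= j < (2 * k).+1)
     eval_T (rho k j) * (h_ ^+ j * W_ ^+ j) * fps_inv1 (eval_T Delta) ^+ (2 * k - j))
  = (BV_term k)%:M.
Proof.
have Eeps : rep (eps_ ^+ k) = (fps_cst (eps ^+ k))%:M.
  by apply: etrans (rep_scalarX k (rep_scal _ _)) _; rewrite (rmorphXn (@fps_cst Qe)).
apply: rep_scalarM (rep_scalarM Eeps (rep_scalarX k (rep_X _))) _.
apply: rep_scalar_sum => j.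
apply: rep_scalarM (rep_scalarM (rep_eval_T _) (rep_hWX j)) _.
exact: rep_scalarX rep_Dinv.
Qed.

Lemma BV_term_ord k : fps_ord k (BV_term k).
Proof. by apply/fps_ordMr/fps_ordMl/fps_ord1X/fps_ord_X. Qed.

Lemma rep_fps_sum_scalar k0 (u : nat -> fps freeD) (c : nat -> S) :
  (forall k, fps_ord k (u k)) -> (forall k, rep (u k) = (c k)%:M) ->
  rep (fps_sum k0 u) = (fps_sum k0 c)%:M.
Proof.
move=> ordu E; apply/matrixP => i j.
apply: etrans (rep_fps_sum _ k0 i j ordu) _; rewrite mxE.
apply: fpsP => N.
have Eij k : rep (u k) i j = c k *+ (i == j).
  by apply: etrans (congr1 (fun M : 'M_n => M i j) (E k)) _; rewrite mxE.
transitivity (\sum_(k0 <= k < N.+1) (c k *+ (i == j)) N).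
  by apply: eq_bigr => k _; refine (congr1 (fun f : S => f N) (Eij k)).
by case: (i == j) => //=; rewrite big1.
Qed.

(** The relations act as 0, so that congruent elements have the same action, and everything in the
    expansion (T, h W, h, eps) acts as a scalar. *)
Lemma rep_BV_expansion K : BV_expansion K Delta rho ->
  rep (Z_D K) = BV_value%:M.
Proof.
move=> E; apply: etrans (rep_D_eq (@rep_relations m) E) _.
have ordG k : fps_ord k (eps_ ^+ k * h_ ^+ k * \sum_(0 <= j < (2 * k).+1)
     eval_T (rho k j) * (h_ ^+ j * W_ ^+ j) * fps_inv1 (eval_T Delta) ^+ (2 * k - j)).
  by apply/fps_ordMr/fps_ordMl/fps_ord1X/fps_ord_X.
have EG := rep_fps_sum_scalar 1 ordG rep_BV_term.
apply: rep_scalarM rep_Dinv _; rewrite -dg_scalar.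
apply: rep_exp; last by rewrite dg_scalar.
move=> [|//] _; apply: etrans (big_geq _) _ => //.
Qed.

End DValue.

(** * Expansion at q^(1/2) = 1 with rational coefficients *)

Section Ratr.
Variable K : fieldType.
Hypothesis charK : [pchar K] =i pred0.

Lemma intr_inj_char0 (i : int) : (i%:~R : K) = 0 -> i = 0.
Proof.
have natP p : (p%:R : K) = 0 -> p = 0%N.
  by move/eqP; rewrite ((pcharf0P K).1 charK) => /eqP.
case: i => p; first by rewrite -pmulrn => /natP ->.
by rewrite NegzE mulrNz => /eqP; rewrite oppr_eq0 -pmulrn => /eqP/natP.
Qed.

Lemma denq_char0 x : ((denq x)%:~R : K) != 0.
Proof. by apply/eqP => /intr_inj_char0/eqP; rewrite denq_eq0. Qed.

Lemma ratr_unique (x : rat) (p d : int) : d != 0 ->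
  x * d%:~R = p%:~R -> (ratr x : K) * d%:~R = p%:~R.
Proof.
move=> d0 E; have Ei : numq x * d = p * denq x.
  apply: (@intr_inj rat); rewrite !rmorphM /= -E numqE; ring.
apply: (mulIf (denq_char0 x)); rewrite -intrM -Ei intrM /ratr.
by have nz := denq_char0 x; field.
Qed.

Fact ratr_is_zmod_morphism : zmod_morphism (ratr : rat -> K).
Proof.
move=> x y; have dx := denq_char0 x; have dy := denq_char0 y.
have d0 : denq x * denq y != 0 by rewrite mulf_neq0 ?denq_neq0.
apply: (mulIf (mulf_neq0 dx dy)); rewrite -intrM.
rewrite (@ratr_unique _ (numq x * denq y - numq y * denq x)) //.
  rewrite mulrBl rmorphB /= !intrM /ratr; by field; rewrite dx dy.
by rewrite rmorphB /= !rmorphM /= !numqE; ring.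
Qed.

Fact ratr_is_monoid_morphism : monoid_morphism (ratr : rat -> K).
Proof.
split=> [|x y].
  by have := @ratr_unique 1 1 1 isT; rewrite !mulr1; apply.
have dx := denq_char0 x; have dy := denq_char0 y.
have d0 : denq x * denq y != 0 by rewrite mulf_neq0 ?denq_neq0.
apply: (mulIf (mulf_neq0 dx dy)); rewrite -intrM.
rewrite (@ratr_unique _ (numq x * numq y)) //.
  by rewrite !intrM /ratr; field; rewrite dx dy.
by rewrite !rmorphM /= !numqE; ring.
Qed.

Definition ratr_morph : {rmorphism rat -> K} :=
  HB.pack (ratr : rat -> K)
    (GRing.isZmodMorphism.Build rat K _ ratr_is_zmod_morphism)
    (GRing.isMonoidMorphism.Build rat K _ ratr_is_monoid_morphism).

Definition fps_ratr : {rmorphism fps rat -> fps K} := fps_map ratr_morph.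

Lemma ratr_inj : injective (ratr : rat -> K).
Proof. exact: fmorph_inj ratr_morph. Qed.

Lemma fps_ratr_inj : injective fps_ratr.
Proof.
move=> f g E; apply: fpsP => i; apply: ratr_inj.
by refine (congr1 (fun h : fps K => h i) E).
Qed.

Lemma q12_series_at0 : q12_series K 0%N = 1.
Proof. by rewrite /= big_ord0 fact0 divr1. Qed.

Lemma four_neq0 : (4 : K) != 0.
Proof. exact: natf_neq0_char0 charK 3. Qed.

Lemma q12_series_neq1 : q12_series K <> 1.
Proof.
move=> /(congr1 (fun h : fps K => h 1%N)) /eqP; rewrite /= big_ord1 subr0.
by rewrite (_ : 1`! = 1%N) // divr1 invr_eq0 (negPf four_neq0).
Qed.

Lemma fps_ratr_q12 : fps_ratr (q12_series rat) = q12_series K.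
Proof.
apply: fpsP => i.
rewrite -[LHS]/(ratr_morph (\prod_(j < i) (4%:R^-1 - j%:R) / i`!%:R)).
rewrite fmorph_div rmorph_prod rmorph_nat; congr (_ / _).
by apply: eq_bigr => j _; rewrite rmorphB fmorphV !rmorph_nat.
Qed.

Lemma poly_seriesM : {morph @poly_series K : p r / p * r}.
Proof. by move=> p r; rewrite /poly_series rmorphM hornerM. Qed.
Lemma poly_seriesD : {morph @poly_series K : p r / p + r}.
Proof. by move=> p r; rewrite /poly_series rmorphD hornerD. Qed.
Lemma poly_seriesN : {morph @poly_series K : p / - p}.
Proof. by move=> p; rewrite /poly_series rmorphN hornerN. Qed.
Lemma poly_series1 : poly_series (1 : {poly K}) = 1.
Proof. by rewrite /poly_series rmorph1 hornerC. Qed.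
Lemma poly_series0 : poly_series (0 : {poly K}) = 0.
Proof. by rewrite /poly_series rmorph0 horner0. Qed.
Lemma poly_seriesX : poly_series ('X : {poly K}) = q12_series K.
Proof. by rewrite /poly_series map_polyX hornerX. Qed.

Lemma poly_series_eq0 (p : {poly K}) : poly_series p = 0 -> p = 0.
Proof. exact: poly_at_fps_inj q12_series_at0 q12_series_neq1. Qed.

(** Keeping the expansion in Q[[z]] makes it independent of k, so that it can be mapped to series
    over Q(eps). *)
Definition expands (f : kq K) (g : fps rat) := has_expansion f (fps_ratr g).

(** The series of q^(1/2) is transcendental, so that nonzero denominators have nonzero series, which
    can be cancelled. *)
Lemma expands_inj f g1 g2 : expands f g1 -> expands f g2 -> g1 = g2.
Proof.
move=> [a1 [b1 [nz1 E1 H1]]] [a2 [b2 [nz2 E2 H2]]]; apply: fps_ratr_inj.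
have Eab : a1 * b2 = a2 * b1.
  have/eqP := etrans (esym E1) E2.
  rewrite eqr_div ?tofrac_eq0 // -!tofracM tofrac_eq => /eqP ->.
  by rewrite mulrC.
have nzb : poly_series (b1 * b2) <> 0.
  by move/poly_series_eq0/eqP; rewrite mulf_eq0 (negPf nz1) (negPf nz2).
apply: (fps_mulIf nzb); rewrite poly_seriesM.
transitivity (poly_series b2 * poly_series a1); first by rewrite -H1; ring.
by rewrite -poly_seriesM mulrC Eab poly_seriesM -H2; ring.
Qed.

Lemma expands_rel : ring_rel expands.
Proof.
split.
- by exists 0, 1; rewrite oner_eq0 tofrac0 mul0r poly_series0 rmorph0 mulr0.
- by exists 1, 1; rewrite oner_eq0 tofrac1 divr1 poly_series1 rmorph1 mulr1.
- move=> f g [a [b [nz -> H]]]; exists (- a), b; split=> //.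
    by rewrite tofracN mulNr.
  by rewrite rmorphN mulrN H poly_seriesN.
- move=> f1 g1 f2 g2 [a1 [b1 [nz1 -> H1]]] [a2 [b2 [nz2 -> H2]]].
  exists (a1 * b2 + a2 * b1), (b1 * b2); rewrite mulf_neq0 //; split=> //.
    by rewrite addf_div ?tofrac_eq0 // tofracD !tofracM.
  by rewrite rmorphD poly_seriesD !poly_seriesM -H1 -H2; ring.
- move=> f1 g1 f2 g2 [a1 [b1 [nz1 -> H1]]] [a2 [b2 [nz2 -> H2]]].
  exists (a1 * a2), (b1 * b2); rewrite mulf_neq0 //; split=> //.
    by rewrite mulf_div !tofracM.
  by rewrite rmorphM !poly_seriesM -H1 -H2; ring.
Qed.

Lemma expands_inv f g h : expands f g -> g * h = 1 -> f != 0 /\ expands f^-1 h.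
Proof.
move=> [a [b [nz -> H]]] gh.
have nza : a != 0.
  apply/eqP => a0; move: H; rewrite a0 poly_series0 => H.
  case/eqP: nz; apply: poly_series_eq0.
  rewrite -[LHS]mulr1 -(rmorph1 fps_ratr) -gh rmorphM mulrA H.
  exact: mul0r.
split; first by rewrite mulf_neq0 ?invr_eq0 ?tofrac_eq0.
exists b, a; split=> //; first by rewrite invf_div.
by rewrite -H -mulrA -(rmorphM fps_ratr) gh rmorph1 mulr1.
Qed.

Lemma expands_q12 : expands (q12 K) (q12_series rat).
Proof.
exists 'X, 1; rewrite oner_eq0 poly_seriesX poly_series1 mul1r fps_ratr_q12.
by rewrite tofrac1 divr1.
Qed.

End Ratr.

(** * The binomial series of q^(1/2) *)

Section BinomialSeries.
Local Notation S := (fps rat).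

Definition fps_deriv (f : S) : S := Fps (fun i => i.+1%:R * f i.+1).

Lemma fps_derivM f g : fps_deriv (f * g) = fps_deriv f * g + f * fps_deriv g.
Proof.
apply: fpsP => i; rewrite fps_coefD -[LHS]/(i.+1%:R * (f * g) i.+1) !fps_coefM.
rewrite mulr_sumr.
transitivity (\sum_(j < i.+2) (j%:R * f j * g (i.+1 - j)%N)
   + \sum_(j < i.+2) (f j * ((i.+1 - j)%:R * g (i.+1 - j)%N))).
  rewrite -big_split; apply: eq_bigr => j _ /=.
  have le_ji : (j <= i.+1)%N by rewrite -ltnS ltn_ord.
  rewrite (natrB _ le_ji); move: (f j) (g _) (i.+1%:R : rat) (j%:R : rat) => u v x y.
  by ring.
congr (_ + _).
  by rewrite big_ord_recl !mul0r add0r; apply: eq_bigr => j _.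
rewrite big_ord_recr /= subnn mul0r mulr0 addr0; apply: eq_bigr => j _ /=.
by rewrite subSn // -ltnS ltn_ord.
Qed.

Lemma q12_series_ode :
  (1 + fps_X) * fps_deriv (q12_series rat) = fps_cst 4%:R^-1 * q12_series rat.
Proof.
have recE i : i.+1%:R * q12_series rat i.+1 = (4%:R^-1 - i%:R) * q12_series rat i.
  rewrite /= big_ord_recr /= factS natrM.
  have nz1 : (i.+1%:R : rat) != 0 by rewrite Num.Theory.pnatr_eq0.
  have nz2 : (i`!%:R : rat) != 0 by rewrite Num.Theory.pnatr_eq0 -lt0n fact_gt0.
  move: (\prod_(_ < i) _) (i.+1%:R : rat) (i`!%:R : rat) nz1 nz2 (_ - _) => u v w nz1 nz2 t.
  by field; rewrite nz1 nz2.
apply: fpsP => i; rewrite mulrDl mul1r fps_coefD fps_coefCM fps_coefXM.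
rewrite -[X in X + _]/(i.+1%:R * q12_series rat i.+1) recE.
case: i => [|i]; first by rewrite subr0 addr0.
rewrite -[X in _ + X]/(i.+1%:R * q12_series rat i.+1); ring.
Qed.

(** The fourth power f of a solution of (1 + z) s' = s / 4 satisfies (1 + z) f' = f. This determines
    f from its constant term 1: the coefficient of z is 1 and the recursion makes all later ones
    0. *)
Lemma q12_series4 : q12_series rat ^+ 4 = 1 + fps_X.
Proof.
set s := q12_series rat; set f := s ^+ 4.
have ode : (1 + fps_X) * fps_deriv f = f.
  have -> : fps_deriv f = 4%:R * s ^+ 3 * fps_deriv s.
    by rewrite /f !exprS expr0 mulr1 !fps_derivM; ring.
  transitivity (4%:R * s ^+ 3 * ((1 + fps_X) * fps_deriv s)); first by ring.
  rewrite q12_series_ode -/s.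
  transitivity (4%:R * fps_cst 4%:R^-1 * s ^+ 4); first by ring.
  rewrite -(rmorph_nat (@fps_cst rat)) -rmorphM mulfV ?rmorph1 ?mul1r //.
have rec i : i.+2%:R * f i.+2 = (1 - i.+1%:R) * f i.+1.
  have := congr1 (fun h : S => h i.+1) ode.
  rewrite mulrDl mul1r fps_coefD fps_coefXM.
  rewrite -[X in X + _]/(i.+2%:R * f i.+2) -[X in _ + X]/(i.+1%:R * f i.+1).
  by move=> E; rewrite mulrBl mul1r -[X in _ = X - _]E addrK.
have f0 : f 0%N = 1.
  apply: etrans (rmorphXn (@fps_at0 rat) 4 s) _.
  by apply: etrans (congr1 (fun x => x ^+ 4) (q12_series_at0 rat)) _; apply: expr1n.
have f1 : f 1%N = 1.
  have := congr1 (fun h : S => h 0%N) ode.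
  rewrite mulrDl mul1r fps_coefD fps_coefXM addr0.
  by rewrite -[LHS]/(1%:R * f 1%N) mul1r f0.
have f2 i : f i.+2 = 0.
  elim: i => [|i IH]; last first.
    by have/eqP := rec i.+1; rewrite IH mulr0 mulf_eq0 Num.Theory.pnatr_eq0 => /eqP.
  by have/eqP := rec 0%N; rewrite subrr mul0r mulf_eq0 Num.Theory.pnatr_eq0 => /eqP.
have XE i : (fps_X : S) i = (i == 1%N)%:R by [].
apply: fpsP => -[|[|i]].
- by rewrite f0 fps_coefD fps_coef1 XE addr0.
- by rewrite f1 fps_coefD fps_coef1 XE add0r.
- by rewrite f2 fps_coefD fps_coef1 XE addr0.
Qed.

End BinomialSeries.

Lemma tau_ord : fps_ord 1 (qpow 1 - 1).
Proof. by move=> [|//] _; rewrite fps_coefB fps_coef1 qpow_at0 subrr. Qed.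

(* The substitution z := q_eps - 1 *)
Definition tau : {rmorphism fps rat -> fps Qe} :=
  fps_subst_morph (@fps_cst Qe \o ratr_morph char_Qe) tau_ord
    (fun g => mulrC (qpow 1 - 1) g).

Lemma tau_at0 g : tau g 0%N = ratr_morph char_Qe (g 0%N).
Proof.
rewrite -[LHS]/(fps_subst _ _ g 0%N) (fps_subst_coef _ tau_ord _ (ltnSn 0)).
by rewrite big_ord1 mulr1.
Qed.

Lemma tau_X : tau fps_X = qpow 1 - 1.
Proof. exact: fps_subst_X _ tau_ord. Qed.

(** Both sides have constant term 1 and fourth power q_eps. *)
Lemma tau_q12 : tau (q12_series rat) = qpow 4^-1.
Proof.
have nz4 : (4 : Qe) != 0 := four_neq0 char_Qe.
apply: (@fps_at0_unit_inj _ _ _ 3 nz4).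
- by rewrite tau_at0 q12_series_at0 rmorph1.
- exact: qpow_at0.
apply: etrans (esym (rmorphXn tau 4 _)) _; rewrite q12_series4 rmorphD rmorph1.
apply: etrans (congr1 (fun z => 1 + z) tau_X) _; rewrite addrC subrK.
rewrite -qpowMn; congr qpow.
exact: esym (etrans (esym (mulr_natr 4^-1 4)) (mulVf nz4)).
Qed.

Lemma q_number_sum (F : fieldType) (x : F) p : x != 0 -> x - x^-1 != 0 ->
  (x ^+ p - x ^- p) / (x - x^-1) = \sum_(i < p) (x ^+ p * x^-1 * x ^- (2 * i)).
Proof.
move=> xz nz; apply: (mulIf nz); rewrite mulfVK // mulr_suml.
pose u i := - (x ^+ p * x * x ^- (2 * i)) * x^-1.
rewrite (eq_bigr (fun i : 'I_p => u i.+1 - u i)); last first.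
  move=> i _; rewrite /u mulnS exprD expr2.
  have := expf_neq0 (2 * i) xz; move: (x ^+ (2 * i)) (x ^+ p) => y v yz.
  by field; rewrite xz yz.
rewrite -(big_mkord xpredT (fun i => u i.+1 - u i)) telescope_sumr // /u.
rewrite muln0 expr0 invr1 mulr1 mul2n -addnn exprD.
have := expf_neq0 p xz; move: (x ^+ p) => y yz; by field; rewrite xz yz.
Qed.

(** * From k(q^(1/2)) to series in h *)

Section Relation.
Variable K : fieldType.
Hypothesis charK : [pchar K] =i pred0.

(** The graph of the specialization q^2 := q_eps. It is a relation and not a map because elements
    with a pole at q^(1/2) = 1, or without a rational expansion, have no value. *)
Definition kq_rel (f : kq K) (s : fps Qe) : Prop :=
  exists2 g, expands charK f g & tau g = s.

Lemma kq_rel_ring : ring_rel kq_rel.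
Proof.
have er := expands_rel charK; split.
- by exists 0; [apply: ring_rel0 er | rewrite rmorph0].
- by exists 1; [apply: ring_rel1 er | rewrite rmorph1].
- by move=> f s [g fg <-]; exists (- g); [apply: ring_relN er _ _ fg | rewrite rmorphN].
- move=> f s f' s' [g fg <-] [g' fg' <-]; exists (g + g'); last by rewrite rmorphD.
  exact: ring_relD er _ _ _ _ fg fg'.
- move=> f s f' s' [g fg <-] [g' fg' <-]; exists (g * g'); last by rewrite rmorphM.
  exact: ring_relM er _ _ _ _ fg fg'.
Qed.

Lemma kq_rel_inv f s t : kq_rel f s -> s * t = 1 -> f != 0 /\ kq_rel f^-1 t.
Proof.
move=> [g fg <-] gt; have g0 : g 0%N != 0.
  apply/eqP => g0; have := congr1 (fun h : fps Qe => h 0%N) gt.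
  rewrite fps_coefM big_ord1 tau_at0 g0 rmorph0 mul0r => /eqP.
  by rewrite eq_sym oner_eq0.
have gK := fps_invK g0; have [nf fg'] := expands_inv fg gK.
split=> //; exists (fps_inv g) => //.
have E := etrans (esym (rmorphM tau g (fps_inv g))) (etrans (congr1 tau gK) (rmorph1 tau)).
by rewrite -[t]mul1r -E -[tau g * _]mulrC -mulrA gt mulr1.
Qed.

Lemma kq_rel_neq0 f s : kq_rel f s -> s <> 0 -> f != 0.
Proof.
move=> [g fg Eg] nz; apply/eqP => f0; case: nz.
have := expands_inj fg; rewrite f0 => /(_ 0 (ring_rel0 (expands_rel charK))) g0.
by rewrite -Eg g0 rmorph0.
Qed.

Lemma kq_rel_q12 : kq_rel (q12 K) (qpow 4^-1).
Proof. by exists (q12_series rat); [apply: expands_q12 | apply: tau_q12]. Qed.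

Lemma q12_neq0 : q12 K != 0.
Proof. by rewrite /q12 tofrac_eq0 polyX_eq0. Qed.

Lemma kq_rel_q12z (z : int) : kq_rel (q12 K ^ z) (qpow (z%:~R / 4)).
Proof.
have posP p : kq_rel (q12 K ^+ p) (qpow (p%:R / 4)).
  rewrite mulr_natl qpowMn; by apply: (ring_relX kq_rel_ring); apply: kq_rel_q12.
case: z => p; first by rewrite -pmulrn -exprnP; apply: posP.
rewrite NegzE -exprnN mulrNz mulNr -pmulrn.
by have [] := kq_rel_inv (posP p.+1) (qpowN _).
Qed.

Lemma kq_rel_qz (z : int) : kq_rel (q K ^ z) (qpow (z%:~R / 2)).
Proof.
have -> : q K ^ z = q12 K ^ (2 * z) by rewrite /q exprnP exprz_exp.
have -> : z%:~R / 2 = (2 * z)%:~R / 4 :> Qe.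
  have nz2 := two_neq0; have nz4 : (4 : Qe) != 0 := four_neq0 char_Qe.
  have E2 : (2 * z)%:~R = 2 * z%:~R :> Qe := intrM _ 2 z.
  apply: esym; apply: etrans (congr1 (fun x => x / 4) E2) _.
  have E4 : 2^-1 = 2 * 4^-1 :> Qe.
    apply: (mulfI nz2); apply: etrans (mulfV nz2) _.
    by apply: esym; apply: etrans (mulrA 2 2 _) _; rewrite -natrM; apply: (mulfV nz4).
  apply: etrans _ (congr1 (fun x => z%:~R * x) (esym E4)).
  by rewrite mulrA [2 * _]mulrC.
exact: kq_rel_q12z.
Qed.

Lemma kq_rel_qn p : kq_rel (q K ^+ p) (qpow (p%:R / 2)).
Proof. by have := kq_rel_qz p; rewrite -pmulrn -exprnP. Qed.

Lemma kq_rel_qnV p : kq_rel (q K ^- p) (qpow (- (p%:R / 2))).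
Proof. by have [] := kq_rel_inv (kq_rel_qn p) (qpowN _). Qed.

Lemma kq_rel_qdiff : kq_rel (q K - (q K)^-1) qdiff.
Proof.
have := kq_rel_qn 1; have := kq_rel_qnV 1; rewrite expr1 mul1r => rV r1.
exact: (ring_relB kq_rel_ring) r1 rV.
Qed.

Lemma q_sub_inv_neq0 : q K - (q K)^-1 != 0.
Proof. exact: kq_rel_neq0 kq_rel_qdiff qdiff_neq0. Qed.

Lemma q_neq0 : q K != 0.
Proof. by rewrite expf_neq0 // q12_neq0. Qed.

Lemma qnum_sum p : qnum K p = \sum_(i < p) (q K ^+ p * (q K)^-1 * q K ^- (2 * i)).
Proof. exact: q_number_sum q_neq0 q_sub_inv_neq0. Qed.

(** The quotient has to be turned into a sum first: the image of q - q^-1 has constant term 0, so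
    that [kq_rel_inv] does not apply to it. *)
Lemma kq_rel_qnum p : kq_rel (qnum K p) (qint p).
Proof.
rewrite qnum_sum; apply: (ring_rel_sum kq_rel_ring) => i _.
have nz := two_neq0.
have -> : (p%:R - 1) / 2 - i%:R = p%:R / 2 + - (1%:R / 2) + - ((2 * i)%:R / 2) :> Qe.
  by rewrite natrM; field.
rewrite !qpowD; apply: ring_relM kq_rel_ring _ _ _ _ _ (kq_rel_qnV _).
apply: ring_relM kq_rel_ring _ _ _ _ (kq_rel_qn _) _.
by have := kq_rel_qnV 1; rewrite expr1.
Qed.

Definition qfac (p : nat) : fps Qe := \prod_(1 <= i < p.+1) qint i.

Lemma qint_at0 p : qint p 0%N = p%:R.
Proof.
rewrite /qint fps_coef_sum (eq_bigr (fun=> 1)) => [|i _]; last exact: qpow_at0.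
by rewrite sumr_const card_ord.
Qed.

Lemma qfac_at0 p : qfac p 0%N != 0.
Proof.
rewrite -[qfac p 0%N]/(fps_at0 (qfac p)) rmorph_prod big_nat prodf_seq_neq0.
apply/allP => i; rewrite mem_index_iota => /andP[ltpi lti]; apply/implyP => _.
rewrite [X in X != 0]qint_at0; case: i ltpi {lti} => // i _.
exact: natf_neq0_char0 char_Qe i.
Qed.

Lemma kq_rel_qfact p : kq_rel (qfact K p) (qfac p).
Proof. by apply: (ring_rel_prod kq_rel_ring) => i _; apply: kq_rel_qnum. Qed.

Lemma kq_rel_qfactV p : kq_rel (qfact K p)^-1 (fps_inv (qfac p)).
Proof. by have [] := kq_rel_inv (kq_rel_qfact p) (fps_invK (qfac_at0 p)). Qed.

End Relation.

Lemma fps_invE (K : fieldType) (f g : fps K) : f * g = 1 -> fps_inv f = g.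
Proof.
move=> fg; have f0 : f 0%N != 0.
  apply/eqP => f0; have := congr1 (fun h : fps K => h 0%N) fg.
  by rewrite fps_coefM big_ord1 f0 mul0r => /eqP; rewrite eq_sym oner_eq0.
by rewrite -[LHS]mulr1 -fg mulrA [fps_inv f * f]mulrC fps_invK // mul1r.
Qed.

Lemma fps_sum_mull (R : nzRingType) (c : fps R) (u : nat -> fps R) :
  (forall k, fps_ord k (u k)) ->
  fps_sum 0 (fun k => c * u k) = c * fps_sum 0 u.
Proof.
move=> ordu; apply: fps_eqmod_all => N.
have ordc k : fps_ord k (c * u k) by apply: fps_ordMl.
have/fps_eqmodP E1 := @fps_sum_eqmod _ 0 _ N ordc.
have/fps_eqmodP E2 : fps_eqmod N (c * fps_sum 0 u) (c * \sum_(0 <= k < N) u k).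
  by apply: fps_eqmodM; [apply/fps_eqmodP | apply: fps_sum_eqmod].
by apply/fps_eqmodP => i lti; rewrite E1 // E2 // mulr_sumr.
Qed.

Lemma fps_sum_finite (R : nzRingType) n (u : nat -> fps R) :
  (forall k, fps_ord k (u k)) -> (forall k, (n <= k)%N -> u k = 0) ->
  fps_sum 0 u = \sum_(0 <= k < n) u k.
Proof.
move=> ordu u0; apply: fpsP => N; rewrite fps_coef_sum.
rewrite -[LHS]/(\sum_(0 <= k < N.+1) u k N) !big_mkord.
have sum_max l : (forall k, (l <= k)%N -> u k N = 0) ->
    \sum_(k < l) u k N = \sum_(k < maxn l (maxn N.+1 n)) u k N.
  move=> z; rewrite [LHS](big_ord_widen (maxn l (maxn N.+1 n)) (fun k => u k N)) ?leq_maxl //.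
  by rewrite big_mkcond; apply: eq_bigr => k _; case: ltnP => // /z.
rewrite (sum_max N.+1) => [|k ltNk]; last exact: ordu.
rewrite (sum_max n) => [|k /u0 -> //].
by rewrite maxnA maxnn [maxn n _]maxnCA maxnn.
Qed.

Lemma qe_numE p : qe_num p = qpow ((p%:R - 1) / 2) * qint p.
Proof.
have nz := two_neq0; rewrite /qe_num /qint mulr_sumr (reindex_inj rev_ord_inj).
apply: eq_bigr => i _; rewrite -(qpowD ((p%:R - 1) / 2)) q_epsE -(qpowMn 1).
congr qpow; rewrite /= natrB ?ltn_ord // -natr1.
by move: (i%:R : Qe) (p%:R : Qe) => x y; field.
Qed.

Lemma bin2S p : 'C(p.+1, 2) = ('C(p, 2) + p)%N.
Proof. by rewrite binS bin1. Qed.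

Lemma qe_factE p : qe_fact p = qpow ('C(p, 2)%:R / 2) * qfac p.
Proof.
have nz := two_neq0; rewrite /qe_fact /qfac; elim: p => [|p IH].
  by rewrite !big_geq // mul0r qpow0 mulr1.
rewrite !(big_nat_recr p.+1) //= IH qe_numE.
have -> : 'C(p.+1, 2)%:R / 2 = 'C(p, 2)%:R / 2 + (p.+1%:R - 1) / 2 :> Qe.
  by rewrite bin2S natrD -[p.+1%:R]natr1; move: ('C(p, 2)%:R : Qe) (p%:R : Qe) => x y; field.
rewrite (qpowD ('C(p, 2)%:R / 2)).
move: (qpow _) (qpow _) (\prod_(_ <= _ < _) _) (qint _) => u v w x; ring.
Qed.

Lemma qe_fact_inv p r : fps_inv (qe_fact p * r`!%:R) =
  qpow (- ('C(p, 2)%:R / 2)) * fps_inv (qfac p) * fps_cst (r`!%:R^-1).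
Proof.
apply: fps_invE; rewrite qe_factE.
have E1 := qpowN ('C(p, 2)%:R / 2); have E2 := fps_invK (qfac_at0 p).
have E3 : (r`!%:R : fps Qe) * fps_cst (r`!%:R^-1) = 1.
  rewrite -(rmorph_nat (@fps_cst Qe)) -(rmorphM (@fps_cst Qe)) mulfV ?rmorph1 //.
  exact: factf_neq0 char_Qe r.
move: (qpow _) (qpow _) (qfac p) (fps_inv _) (r`!%:R) (fps_cst _) E1 E2 E3.
move=> a b c d e f E1 E2 E3.
transitivity ((b * a) * (c * d) * (e * f)); first by ring.
by rewrite E1 E2 E3 !mulr1.
Qed.

(** * The R-matrix of D on the module *)

Section RMatrix.
Variable m : nat.
Local Notation n := m.+1.
Local Notation S := (fps Qe).
Local Notation rep := (rep (@gens m)).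
Local Notation half_wt := (half_wt m).

Lemma y_mx_pow_neq0 p (i k : 'I_n) : (y_mx m ^+ p) i k != 0 -> k = (i + p)%N :> nat.
Proof.
elim: p i k => [|p IH] i k.
  by rewrite expr0 mxE; case: (i =P k) => [->|_]; rewrite ?addn0 // mulr0n eqxx.
rewrite exprS mxE => nz; apply/eqP; apply: contraNT nz => nk.
rewrite big1 // => l _; have [->|/y_mx_neq0 El] := eqVneq (y_mx m i l) 0.
  by rewrite mul0r.
have [->|/IH Ek] := eqVneq ((y_mx m ^+ p) l k) 0; first by rewrite mulr0.
by rewrite Ek El addSnnS eqxx in nk.
Qed.

Lemma f_mx_neq0 (i j : 'I_n) : f_mx m i j != 0 -> i = j.+1 :> nat.
Proof. by rewrite mxE; case: (nat_of_ord i =P j.+1) => // _; rewrite mulr0n eqxx. Qed.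

Lemma f_mx_pow_neq0 p (j l : 'I_n) : (f_mx m ^+ p) j l != 0 -> j = (l + p)%N :> nat.
Proof.
elim: p j l => [|p IH] j l.
  by rewrite expr0 mxE; case: (j =P l) => [->|_]; rewrite ?addn0 // mulr0n eqxx.
rewrite exprS mxE => nz; apply/eqP; apply: contraNT nz => nk.
rewrite big1 // => k _; have [->|/f_mx_neq0 Ej] := eqVneq (f_mx m j k) 0.
  by rewrite mul0r.
have [->|/IH Ek] := eqVneq ((f_mx m ^+ p) k l) 0; first by rewrite mulr0.
by rewrite Ej Ek addnS eqxx in nk.
Qed.

Lemma x_mxE (j l : 'I_n) : x_mx m j l = qquot * qpow (half_wt j) * f_mx m j l.
Proof. exact: mul_dgmx. Qed.

(** The p factors K of (K F)^p are collected on the left. Each F shifts the half weight by 1, so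
    that the exponents half_wt j + t for t < p add up to the one shown. *)
Lemma x_mx_pow p (j l : 'I_n) : (x_mx m ^+ p) j l =
  qquot ^+ p * qpow (p%:R * half_wt j + 'C(p, 2)%:R) * (f_mx m ^+ p) j l.
Proof.
elim: p j l => [|p IH] j l.
  by rewrite !expr0 mul0r bin0n addr0 qpow0 !mul1r.
rewrite (exprS (x_mx m)) (exprS (f_mx m)) [LHS]mxE [X in _ = _ * X]mxE mulr_sumr.
apply: eq_bigr => k _; apply: etrans (congr2 *%R (x_mxE j k) (IH k l)) _.
move: ((f_mx m ^+ p) k l) => z.
have [->|nz] := eqVneq (f_mx m j k) 0; first by rewrite mulr0 !mul0r mulr0.
have Ek : half_wt k = half_wt j + 1.
  by rewrite /half_wt (f_mx_neq0 nz) -[(_.+1)%:R]natr1; ring.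
have E : qpow (p.+1%:R * half_wt j + 'C(p.+1, 2)%:R) =
    qpow (half_wt j) * qpow (p%:R * half_wt k + 'C(p, 2)%:R).
  rewrite -(qpowD (half_wt j)); congr qpow.
  by rewrite Ek bin2S natrD -[p.+1%:R]natr1; ring.
rewrite E (exprS qquot); move: (qpow _) (qpow _) (qquot) (f_mx m j k).
by move=> u v w x; ring.
Qed.

Definition R_coef p : S :=
  qdiff ^+ p * fps_inv (qfac p) * qpow ('C(p, 2)%:R / 2).

Definition R_hat_entry (i j k l : 'I_n) : S :=
  \sum_(0 <= p < n) R_coef p * qpow (half_wt i * half_wt j)
     * ((y_mx m ^+ p) i k * (f_mx m ^+ p) j l).

(** The R-matrix of U_q(sl_2) on V_(n-1), with q^(1/2) replaced by q_eps^(1/4). *)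
Definition R_hat : 'M[S]_(n * n) :=
  \matrix_(a, b) let: (i, j) := mxtens_unindex a in
                 let: (k, l) := mxtens_unindex b in R_hat_entry i j k l.

Lemma rep_D_R_term1 p r i k : rep (D_R_term p r).1 i k =
  fps_X ^+ (p + r) * fps_inv (qe_fact p * r`!%:R)
    * ((y_mx m ^+ p) i k * fps_cst (b_wt m k) ^+ r).
Proof.
set c := fps_X ^+ (p + r) * _.
have E : rep (D_R_term p r).1 = c *: (y_mx m ^+ p *m dg (fun i : 'I_n => fps_cst (b_wt m i) ^+ r)).
  apply: etrans (congr1 rep (esym (mulrA (scal c) (y_ ^+ p) (b_ ^+ r)))) _.
  apply: etrans (rep_scalM _ _ (y_ ^+ p * b_ ^+ r)) _; congr (c *: _).
  apply: etrans (repM _ (y_ ^+ p) (b_ ^+ r)) _.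
  apply: etrans (congr2 *%R (etrans (repXn _ y_ p) (congr1 (fun M => M ^+ p) (rep_y m)))
    (etrans (repXn _ b_ r) (congr1 (fun M => M ^+ r) (rep_b m)))) _.
  exact: congr1 (dgX _ _).
by apply: etrans (congr1 (fun M : 'M[S]_n => M i k) E) _; rewrite mxE mul_mxdg.
Qed.

Lemma rep_D_R_term2 p r j l : rep (D_R_term p r).2 j l =
  fps_cst (a_wt j) ^+ r * (x_mx m ^+ p) j l.
Proof.
have E : rep (D_R_term p r).2 = dg (fun i : 'I_n => fps_cst (a_wt i) ^+ r) *m x_mx m ^+ p.
  apply: etrans (repM _ (a_ ^+ r) (x_ ^+ p)) _.
  apply: etrans (congr2 *%R (etrans (repXn _ a_ r) (congr1 (fun M => M ^+ r) (rep_a m)))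
    (etrans (repXn _ x_ p) (congr1 (fun M => M ^+ p) (rep_x m)))) _.
  exact: (congr1 (fun M : 'M[S]_n => M *m x_mx m ^+ p) (dgX (fun i : 'I_n => fps_cst (a_wt i)) r)).
by apply: etrans (congr1 (fun M : 'M[S]_n => M j l) E) _; rewrite mul_dgmx.
Qed.

End RMatrix.

Local Opaque y_mx x_mx f_mx.

Section RMatrix2.
Variable m : nat.
Local Notation n := m.+1.
Local Notation S := (fps Qe).
Local Notation rep := (rep (@gens m)).
Local Notation half_wt := (half_wt m).

Definition R_head (i j k l : 'I_n) p : S :=
  fps_X ^+ p * (qpow (- ('C(p, 2)%:R / 2)) * fps_inv (qfac p))
    * ((y_mx m ^+ p) i k * (x_mx m ^+ p) j l).

Fact R_entry_arith (A : comPzRingType) (xp xr c d e y a b x : A) :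
  xp * xr * (c * d * e) * (y * b) * (a * x) =
  xp * (c * d) * (y * x) * (e * (b * a * xr)).
Proof. ring. Qed.

Lemma R_entryE (i j k l : 'I_n) p r : R_entry rep i j k l p r =
  R_head i j k l p
    * (fps_cst (r`!%:R^-1) * (fps_cst (b_wt m k * a_wt j) * fps_X) ^+ r).
Proof.
apply: etrans (congr2 *%R (rep_D_R_term1 p r i k) (rep_D_R_term2 p r j l)) _.
rewrite (qe_fact_inv p r) /R_head (rmorphM (@fps_cst Qe) (b_wt m k)) !exprMn (exprD fps_X).
exact: R_entry_arith.
Qed.

(** The sum over r is e^(h b (x) a) at the weights: in y^p b^r (x) a^r x^p, b acts on the incoming
    v_k of the first slot and a on the outgoing v_j of the second. *)
Lemma R_head_sum (i j k l : 'I_n) p :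
  fps_sum 0 (R_entry rep i j k l p) = R_head i j k l p * expc (b_wt m k * a_wt j).
Proof.
rewrite -fexp_X -fps_sum_mull; last first.
  move=> r; apply: fps_ordMl; rewrite exprMn; apply: fps_ordMl => s lts.
  by rewrite fps_coefXn ltn_eqF.
by congr (fps_sum 0 _); apply: funext => r; apply: R_entryE.
Qed.

(** The excess of the exponent in the R-matrix of D over that in [R_hat]. The quadratic terms have
    cancelled; being affine in j and k, it splits into a factor on the output of the second slot,
    one on the input of the first, and a scalar. *)
Definition gauge_exp (j k : nat) : Qe :=
  n%:R / 2 * k%:R - n%:R / 2 * j%:R - (n%:R / 2) * (n%:R / 2).

Fact R_head_hat_arith (i j k : 'I_n) p (yik z : S) :
  (yik <> 0 -> k%:R = i%:R + p%:R :> Qe) ->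
  fps_X ^+ p * (qpow (- ('C(p, 2)%:R / 2)) * fps_inv (qfac p))
    * (yik * (qquot ^+ p * qpow (p%:R * half_wt j + 'C(p, 2)%:R) * z))
    * expc (b_wt m k * a_wt j) =
  qpow (gauge_exp j k) * (R_coef p * qpow (half_wt i * half_wt j) * (yik * z)).
Proof.
move=> Ek; rewrite /R_coef.
have [->|/eqP/Ek{}Ek] := eqVneq yik 0; first by rewrite !(mul0r, mulr0).
have E : qpow (- ('C(p, 2)%:R / 2)) * qpow (p%:R * half_wt j + 'C(p, 2)%:R)
     * expc (b_wt m k * a_wt j)
   = qpow (gauge_exp j k) * qpow ('C(p, 2)%:R / 2) * qpow (half_wt i * half_wt j).
  rewrite /b_wt -(mulrA eps) -/(qpow _).
  rewrite -(qpowD (- _)) -(qpowD (_ + _)) -(qpowD (gauge_exp j k)) -(qpowD (_ + _)).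
  congr qpow; rewrite /gauge_exp /half_wt /a_wt Ek; have t := two_neq0.
  move: (i%:R : Qe) (j%:R : Qe) (p%:R : Qe) (n%:R : Qe) ('C(p, 2)%:R : Qe).
  by move=> a b c d e; field.
rewrite -qquotE exprMn.
move: (qpow _) (qpow _) (expc _) (qpow _) (qpow _) (qpow _) E => a b c d e f E.
move: (fps_X ^+ p : S) (fps_inv _ : S) (qquot ^+ p : S) => g h u; move: yik Ek => v _.
transitivity ((f * e * c) * (g * h * u * v * z)); first by ring.
by rewrite E; ring.
Qed.

Lemma R_head_hat (i j k l : 'I_n) p :
  R_head i j k l p * expc (b_wt m k * a_wt j) =
  qpow (gauge_exp j k) * (R_coef p * qpow (half_wt i * half_wt j)
     * ((y_mx m ^+ p) i k * (f_mx m ^+ p) j l)).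
Proof.
apply: etrans (congr1 (fun z : S => fps_X ^+ p * (qpow (- ('C(p, 2)%:R / 2))
  * fps_inv (qfac p)) * ((y_mx m ^+ p) i k * z) * _) (x_mx_pow p j l)) _.
by apply: R_head_hat_arith => /eqP nz; rewrite (y_mx_pow_neq0 nz) natrD.
Qed.

Lemma R_mx_entry (i j k l : 'I_n) :
  fps_sum2 (R_entry rep i j k l) = qpow (gauge_exp j k) * R_hat_entry i j k l.
Proof.
transitivity (fps_sum 0 (fun p => R_head i j k l p * expc (b_wt m k * a_wt j))).
  by congr (fps_sum 0 _); apply: funext => p; apply: R_head_sum.
rewrite (@fps_sum_finite _ n).
- by rewrite mulr_sumr; apply: eq_bigr => p _; apply: R_head_hat.
- move=> p; apply/fps_ordMr/fps_ordMr/fps_ordMr => s lts.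
  by rewrite fps_coefXn ltn_eqF.
move=> p lenp; have [Ey|/y_mx_pow_neq0 E] := eqVneq ((y_mx m ^+ p) i k) 0.
  apply: etrans (congr1 (fun z : S => _ * (z * _) * _) Ey) _.
  by rewrite mul0r mulr0 mul0r.
by have := ltn_ord k; rewrite E ltnNge (leq_trans lenp) // leq_addl.
Qed.

(** Up to a scalar, the action of T^(z a / 2). *)
Definition gauge (z : int) : 'M[S]_n := dg (fun p => qpow (z%:~R * (n%:R / 2 * (p : nat)%:R))).

Lemma gauge0 : gauge 0 = 1.
Proof.
apply: etrans (dg_scalar _ 1); apply: eq_dg => p.
by rewrite mul0r qpow0.
Qed.

Lemma gaugeD i j : gauge (i + j) = gauge i * gauge j.
Proof.
rewrite /gauge -mulmxE dgM; apply: eq_dg => p.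
by rewrite -(qpowD (i%:~R * _)) -mulrDl rmorphD.
Qed.

Lemma dgC (d e : 'I_n -> S) : dg d * dg e = dg e * dg d.
Proof. by rewrite -mulmxE !dgM; apply: eq_dg => p; rewrite mulrC. Qed.

Lemma tens_dg (d e : 'I_n -> S) : dg d *t dg e =
  diag_mx (\row_a (d (mxtens_unindex a).1 * e (mxtens_unindex a).2)).
Proof.
apply/matrixP => a b; rewrite -(mxtens_unindexK a) -(mxtens_unindexK b).
case: (mxtens_unindex a) (mxtens_unindex b) => i j [k l].
rewrite tensmxE !mxE mxtens_indexK (can_eq (@mxtens_indexK _ _)) xpair_eqE /=.
by case: (i == k); case: (j == l); rewrite ?mulr0n ?mulr1n ?mulr0 ?mul0r.
Qed.

Lemma R_hatE a b : R_hat m a b = R_hat_entry (mxtens_unindex a).1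
  (mxtens_unindex a).2 (mxtens_unindex b).1 (mxtens_unindex b).2.
Proof. by rewrite mxE; case: (mxtens_unindex a) (mxtens_unindex b) => i j []. Qed.

Definition gauge_cst : S := qpow (- ((n%:R / 2) * (n%:R / 2))).

Lemma R_mx_gauge : R_mx rep =
  gauge_cst *: ((1 *t gauge (-1)) *m R_hat m *m (gauge 1 *t 1)).
Proof.
have one : (1 : 'M[S]_n) = dg (fun=> 1) by rewrite dg_scalar.
apply/matrixP => a b; rewrite [X in X *t gauge (- 1)]one [X in gauge 1 *t X]one !tens_dg.
rewrite mul_mx_diag mul_diag_mx !mxE; case: (mxtens_unindex a) => i j.
case: (mxtens_unindex b) => k l /=; rewrite R_mx_entry.
move: (R_hat_entry _ _ _ _) => r.
have -> : qpow (gauge_exp j k) = gauge_cst * qpow ((-1)%:~R * (n%:R / 2 * j%:R))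
    * qpow (1%:~R * (n%:R / 2 * k%:R)).
  rewrite -(qpowD (- _)) -(qpowD (_ + _)); congr qpow; rewrite /gauge_exp.
  by rewrite rmorphN rmorph1; move: (n%:R / 2) => x; ring.
by move: (qpow _) (qpow _) gauge_cst => u v w; ring.
Qed.

Fact gauge_R_hat_arith (z : int) (i j k l p : nat) (c yy ff : S) :
  (yy != 0 -> k = (i + p)%N) -> (ff != 0 -> j = (l + p)%N) ->
  qpow (z%:~R * (n%:R / 2 * i%:R)) * qpow (z%:~R * (n%:R / 2 * j%:R))
    * (c * (yy * ff)) =
  c * (yy * ff)
    * (qpow (z%:~R * (n%:R / 2 * k%:R)) * qpow (z%:~R * (n%:R / 2 * l%:R))).
Proof.
have [->|nzy] := eqVneq yy 0; first by rewrite !(mul0r, mulr0).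
have [->|nzf] := eqVneq ff 0; first by rewrite !(mul0r, mulr0).
move=> /(_ isT) -> /(_ isT) ->; rewrite [LHS]mulrC; congr (_ * _).
by rewrite -!(qpowD (z%:~R * _)) !natrD; congr qpow; ring.
Qed.

(** E^p (x) F^p preserves the sum of the indices: k = i + p and j = l + p give i + j = k + l. *)
Lemma gauge_R_hat z : (gauge z *t gauge z) *m R_hat m = R_hat m *m (gauge z *t gauge z).
Proof.
apply/matrixP => a b; rewrite !tens_dg mul_mx_diag mul_diag_mx.
rewrite [LHS]mxE [RHS]mxE !R_hatE !(mxE matrix_key); case: (mxtens_unindex a) => i j.
case: (mxtens_unindex b) => k l /=; rewrite /R_hat_entry mulr_sumr mulr_suml.
apply: eq_bigr => p _; apply: gauge_R_hat_arith.
  exact: y_mx_pow_neq0.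
exact: f_mx_pow_neq0.
Qed.

End RMatrix2.

Lemma inv_commute (A : pzRingType) (T X D : A) :
  T * X = 1 -> X * T = 1 -> D * T = T * D -> D * X = X * D.
Proof.
move=> TX XT DT; rewrite -[LHS]mul1r -XT -mulrA [T * _]mulrA -DT.
by rewrite -[D * T * X]mulrA TX mulr1.
Qed.

(** The inverse of R = L T M is M' Y L'. Since D commutes with Y and L' = D M' = M' D, this equals
    L' Y M', the form that [knot_mx_gauge] requires for the inverse. *)
Lemma gauge_inverse (A : pzRingType) (L L' M M' D T R X : A) :
  L * L' = 1 -> L' * L = 1 -> M * M' = 1 -> M' * M = 1 -> L' = D * M' ->
  L' = M' * D -> D * T = T * D -> R = L * T * M -> R * X = 1 -> X * R = 1 ->
  exists Y, [/\ T * Y = 1, Y * T = 1 & L' * Y * M' * R = 1].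
Proof.
move=> LK LV MK MV LD LD' DT ER RX XR.
have ET : T = L' * R * M'.
  by rewrite ER !mulrA LV mul1r -mulrA MK mulr1.
have TX : T * (M * X * L) = 1.
  rewrite ET !mulrA -[L' * R * M' * M]mulrA MV mulr1 -[L' * R * X]mulrA RX.
  by rewrite mulr1 LV.
have XT : M * X * L * T = 1.
  rewrite ET !mulrA -[M * X * L * L']mulrA LK mulr1 -[M * X * R]mulrA XR.
  by rewrite mulr1 MK.
exists (M * X * L); split=> //; move: (M * X * L) TX XT => Y TX XT.
have DY : D * Y = Y * D := inv_commute TX XT DT.
rewrite ER LD' -[M' * D * Y]mulrA DY -!mulrA [D * (M' * _)]mulrA -LD.
by rewrite [L' * (L * _)]mulrA LV mul1r [Y * (T * _)]mulrA XT mul1r MV.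
Qed.

(** * Removal of the gauge for 0-framed knots *)

Section KnotValue.
Variable m : nat.
Local Notation n := m.+1.
Local Notation S := (fps Qe).
Local Notation rep := (rep (@gens m)).

Lemma gaugeV i : gauge m i * gauge m (- i) = 1.
Proof. by rewrite -gaugeD subrr gauge0. Qed.

Lemma tens1 : (1 : 'M[S]_n) *t (1 : 'M[S]_n) = 1%:M.
Proof. exact: tens11. Qed.

Lemma tensMM (a b c d : 'M[S]_n) : (a *t b) *m (c *t d) = (a * c) *t (b * d).
Proof. exact: tensmx_mul. Qed.

Lemma rep_Z_D_knot_mx K : framing K = 0 -> exists Xhat,
  R_hat m *m Xhat = 1%:M /\
  rep (Z_D K) = knot_mx (R_hat m) Xhat (dg (fun i : 'I_n => qpow (half_wt m i)))
                  (dg (fun i : 'I_n => qpow (- half_wt m i))) K.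
Proof.
move=> fr0; have [X0 [RX XR]] := mx_inv_eqmod1 (R_mx_eqmod1 (@rep_ord _ (@gens m))).
pose g := gauge m; pose c := gauge_cst m; pose ci : S := qpow ((n%:R / 2) * (n%:R / 2)).
have cK : c * ci = 1 by rewrite mulrC; apply: qpowN.
pose L := (1 *t g (-1)) : 'M[S]_(n * n); pose L' := (1 *t g 1) : 'M[S]_(n * n).
pose M := (g 1 *t 1) : 'M[S]_(n * n); pose M' := (g (-1) *t 1) : 'M[S]_(n * n).
pose D := (g 1 *t g 1) : 'M[S]_(n * n).
have gK : g 1 * g (-1) = 1 by apply: gaugeV.
have gV : g (-1) * g 1 = 1 by apply: (gaugeV (-1)).
have ER := R_mx_gauge m; set R1 := L *m R_hat m *m M in ER.
have [Xhat [TX XT XR1]] : exists Xhat, [/\ R_hat m *m Xhat = 1%:M,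
    Xhat *m R_hat m = 1%:M & L' *m Xhat *m M' *m R1 = 1%:M].
  (* As [R_mx] is c times R1 and X0 is its inverse, c X0 is the inverse of R1. *)
  apply: (@gauge_inverse _ L L' M M' D (R_hat m) R1 (c *: X0)).
  - by apply: etrans (tensMM _ _ _ _) _; rewrite gV mulr1; apply: tens1.
  - by apply: etrans (tensMM _ _ _ _) _; rewrite gK mulr1; apply: tens1.
  - by apply: etrans (tensMM _ _ _ _) _; rewrite gK mulr1; apply: tens1.
  - by apply: etrans (tensMM _ _ _ _) _; rewrite gV mulr1; apply: tens1.
  - by apply/esym; apply: etrans (tensMM _ _ _ _) _; rewrite gK mulr1.
  - by apply/esym; apply: etrans (tensMM _ _ _ _) _; rewrite gV mul1r.
  - exact: gauge_R_hat.
  - by [].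
  - by rewrite -[LHS]/(R1 *m (c *: X0)) -scalemxAr scalemxAl -ER.
  - by rewrite -[LHS]/((c *: X0) *m R1) -scalemxAl scalemxAr -ER.
exists Xhat; split; first exact: TX.
have XR' : (ci *: (L' *m Xhat *m M')) *m R_mx rep = 1%:M.
  by rewrite ER -scalemxAl -scalemxAr scalerA [ci * _]mulrC cK scale1r XR1.
apply: etrans (rep_Z_D _ XR') _.
apply: etrans (congr2 (fun a b => knot_mx _ _ a b K) (rep_kappa m) (rep_kappainv m)) _.
apply: etrans (congr1 (fun R => knot_mx R _ _ _ K) ER) _.
have gT i : (g i *t g i) *m R_hat m = R_hat m *m (g i *t g i) by apply: gauge_R_hat.
have gX i : (g i *t g i) *m Xhat = Xhat *m (g i *t g i).
  exact: (inv_commute TX XT (gT i)).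
have gk d i : g i * dg d = dg d * g i by apply: dgC.
exact: (@knot_mx_gauge _ _ K g _ _ c ci (gauge0 m) (@gaugeD m) (gk _) (gk _) cK _ _ gT gX fr0).
Qed.

End KnotValue.

Local Transparent y_mx x_mx f_mx.

Lemma mx_rel_of_fun (C C' : Type) (r : C -> C' -> Prop) p q
    (f : 'I_p -> 'I_q -> C) (g : 'I_p -> 'I_q -> C') :
  (forall i j, r (f i j) (g i j)) -> mx_rel r (\matrix_(i, j) f i j) (\matrix_(i, j) g i j).
Proof. by move=> fg i j; rewrite !mxE. Qed.

(** * The colored Jones polynomial at q^2 = q_eps *)

Section ColoredJonesValue.
Variable F : fieldType.
Hypothesis charF : [pchar F] =i pred0.
Variable m : nat.
Local Notation n := m.+1.
Local Notation S := (fps Qe).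
Local Notation rel := (kq_rel charF).
Local Notation wt_mx := (dg (fun i : 'I_n => qpow (half_wt m i))).
Local Notation rr := (kq_rel_ring charF).

Lemma wt_half p : (wt n p)%:~R / 2 = half_wt m p :> Qe.
Proof.
rewrite /wt /half_wt !rmorphB /= -!pmulrn natrM; have nz := two_neq0.
by move: (p%:R : Qe) (n%:R : Qe) => x y; field.
Qed.

Lemma actK_rel : mx_rel rel (actK F n) wt_mx.
Proof.
apply: mx_rel_of_fun => i j; have [->|_] := eqVneq i j; last exact: (ring_rel0 rr).
apply: (ring_relMn rr); rewrite -wt_half; exact: kq_rel_qz.
Qed.

Lemma actE_rel : mx_rel rel (actE F n) (y_mx m).
Proof. by apply: mx_rel_of_fun => i j; apply/(ring_relMn rr)/kq_rel_qnum. Qed.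

Lemma actF_rel : mx_rel rel (actF F n) (f_mx m).
Proof. by apply: mx_rel_of_fun => i j; apply/(ring_relMn rr)/kq_rel_qnum. Qed.

Lemma actKV_rel : mx_rel rel (invmx (actK F n))
  (dg (fun i : 'I_n => qpow (- half_wt m i))).
Proof.
apply: (mx_rel_inv rr (@kq_rel_inv _ charF) actK_rel).
rewrite dgM; apply: etrans (dg_scalar _ 1); apply: eq_dg => i.
exact: qpowN.
Qed.

Definition Uq_R_coef p (i j : 'I_n) : kq F :=
  (q F - (q F)^-1) ^+ p / qfact F p * q F ^+ 'C(p, 2) * q12 F ^ (wt n i * wt n j).

Lemma delta_mulmxE (C : comNzRingType) (a i k : 'I_n) (A : 'M[C]_n) :
  (delta_mx a a * A) i k = A i k *+ (i == a).
Proof.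
rewrite -mulmxE mxE (bigD1 a) //= !mxE eqxx andbT big1 ?addr0 => [|l nla].
  by have [->|_] := eqVneq i a; rewrite ?mul1r ?mul0r.
by rewrite !mxE (negPf nla) andbF mul0r.
Qed.

Lemma Uq_Rmx_entry i j k l :
  Uq_Rmx F n (mxtens_index (i, j)) (mxtens_index (k, l)) =
  \sum_(0 <= p < n) Uq_R_coef p i j * ((actE F n ^+ p) i k * (actF F n ^+ p) j l).
Proof.
apply: etrans (kronE (Uq_R F n) i j k l) _.
rewrite big_allpairs_dep /index_iota subn0; apply: eq_bigr => p _.
rewrite big_enum /= (bigD1 (i, j)) //= big1 ?addr0 => [|[a b]].
  by rewrite mxE !delta_mulmxE !eqxx !mulr1n mulrA.
rewrite xpair_eqE negb_and => /orP[]; rewrite mxE !delta_mulmxE eq_sym => /negPf ->.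
  by rewrite mulr0 mul0r.
by rewrite mulr0.
Qed.

Lemma Uq_R_coef_rel p i j :
  rel (Uq_R_coef p i j) (R_coef p * qpow (half_wt m i * half_wt m j)).
Proof.
apply: ring_relM rr _ _ _ _ _ _; [apply: ring_relM rr _ _ _ _ _ _|].
- apply: ring_relM rr _ _ _ _ _ _; last exact: kq_rel_qfactV.
  by apply/(ring_relX rr)/kq_rel_qdiff.
- exact: kq_rel_qn.
rewrite -!wt_half; have := kq_rel_q12z charF (wt n i * wt n j).
rewrite rmorphM; congr (kq_rel _ _ (qpow _)).
have nz := two_neq0; rewrite (_ : 4 = 2 * 2 :> Qe); last by rewrite -natrM.
by rewrite invfM mulrACA.
Qed.

Lemma Uq_Rmx_rel : mx_rel rel (Uq_Rmx F n) (R_hat m).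
Proof.
move=> a b; rewrite R_hatE -[X in Uq_Rmx _ _ X](mxtens_unindexK a).
rewrite -[X in Uq_Rmx _ _ _ X](mxtens_unindexK b).
case: (mxtens_unindex a) (mxtens_unindex b) => i j [k l] /=.
rewrite Uq_Rmx_entry; apply: (ring_rel_sum rr) => p _.
apply: (ring_relM rr); first exact: Uq_R_coef_rel.
have rx := mx_rel_ring rr n.
apply: (ring_relM rr); first exact: (ring_relX rx p actE_rel).
exact: (ring_relX rx p actF_rel).
Qed.

End ColoredJonesValue.

Section ColoredJonesRozansky.
Variable F : fieldType.
Hypothesis charF : [pchar F] =i pred0.
Variable m : nat.
Local Notation n := m.+1.
Local Notation S := (fps Qe).
Local Notation rel := (kq_rel charF).
Local Notation rr := (kq_rel_ring charF).

Lemma RT_rel K (b : S) : framing K = 0 -> rep (@gens m) (Z_D K) = b%:M ->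
  mx_rel rel (RT F n K) (b%:M : 'M[S]_n).
Proof.
move=> fr0 <-; have [Xhat [RX ->]] := rep_Z_D_knot_mx m fr0.
rewrite /RT universal_invariant_knot_mx.
apply: knot_mx_rel rr _ _ _ _.
- exact: Uq_Rmx_rel.
- have -> : kron (Uq_Rinv F n) = invmx (Uq_Rmx F n) by apply: kron_pure_tensors.
  exact: (mx_rel_inv rr (@kq_rel_inv _ charF) (@Uq_Rmx_rel _ charF m) RX).
- exact: actK_rel.
exact: actKV_rel.
Qed.

Lemma qint_n_at0 : qint n 0%N != 0.
Proof. by rewrite qint_at0; apply: natf_neq0_char0 char_Qe m. Qed.

(** Since the knot acts as the scalar b, the trace is b times the trace of K. The latter is [n], by
    which the colored Jones polynomial is normalized. *)
Lemma colored_jones_rel K (b : S) :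
  framing K = 0 -> rep (@gens m) (Z_D K) = b%:M -> rel (colored_jones F n K) b.
Proof.
move=> fr0 /(RT_rel fr0) rRT; have nK := fps_invK qint_n_at0.
have [_ rV] := kq_rel_inv (kq_rel_qnum charF n) nK.
have -> : b = \sum_(i < n) (dg (fun i : 'I_n => qpow (half_wt m i)) * b%:M) i i
    * fps_inv (qint n).
  rewrite -mulr_suml -[LHS]mulr1 -nK [RHS]mulrC [RHS]mulrC mulrA; congr (_ * _).
  rewrite mulrC -[qint n]/(\sum_(i < n) qpow (half_wt m i)) mulr_suml.
  by apply: eq_bigr => i _; rewrite -mulmxE mul_dgmx mxE eqxx mulr1n.
rewrite /colored_jones /mxtrace mulr_suml; apply: (ring_rel_sum rr) => i _.
apply: (ring_relM rr); last exact: rV.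
exact: (ring_relM (mx_rel_ring rr n) (@actK_rel _ charF m) rRT i i).
Qed.

(** The series of the P_i and the one obtained from the action of Z_D expand the same element of
    k(q^(1/2)), hence are equal before z := q_eps - 1 is substituted. *)
Lemma tau_rozansky K Delta P rho : laurent_eval (1 : int) 1 Delta = 1 ->
  framing K = 0 -> rozansky_expansion F K Delta P -> BV_expansion K Delta rho ->
  tau (rozansky_series Delta P n) = BV_value m Delta rho.
Proof.
move=> D1 fr0 [_ _ PP] rhoP.
have [g Jg <-] := colored_jones_rel fr0 (rep_BV_expansion m D1 rhoP).
have E := @expands_inj _ charF _ _ _ (PP n (ltn0Sn m)) Jg.
exact: (congr1 (fun f => tau f) E).
Qed.

End ColoredJonesRozansky.

Lemma poly_nat_roots (K : fieldType) (p : {poly K}) : [pchar K] =i pred0 ->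
  (forall i : nat, p.[i.+1%:R] = 0) -> p = 0.
Proof.
move=> charK pr; apply/eqP/negPn/negP => nzp.
have := @max_poly_roots K p [seq i.+1%:R | i <- iota 0 (size p)] nzp.
rewrite size_map size_iota ltnn => H; have//: false.
apply: H; first by apply/allP => _ /mapP[i _ ->]; apply/rootP.
rewrite map_inj_uniq ?iota_uniq // => i j /eqP.
wlog leij : i j / (i <= j)%N => [IH|].
  by case/orP: (leq_total i j) => le /eqP E; [|symmetry]; apply: IH => //; rewrite E.
rewrite -(subnK leij) -addnS natrD -subr_eq0 opprD addrCA subrr addr0 oppr_eq0.
case: (j - i)%N => [|l]; first by rewrite add0n.
by rewrite (negPf (natf_neq0_char0 charK l)).
Qed.

Section Laurent.
Variable K : fieldType.
Hypothesis charK : [pchar K] =i pred0.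

Lemma laurent_eval_incl (R : nzRingType) (u v : R) (P : laurent) (A : {fset int}) :
  (finsupp P `<=` A)%fset -> laurent_eval u v P =
  \sum_(i <- A) (if i is Negz k then v ^+ k.+1 else u ^+ `|i|%N) *~ P i.
Proof.
move=> sPA; rewrite /laurent_eval; apply: big_fset_incl => // i _ iP.
by rewrite fsfun_dflt // mulr0z.
Qed.

(** Multiplication by s^M, where M bounds all exponents, turns the difference of the two values into
    a polynomial in s, and s is transcendental. *)
Lemma laurent_eval_inj (s t : fps K) (P Q : laurent) : s * t = 1 ->
  s 0%N = 1 -> s <> 1 -> laurent_eval s t P = laurent_eval s t Q -> P = Q.
Proof.
move=> st s0 s1; pose A := (finsupp P `|` finsupp Q)%fset.
rewrite (@laurent_eval_incl _ _ _ P A) ?fsubsetUl //.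
rewrite (@laurent_eval_incl _ _ _ Q A) ?fsubsetUr // => /eqP.
rewrite -subr_eq0 -sumrB => /eqP E.
pose M := (\sum_(i <- A) `|i|)%N.
have leM i : i \in A -> (`|i| <= M)%N.
  by move=> iA; rewrite /M (big_rem i iA) leq_addr.
pose p : {poly K} := \sum_(i <- A) (P i - Q i)%:~R *: 'X^`|(i + M%:Z)%R|.
have p0 : p = 0.
  apply: (poly_at_fps_inj s0 s1); rewrite rmorph_sum horner_sum.
  apply: etrans _ (etrans (congr1 (fun x => s ^+ M * x) E) (mulr0 _)).
  rewrite /= mulr_sumr.
  rewrite big_seq [RHS]big_seq; apply: eq_bigr => i /leM lei.
  rewrite map_polyZ map_polyXn hornerZ hornerXn rmorph_int -mulrzBr mulrzl mulrzAr.
  congr (_ *~ _); case: i lei => k lek.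
    by rewrite -exprD addnC.
  have -> : `|(Negz k + M%:Z)%R|%N = (M - k.+1)%N.
    by move: lek; rewrite NegzE; clearbody M; clear; lia.
  rewrite -{2}(subnK lek) exprD -mulrA -exprMn st expr1n mulr1 //.
apply/fsfunP => i; have [iA|] := boolP (i \in A); last first.
  by rewrite inE negb_or => /andP[iP iQ]; rewrite !fsfun_dflt.
have := congr1 (fun p : {poly K} => p`_(`|(i + M%:Z)%R|)) p0.
rewrite coef0 coef_sum (bigD1_seq i) ?fset_uniq //= big1_seq => [|j /andP[nji jA]].
  rewrite addr0 coefZ coefXn eqxx mulr1 => /(intr_inj_char0 charK)/eqP.
  by rewrite subr_eq0 => /eqP.
rewrite coefZ coefXn; case: eqP => [Eij|]; last by rewrite mulr0.
case/eqP: nji; have := leM _ jA; have := leM _ iA; move: Eij; lia.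
Qed.

End Laurent.

(** * Separation of the variables h and u = n h *)

Section Rescale.
Variable n : nat.
Local Notation S := (fps Qe).

Lemma rescale_ord : fps_ord 1 (fps_cst n%:R * fps_X : S).
Proof. exact/fps_ordMl/fps_ord_X. Qed.

Definition rescale : {rmorphism S -> S} :=
  fps_subst_morph (@fps_cst Qe) rescale_ord (fun g => mulrC _ g).

Lemma rescale_coef f i : rescale f i = f i * n%:R ^+ i.
Proof.
apply: etrans (fps_subst_coef _ rescale_ord _ (ltnSn i)) _.
have termE j : (fps_cst (f j) * (fps_cst n%:R * fps_X) ^+ j) i =
    f j * n%:R ^+ j * (i == j)%:R.
  by rewrite fps_coefCM exprMn -rmorphXn fps_coefCM fps_coefXn mulrA.
rewrite fps_coef_sum; apply: etrans (eq_bigr _ (fun j _ => termE (j : 'I__))) _.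
rewrite big_ord_recr big1 => [|j _].
  by rewrite /= add0r eqxx mulr1.
by rewrite /= (gtn_eqF (ltn_ord j)) mulr0.
Qed.

Lemma rescale_cst c : rescale (fps_cst c) = fps_cst c.
Proof. exact: fps_subst_cst _ rescale_ord _. Qed.

Lemma rescale_expc c : rescale (expc c) = expc (c * n%:R).
Proof.
by apply: fpsP => i; apply: etrans (rescale_coef _ _) _; rewrite /= exprMn mulrAC.
Qed.

Lemma rescale_inv1 (f : S) : f 0%N = 1 -> rescale (fps_inv1 f) = fps_inv1 (rescale f).
Proof.
move=> f0; have fK := fps_inv1K f0.
have r0 : rescale f 0%N = 1 by apply: etrans (rescale_coef _ _) _; rewrite f0 mulr1.
have rK := fps_inv1K r0; have E : rescale f * rescale (fps_inv1 f) = 1.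
  by apply: etrans (esym (rmorphM rescale _ _)) _; rewrite fK; apply: rmorph1.
move: (rescale f) (rescale (fps_inv1 f)) (fps_inv1 (rescale f)) rK E => u v w uw uv.
by rewrite -[LHS]mulr1 -uw mulrA [v * u]mulrC uv mul1r.
Qed.

(* The specialization u := n h at the outer variable v := h *)
Definition ev : {rmorphism fps S -> S} :=
  fps_subst_morph rescale (@fps_ord_X Qe) (fun g => mulrC _ g).

Lemma ev_cst c : ev (fps_cst c) = rescale c.
Proof. exact: fps_subst_cst _ (@fps_ord_X Qe) _. Qed.

Lemma ev_X : ev fps_X = fps_X.
Proof. exact: fps_subst_X _ (@fps_ord_X Qe). Qed.

Lemma ev_sum k0 (u : nat -> fps S) : (forall k, fps_ord k (u k)) ->
  ev (fps_sum k0 u) = fps_sum k0 (fun k => ev (u k)).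
Proof.
by move=> ordu; apply: (@fps_subst_sum _ _ rescale fps_X (@fps_ord_X Qe) (fun g => mulrC _ g) k0 u ordu).
Qed.

Lemma ev_coef (b : fps S) N : ev b N = \sum_(j < N.+1) b (N - j)%N j * n%:R ^+ j.
Proof.
apply: etrans (fps_subst_coef _ (@fps_ord_X Qe) _ (ltnSn N)) _.
rewrite fps_coef_sum [RHS](reindex_inj rev_ord_inj); apply: eq_bigr => i _.
have leiN : (i <= N)%N by rewrite -ltnS ltn_ord.
rewrite -[rev_ord i : nat]/(N.+1 - i.+1)%N subSS (subKn leiN).
apply: etrans (congr1 (fun f : S => f N) (mulrC _ _)) _.
by rewrite fps_coefXnM ltnNge leiN; apply: rescale_coef.
Qed.

(** In [fps S] the outer variable stands for h and the inner one for u; [outer] embeds series in h,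
    and [fps_cst] series in u. *)
Definition outer : {rmorphism S -> fps S} := fps_map (@fps_cst Qe).

Lemma ev_outer f : ev (outer f) = f.
Proof.
apply: fpsP => N; rewrite ev_coef big_ord_recl big1 => [|j _].
  by rewrite addr0 mulr1 subn0.
by rewrite /= mul0r.
Qed.

End Rescale.

(** By [ev_coef] the coefficient of degree i + j of a specialization is a polynomial in n with
    b_(i,j) as coefficient of n^j. Its values at all positive integers determine it in
    characteristic 0. *)
Lemma ev_inj (b c : fps (fps Qe)) : (forall m, ev m.+1 b = ev m.+1 c) -> b = c.
Proof.
move=> E; apply: fpsP => i; apply: fpsP => j.
pose p : {poly Qe} := \poly_(l < (i + j).+1) (b (i + j - l)%N l - c (i + j - l)%N l).
have p0 : p = 0.
  apply: (poly_nat_roots char_Qe) => m; rewrite horner_poly.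
  have := congr1 (fun f : fps Qe => f (i + j)%N) (E m); rewrite !ev_coef => /eqP.
  rewrite -subr_eq0 -sumrB => /eqP E0; apply: etrans _ E0; apply: eq_bigr => l _.
  exact: mulrBl.
have := congr1 (fun p : {poly Qe} => p`_j) p0.
by rewrite coef_poly ltnS leq_addl coef0 addnK => /subr0_eq.
Qed.

Lemma inv1_morph (R R' : comNzRingType) (f : {rmorphism fps R -> fps R'}) (g : fps R) :
  g 0%N = 1 -> f g 0%N = 1 -> f (fps_inv1 g) = fps_inv1 (f g).
Proof.
move=> g0 fg0; have gK := fps_inv1K g0; have fgK := fps_inv1K fg0.
have E : f g * f (fps_inv1 g) = 1.
  by apply: etrans (esym (rmorphM f _ _)) _; rewrite gK; apply: rmorph1.
move: (f g) (f (fps_inv1 g)) (fps_inv1 (f g)) fgK E => u v w uw uv.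
by rewrite -[LHS]mulr1 -uw mulrA [v * u]mulrC uv mul1r.
Qed.

(** * Comparison of the coefficients of h *)

Section Comparison.
Variables (Delta : laurent) (P : nat -> laurent) (rho : nat -> nat -> laurent).
Hypothesis Delta1 : laurent_eval (1 : int) 1 Delta = 1.
Local Notation S := (fps Qe).
Local Notation B := (fps (fps Qe)).

(** This is Q(e^(eps u)); u := n h turns it into Q(q_eps^n). *)
Definition laurent_exp (Q : laurent) : S := laurent_eval (expc eps) (expc (- eps)) Q.

Lemma rescale_laurent_exp m Q : rescale m.+1 (laurent_exp Q) = eval_qn m Q.
Proof.
apply: etrans (laurent_eval_morph (rescale m.+1) _ _ Q) _.
apply: etrans (congr2 (fun u v => laurent_eval u v Q) (rescale_expc _ _) (rescale_expc _ _)) _.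
by rewrite mulNr -mulrN.
Qed.

Lemma laurent_exp_Delta0 : laurent_exp Delta 0%N = 1.
Proof.
apply: etrans (laurent_eval_morph (@fps_at0 Qe) _ _ _) _.
apply: etrans (congr2 (fun u v => laurent_eval u v Delta) (expc_at0 _) (expc_at0 _)) _.
by rewrite laurent_eval11 Delta1.
Qed.

Let d : S := fps_inv1 (laurent_exp Delta).

Lemma ev_d m : ev m.+1 (fps_cst d) = fps_inv1 (eval_qn m Delta).
Proof.
apply: etrans (ev_cst _ _) _; rewrite -rescale_laurent_exp.
apply: inv1_morph laurent_exp_Delta0 _.
by apply: etrans (rescale_coef _ _ _) _; rewrite laurent_exp_Delta0 mulr1.
Qed.

Lemma ev_laurent m Q : ev m.+1 (fps_cst (laurent_exp Q)) = eval_qn m Q.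
Proof. exact: etrans (ev_cst _ _) (rescale_laurent_exp m Q). Qed.

Lemma evM n u v a b : ev n u = a -> ev n v = b -> ev n (u * v) = a * b.
Proof. by move=> <- <-; apply: rmorphM. Qed.

Lemma evX n u a k : ev n u = a -> ev n (u ^+ k) = a ^+ k.
Proof. by move=> <-; apply: rmorphXn. Qed.

Definition Rozansky_term (i : nat) : B :=
  fps_cst (laurent_exp (P i)) * fps_cst d ^+ (2 * i + 1) * outer (qpow 1 - 1) ^+ i.

Definition Rozansky_B : B := fps_sum 0 Rozansky_term.

Lemma outer_ord1 (f : S) : f 0%N = 0 -> fps_ord 1 (outer f).
Proof.
move=> f0 [|//] _; rewrite -[LHS]/(fps_cst (f 0%N)) f0; apply: rmorph0.
Qed.

Lemma qpow1_at0 : (qpow 1 - 1 : S) 0%N = 0.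
Proof. by rewrite fps_coefB fps_coef1 qpow_at0 subrr. Qed.

Lemma Rozansky_term_ord i : fps_ord i (Rozansky_term i).
Proof. apply: fps_ordMl; apply: fps_ord1X; exact: outer_ord1 qpow1_at0. Qed.

Lemma tau_eval_q2n m Q : tau (eval_q2n m.+1 Q) = eval_qn m Q.
Proof.
have u0 : ((1 + fps_X) ^+ m.+1 : fps rat) 0%N = 1.
  rewrite -[LHS]/(fps_at0 _) rmorphXn rmorphD rmorph1.
  by rewrite [X in 1 + X](_ : _ = 0) // addr0 expr1n.
have tu : tau ((1 + fps_X) ^+ m.+1) = qpow m.+1%:R.
  apply: etrans (rmorphXn tau m.+1 _) _; rewrite (qpowMn 1); congr (_ ^+ _).
  apply: etrans (rmorphD tau 1 fps_X) _.
  by apply: etrans (congr2 +%R (rmorph1 tau) tau_X) _; rewrite addrC subrK.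
apply: etrans (laurent_eval_morph tau _ _ Q) _.
apply: (congr2 (fun u v => laurent_eval u v Q)); first exact: tu.
apply: etrans (inv1_morph u0 _) _; first by rewrite tu qpow_at0.
rewrite tu; have := fps_inv1K (qpow_at0 m.+1%:R); have := qpowN m.+1%:R.
move: (qpow _) (qpow _) (fps_inv1 _) => u v w uv uw.
by rewrite -[LHS]mulr1 -uv mulrA [w * v]mulrC uw mul1r.
Qed.

Lemma eval_q2n_Delta0 n : eval_q2n n Delta 0%N = 1.
Proof.
have at0 : fps_at0 ((1 + fps_X) ^+ n : fps rat) = 1.
  rewrite rmorphXn rmorphD rmorph1.
  by rewrite [X in 1 + X](_ : _ = 0) // addr0 expr1n.
have at0V : fps_at0 (fps_inv1 ((1 + fps_X) ^+ n : fps rat)) = 1.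
  apply: etrans (esym (mul1r _)) _; rewrite -{1}at0.
  apply: etrans (esym (rmorphM (@fps_at0 rat) _ _)) _.
  by rewrite (fps_inv1K at0); apply: rmorph1.
apply: etrans (laurent_eval_morph (@fps_at0 rat) _ _ _) _.
apply: etrans (congr2 (fun u v => laurent_eval u v Delta) at0 at0V) _.
by rewrite laurent_eval11 Delta1.
Qed.

Lemma ev_Rozansky m : ev m.+1 Rozansky_B = tau (rozansky_series Delta P m.+1).
Proof.
apply: etrans (ev_sum _ _ Rozansky_term_ord) _; apply/esym.
apply: etrans (@fps_subst_sum _ _ _ _ tau_ord (fun g => mulrC _ g) _ _ _) _.
  by move=> k; apply: fps_ordMl; apply: fps_ord1X; apply: fps_ord_X.
apply: (congr1 (fps_sum 0)); apply: funext => i; apply: esym.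
transitivity (tau (eval_q2n m.+1 (P i)) *
    tau (fps_inv1 (eval_q2n m.+1 Delta)) ^+ (2 * i + 1) * tau fps_X ^+ i).
  apply: evM; last by apply: evX; rewrite tau_X; apply: ev_outer.
  apply: evM; first by rewrite tau_eval_q2n; apply: ev_laurent.
  apply: evX; apply: etrans (ev_d m) _; rewrite -tau_eval_q2n; apply/esym.
  apply: inv1_morph (eval_q2n_Delta0 _) _.
  by rewrite tau_eval_q2n; apply: eval_qn_Delta0.
have tM u v : tau (u * v) = tau u * tau v by apply: (rmorphM tau).
have tX u k : tau (u ^+ k) = tau u ^+ k by apply: (rmorphXn tau).
by apply/esym; apply: etrans (tM _ _) _; rewrite tX; apply: etrans (congr1 (fun x => x * _) (tM _ _)) _; rewrite tX.
Qed.

Definition W_factor : S :=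
  - (fps_cst 2^-1 * (qpow 2^-1 - 1) * fps_inv (qpow 2^-1 + 1)).

Definition hW_B : B := fps_cst (1 + expc eps) * outer W_factor.

Lemma ev_hW m : ev m.+1 hW_B = hW_val m.
Proof.
transitivity ((1 + qpow m.+1%:R) * W_factor).
  apply: evM; last exact: ev_outer.
  apply: etrans (ev_cst _ _) _; apply: etrans (rmorphD (rescale m.+1) 1 _) _.
  refine (congr2 (fun x y : S => x + y) (_ : rescale m.+1 1 = 1)
    (rescale_expc m.+1 eps : _ = qpow m.+1%:R)).
  exact: rmorph1.
rewrite /W_factor /hW_val; move: (fps_cst _) (qpow _) (qpow _) (fps_inv _).
by move=> x y z t; ring.
Qed.

Lemma outer_at0 f : outer f 0%N = fps_cst (f 0%N).
Proof. by []. Qed.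

(** The factor q_eps^(1/2) - 1 vanishes at h = 0. So h W is divisible by h even when u = n h is kept
    fixed, and rho_(k,j) enters only from order k + j in h on; this isolates rho_(1,0). *)
Lemma hW_B_at0 : hW_B 0%N = 0.
Proof.
rewrite fps_coefCM outer_at0 (_ : W_factor 0%N = 0) ?rmorph0 ?mulr0 //.
rewrite /W_factor fps_coefN -mulrA fps_coefCM fps_coefM big_ord1 fps_coefB.
by rewrite fps_coef1 qpow_at0 subrr mul0r mulr0 oppr0.
Qed.

Definition BV_sum (k : nat) : B := \sum_(0 <= j < (2 * k).+1)
  fps_cst (laurent_exp (rho k j)) * hW_B ^+ j * fps_cst d ^+ (2 * k - j).

Definition BV_term_B (k : nat) : B := outer (fps_cst (eps ^+ k)) * fps_X ^+ k * BV_sum k.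

Definition BV_B : B := fps_cst d *
  fps_sum 0 (fun k => outer (fps_cst (k`!%:R^-1)) * fps_sum 1 BV_term_B ^+ k).

Lemma BV_term_B_ord k : fps_ord k (BV_term_B k).
Proof. by apply/fps_ordMr/fps_ordMl/fps_ord1X/fps_ord_X. Qed.

Lemma BV_sum_B_ord : fps_ord 1 (fps_sum 1 BV_term_B).
Proof. by move=> [|//] _; apply: etrans (big_geq _) _. Qed.

Lemma ev_BV m : ev m.+1 BV_B = BV_value m Delta rho.
Proof.
apply: evM (ev_d m) _.
apply: etrans (ev_sum _ _ _) _.
  by move=> k; apply: fps_ordMl; apply: fps_ord1X; apply: BV_sum_B_ord.
apply: (congr1 (fps_sum 0)); apply: funext => k; apply: evM (ev_outer _ _) _.
apply: evX; apply: etrans (ev_sum _ _ BV_term_B_ord) _.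
apply: (congr1 (fps_sum 1)); apply: funext => {}k.
apply: evM; first by apply: evM; [apply: ev_outer | apply: evX; apply: ev_X].
apply: etrans (rmorph_sum (ev m.+1) _ _ _) _; apply: eq_bigr => j _.
apply: evM; last by apply: evX; apply: ev_d.
by apply: evM (ev_laurent _ _) _; apply: evX; apply: ev_hW.
Qed.

Lemma Rozansky_coef1 :
  Rozansky_B 1%N = laurent_exp (P 1%N) * d ^+ 3 * fps_cst eps.
Proof.
have T0 : Rozansky_term 0 1%N = 0.
  by rewrite /Rozansky_term mulr1 -rmorphXn -rmorphM.
have T1 : Rozansky_term 1 1%N = laurent_exp (P 1%N) * d ^+ 3 * fps_cst eps.
  rewrite /Rozansky_term expr1 -rmorphXn -rmorphM fps_coefCM; congr (_ * _).
  rewrite -[LHS]/(fps_cst ((qpow 1 - 1) 1%N)) fps_coefB fps_coef1 subr0.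
  by rewrite -[qpow 1 1%N]/((eps * 1) ^+ 1 / (1`!)%:R) divr1 mulr1 expr1.
rewrite -[LHS]/(\sum_(0 <= k < 2) Rozansky_term k 1%N) big_nat_recr // big_nat1.
exact: etrans (congr2 (fun x y : S => x + y) T0 T1) (add0r _).
Qed.

Lemma BV_term_coef1 :
  BV_term_B 1 1%N = fps_cst eps * (laurent_exp (rho 1%N 0%N) * d ^+ 2).
Proof.
rewrite /BV_term_B !expr1 -mulrA -[outer _]/(outer (fps_cst eps)).
have -> : outer (fps_cst eps) = fps_cst (fps_cst eps).
  by apply: fpsP => -[|i] //; apply: rmorph0.
rewrite fps_coefCM; congr (_ * _).
rewrite fps_coefXM; apply: etrans (fps_coef_sum _ _ _ _) _.
rewrite muln1 big_nat_recl // big1 => [|j _].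
  apply: etrans (addr0 _) _.
  by rewrite expr0 mulr1 -rmorphXn -rmorphM.
have hW1 : fps_ord 1 hW_B by move=> [|//] _; apply: hW_B_at0.
have: fps_ord 1 (fps_cst (laurent_exp (rho 1%N j.+1)) * hW_B ^+ j.+1
    * fps_cst d ^+ (2 - j.+1)).
  by apply: fps_ordMr; apply: fps_ordMl; rewrite exprS; apply: fps_ordMr.
by apply.
Qed.

(** The exponent is divisible by h, so that in degree 1 only the linear term of the exponential
    counts, and of the exponent only k = 1. *)
Lemma BV_coef1 : BV_B 1%N = d * (fps_cst eps * (laurent_exp (rho 1%N 0%N) * d ^+ 2)).
Proof.
rewrite fps_coefCM; congr (_ * _).
have T0 : (outer (fps_cst (0`!%:R^-1)) * fps_sum 1 BV_term_B ^+ 0) 1%N = 0.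
  by rewrite mulr1 -[LHS]/(fps_cst (0 : Qe)); apply: rmorph0.
have T1 : (outer (fps_cst (1`!%:R^-1)) * fps_sum 1 BV_term_B ^+ 1) 1%N = BV_term_B 1 1%N.
  have -> : outer (fps_cst (1`!%:R^-1)) = 1.
    by rewrite invr1 -[RHS](rmorph1 outer) -[in RHS](rmorph1 (@fps_cst Qe)).
  rewrite mul1r expr1 -[LHS]/(\sum_(1 <= k < 2) BV_term_B k 1%N).
  exact: big_nat1.
rewrite -[LHS]/(\sum_(0 <= k < 2)
  (outer (fps_cst (k`!%:R^-1)) * fps_sum 1 BV_term_B ^+ k) 1%N).
rewrite big_nat_recr // big_nat1.
apply: etrans (congr2 (fun x y : S => x + y) T0 T1) _.
by rewrite add0r BV_term_coef1.
Qed.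

Lemma rho_eq_P :
  (forall m, tau (rozansky_series Delta P m.+1) = BV_value m Delta rho) ->
  rho 1%N 0%N = P 1%N.
Proof.
move=> E; have EB : Rozansky_B = BV_B.
  by apply: ev_inj => m; rewrite ev_Rozansky ev_BV.
have := congr1 (fun b : B => b 1%N) EB; rewrite Rozansky_coef1 BV_coef1.
have -> : d * (fps_cst eps * (laurent_exp (rho 1%N 0%N) * d ^+ 2))
    = fps_cst eps * (d ^+ 3 * laurent_exp (rho 1%N 0%N)).
  by move: (laurent_exp _) (fps_cst eps) d => x y z; ring.
have -> : laurent_exp (P 1%N) * d ^+ 3 * fps_cst eps
    = fps_cst eps * (d ^+ 3 * laurent_exp (P 1%N)).
  by move: (laurent_exp _) (fps_cst eps) d => x y z; ring.
have dK := fps_inv1K laurent_exp_Delta0.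
have d3 : d ^+ 3 <> 0.
  move=> d30; have := congr1 (fun x => x ^+ 3) dK; rewrite exprMn -/d d30.
  by rewrite mulr0 expr1n => /eqP; rewrite eq_sym oner_eq0.
have e0 : (fps_cst eps : S) <> 0.
  by move/(congr1 (fun f : S => f 0%N)); apply/eqP/eps_neq0.
(* Cancelling eps and Delta^-3 leaves an equality of values at e^(eps u), which is transcendental
   because eps is nonzero. *)
move=> H; have EL := fps_mulIf d3 (fps_mulIf e0 H); apply/esym.
apply: (laurent_eval_inj char_Qe _ (expc_at0 _) _ EL); first exact: (expcK char_Qe).
exact: expc_neq1 eps_neq0.
Qed.

End Comparison.

Theorem theorem1p1 (k : fieldType) (k_char0 : [pchar k] =i pred0)
    (K : long_knot) (K_0framed : framing K = 0)
    (Delta : laurent) (DeltaP : is_alexander K Delta)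
    (P : nat -> laurent) (PP : rozansky_expansion k K Delta P)
    (rho : nat -> nat -> laurent) (rhoP : BV_expansion K Delta rho) :
  rho 1%N 0%N = P 1%N.
Proof.
have [_ Delta1 _] := DeltaP; apply: (rho_eq_P Delta1) => m.
exact: (@tau_rozansky k k_char0 m K Delta P rho Delta1 K_0framed PP rhoP).
Qed.
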